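(* Let $a\in\mathbb{R}$. The singular set image $u\mapsto f(u,0)$ of a germ $f$ of non-generic swallowtail in $M^3(a)$ must be a generic space-cusp in $M^3(a)$. In particular, there are no asymptotic swallowtails along a non-generic space-cusp. Moreover, for any given generic space-cusp $\gamma$ in $M^3(a)$, there exists an asymptotic swallowtail along $\gamma$ (that is, with $f(u,0)=\gamma(u)$).
   Context: $M^3(a)$ is the (oriented) complete simply connected Riemannian $3$-manifold of constant sectional curvature $a$, with metric $g=\langle\,,\rangle$ and Levi-Civita connection $\nabla$. Let $o=(0,0)\in\mathbb{R}^2$. Swallowtail: a germ $f$ at $o$ of a $C^\infty$-map into $M^3(a)$ is a swallowtail if there are a diffeomorphism germ $\varphi$ of $\mathbb{R}^2$ at the origin and a diffeomorphism germ $\Phi$ from $M^3(a)$ to $\mathbb{R}^3$ with $\Phi(f(o))=\mathbf 0$ such that $\Phi\circ f\circ\varphi$ is $(u,v)\mapsto(u,2v^3+uv,3v^4+uv^2)$. Swallowtails are taken with admissible parametrizations, i.e. the $u$-axis is the singular set. Such an $f$ has a smooth unit normal vector field $\nu$, chosen so that $\det_g(\nabla_vf_u(o),f_v(o),\nu(o))>0$; set $\sigma^S_g:=\mathrm{sgn}\,\langle\nabla_vf_v(o),\nu(o)\rangle$. The swallowtail is generic if $\sigma^S_g\ne0$, non-generic if $\sigma_g^S=0$. Limiting normal curvature along the singular set: $\kappa_\nu(o)=\langle\nabla_vf_v(o),\nu(o)\rangle/\langle f_v(o),f_v(o)\rangle$ and, at $(u,0)$ with $u\neq0$, $\kappa_\nu(u)=\langle\nabla_uf_u,\nu\rangle/\langle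 f_u,f_u\rangle$. The swallowtail is asymptotic if its limiting normal curvature vanishes identically along the singular set. A germ at $u=0$ of a $C^\infty$-curve $\gamma$ in $M^3(a)$ is a space-cusp if $\gamma'(u)$ vanishes if and only if $u=0$ and $\nabla_u\gamma'(0),\nabla_u\nabla_u\gamma'(0)$ are linearly independent; it is generic if moreover $\nabla_u\gamma'(0),\nabla_u\nabla_u\gamma'(0),\nabla_u\nabla_u\nabla_u\gamma'(0)$ are linearly independent, and non-generic otherwise. *)

(* Defs.v *)
From HB Require Import structures.
From mathcomp Require Import all_boot all_order all_algebra.
From mathcomp Require Import all_classical all_reals all_analysis.
Set Implicit Arguments.
Unset Strict Implicit.
Unset Printing Implicit Defensive.
Import Order.TTheory GRing.Theory Num.Theory.
Import numFieldNormedType.Exports.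
Local Open Scope classical_set_scope.
Local Open Scope ring_scope.

Section Smooth.
Context {R : realType}.

Fixpoint Ck (V W : normedModType R) (k : nat) (U : set V) (f : V -> W) : Prop :=
  match k with
  | 0 => forall x, U x -> {for x, continuous f}
  | k'.+1 => (forall x, U x -> differentiable f x) /\
             (forall v, Ck k' U (fun x => 'D_v f x))
  end.

(* f represents a C^oo germ at p: one open neighbourhood serves all orders. *)
Definition smooth_at (V W : normedModType R) (p : V) (f : V -> W) : Prop :=
  exists2 U : set V, open_nbhs p U & forall k, Ck k U f.

(* F represents a diffeomorphism germ from (X, p) to (Y, q), for submanifolds
   X, Y of normed spaces: F and a local inverse G are restrictions to X and Y of
   smooth maps defined on neighbourhoods in the ambient spaces. *)
Definition diffeo_germ (V W : normedModType R) (X : set V) (Y : set W)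
    (p : V) (q : W) (F : V -> W) : Prop :=
  [/\ F p = q, smooth_at p F &
    exists G : W -> V,
      [/\ G q = p, smooth_at q G,
          \forall x \near p, X x -> Y (F x) /\ G (F x) = x &
          \forall y \near q, Y y -> X (G y) /\ F (G y) = y]].

End Smooth.

Section SpaceForm.
Context {R : realType}.

(* For V = (V_0, V_1, V_2, V_3) and W, the product of the spatial parts. *)
Definition sdot (V W : 'rV[R]_4) : R :=
  \sum_(i < 3) V 0 (lift 0 i) * W 0 (lift 0 i).

(* M^3(a), as the quadric p_0^2 + a (p_1^2 + p_2^2 + p_3^2) = 1 in R^4, with the
   sheet p_0 > 0 when a <= 0: a round sphere of radius 1 / sqrt a (with p_0
   measured in units of that radius), the affine space {1} * R^3, or the upper
   sheet of a hyperboloid. *)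
Definition M3 (a : R) : set 'rV[R]_4 :=
  [set p : 'rV[R]_4 | p 0 0 ^+ 2 + a * sdot p p = 1 /\ (a <= 0 -> 0 < p 0 0)].

Definition tangent (a : R) (p V : 'rV[R]_4) : Prop :=
  p 0 0 * V 0 0 + a * sdot p V = 0.

(* The Riemannian metric of M^3(a) is the restriction to tangent vectors of this
   ambient form.  When a = 0, tangent vectors satisfy V_0 = 0, so the first term
   plays no role (and a^-1 = 0 by convention). *)
Definition metric (a : R) (V W : 'rV[R]_4) : R :=
  a^-1 * (V 0 0 * W 0 0) + sdot V W.

(* The Riemannian volume form at p: the isometries in the identity component
   are linear maps of R^4 of determinant 1 acting transitively on M3 a, and at
   p = (1, 0, 0, 0) this is the determinant of the spatial parts. *)
Definition detg (p X Y Z : 'rV[R]_4) : R :=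
  \det (\matrix_(i < 4) [:: p; X; Y; Z]`_i).

(* nabla_w X at p, for a tangent vector field X along f : T -> M3 a.  This is the
   metric-orthogonal projection of the ambient derivative D_w X to the tangent
   space at f p: the form takes the value a^-1 on (f p, f p), and
   <D_w X, f> = - <D_w f, X> because <X, f> = 0 (a <> 0); when a = 0 the
   ambient derivative is already tangent. *)
Definition cov (T : normedModType R) (a : R) (f : T -> 'rV[R]_4) (w : T)
    (X : T -> 'rV[R]_4) (p : T) : 'rV[R]_4 :=
  'D_w X p + (a * metric a ('D_w f p) (X p)) *: f p.

End SpaceForm.

Section Swallowtails.
Context {R : realType}.
Implicit Types (a : R) (f nu : 'rV[R]_2 -> 'rV[R]_4).

Definition pt (u v : R) : 'rV[R]_2 := \row_(i < 2) [:: u; v]`_i.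

Definition eu : 'rV[R]_2 := pt 1 0.
Definition ev : 'rV[R]_2 := pt 0 1.

Definition du f : 'rV[R]_2 -> 'rV[R]_4 := fun p => 'D_eu f p.
Definition dv f : 'rV[R]_2 -> 'rV[R]_4 := fun p => 'D_ev f p.

Definition std_swallowtail (p : 'rV[R]_2) : 'rV[R]_3 :=
  let u := p 0 0 in let v := p 0 1 in
  \row_(i < 3) [:: u; 2 * v ^+ 3 + u * v; 3 * v ^+ 4 + u * v ^+ 2]`_i.

(* The singular set of the germ is the u-axis. *)
Definition admissible f : Prop :=
  \forall p \near (0 : 'rV[R]_2), ~~ free [:: du f p; dv f p] <-> p 0 1 = 0.

Definition swallowtail a f : Prop :=
  [/\ smooth_at 0 f,
      \forall p \near (0 : 'rV[R]_2), M3 a (f p),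
      exists (phi : 'rV[R]_2 -> 'rV[R]_2) (Phi : 'rV[R]_4 -> 'rV[R]_3),
        [/\ diffeo_germ setT setT 0 0 phi,
            diffeo_germ (M3 a) setT (f 0) 0 Phi &
            \forall p \near (0 : 'rV[R]_2),
              Phi (f (phi p)) = std_swallowtail p] &
      admissible f].

Definition unit_normal a f nu : Prop :=
  [/\ smooth_at 0 nu,
      \forall p \near (0 : 'rV[R]_2),
        [/\ tangent a (f p) (nu p), metric a (nu p) (nu p) = 1,
            metric a (du f p) (nu p) = 0 & metric a (dv f p) (nu p) = 0] &
      0 < detg (f 0) (cov a f ev (du f) 0) (dv f 0) (nu 0)].

Definition sigmaS a f nu : R :=
  Num.sg (metric a (cov a f ev (dv f) 0) (nu 0)).

(* unit_normal determines the germ of nu, hence sigmaS and kappa_nu below. *)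
Definition nongeneric_swallowtail a f : Prop :=
  swallowtail a f /\ exists2 nu, unit_normal a f nu & sigmaS a f nu = 0.

Definition kappa_nu a f nu (u : R) : R :=
  let p := pt u 0 in
  if u == 0 then
    metric a (cov a f ev (dv f) p) (nu p) / metric a (dv f p) (dv f p)
  else
    metric a (cov a f eu (du f) p) (nu p) / metric a (du f p) (du f p).

Definition asymptotic_swallowtail a f : Prop :=
  swallowtail a f /\
  exists2 nu, unit_normal a f nu &
    \forall u \near (0 : R), kappa_nu a f nu u = 0.

End Swallowtails.

Section SpaceCusps.
Context {R : realType}.
Implicit Types (a : R) (c : R^o -> 'rV[R]_4).

Definition velocity c : R^o -> 'rV[R]_4 := fun u => 'D_(1 : R^o) c u.

(* nabla_u X for a vector field X along the curve c *)
Definition covc a c (X : R^o -> 'rV[R]_4) : R^o -> 'rV[R]_4 :=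
  fun u => cov a c (1 : R^o) X u.

Definition space_cusp a c : Prop :=
  [/\ smooth_at (0 : R^o) c,
      \forall u \near (0 : R^o), M3 a (c u),
      \forall u \near (0 : R^o), velocity c u = 0 <-> u = 0 &
      free [:: covc a c (velocity c) 0; covc a c (covc a c (velocity c)) 0]].

Definition generic_space_cusp a c : Prop :=
  space_cusp a c /\
  free [:: covc a c (velocity c) 0;
           covc a c (covc a c (velocity c)) 0;
           covc a c (covc a c (covc a c (velocity c))) 0].

Definition nongeneric_space_cusp a c : Prop :=
  space_cusp a c /\ ~ generic_space_cusp a c.

(* The germ identity f(u, 0) = c(u). *)
Definition along (f : 'rV[R]_2 -> 'rV[R]_4) c : Prop :=
  \forall u \near (0 : R^o), f (pt u 0) = c u.

End SpaceCusps.

(* Main.v *)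
(** Write a swallowtail as f = Psi o std o chi with chart germs chi and Psi.  Along the
    u-axis chi traces the parabola x = - 6 y^2, which std maps to the cusp
    (- 6 s^2, - 4 s^3, - 3 s^4) with velocity - 12 s s' (1, s, s^2).  If a linear form l
    on R^4 kills f and the second to fourth u-derivatives of f(u, 0) at 0, then
    L = l o Psi satisfies L_x = L_y = 0 and L_z = 6 L_xx at 0, so that l kills f_v and
    f_uv, while l(f_vv) is a nonzero multiple of L_xx.  Nongenericity puts f_vv in the
    span of f, f_uv and f_v; hence L_xx = 0 and l = 0, which says that the jets of
    f(u, 0) span R^4, i.e. that the cusp is generic.  An asymptotic swallowtail is
    nongeneric because its limiting normal curvature vanishes at 0.

    Conversely a cusp has the form gamma(t) = G0(t^2) + t^3 G1(t^2) by Whitney's theorem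
    on even functions.  Project radially to M3 the surface
    F = G0(X) + Y G1(X) + W (V0(X) + Y V1(X)) with X = u^2 - v/6,
    Y = u^3 - u v/4 + d v^2/12, W = v^2/12.  It is a swallowtail along gamma, with
    F_u + 12 u F_v = v h, and it is asymptotic when gamma'' lies in the span of
    F, F_v, h along v = 0.  That condition prescribes V(t) = V0(t^2) + t^3 V1(t^2) up to
    constants, and genericity of gamma lets them be chosen so that V'(0) = 0. *)

Require Import Defs.
From HB Require Import structures.
From mathcomp Require Import all_boot all_order all_algebra.
From mathcomp Require Import all_classical all_reals all_analysis.
From mathcomp Require Import ring lra.
Set Implicit Arguments.
Unset Strict Implicit.
Unset Printing Implicit Defensive.
Import Order.TTheory GRing.Theory Num.Theory.
Import numFieldNormedType.Exports.
Local Open Scope classical_set_scope.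
Local Open Scope ring_scope.

(** * Smooth germs *)

Section Differential.
Context {R : realType}.
Implicit Types V W Z : normedModType R.

(** The constants of F come from the chart (u, v) |-> (v - 6 u^2, u), in which the standard
    swallowtail (x, y, z) is singular along v = 0. The substitution X = - x/6, W = z + x^2/12, Y = -
    y/4 + d W carries its singular curve (- 6 t^2, - 4 t^3, - 3 t^4) to (t^2, t^3, 0), and W becomes
    v^2/12. As W vanishes to second order on the axis, V leaves gamma unchanged and enters the
    asymptotic condition only through h = (- 1/4 + 2 d t) G1 + 2 t V. The obstacle is that V(t) must
    be the restriction to the curve (t^2, t^3) of a smooth field in the plane, which forces V'(0) =
    0. What remains free is d and a combination of gamma, gamma'/t and (gamma'/t)' added to h. They
    move V'(0) along the jets of gamma at 0, and these span R^4 when gamma is generic. All geometry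
    is done in R^4 modulo the position vector: covariant and ordinary derivatives differ by
    multiples of f, so tangential statements become 4 x 4 determinants having f as a row, uniformly
    in the sign of a. *)

Lemma near_addr V x (P : set V) : (\near x, P x) -> \forall h \near 0, P (h + x).
Proof. by rewrite (near_shift 0) subr0. Qed.

(** An explicit remainder estimate yields differentiability and the differential together. It serves
    wherever a derivative is produced by hand: germ equality, Hadamard quotients, reflected series,
    local inverses. *)
Lemma differentiable_remainder V W (f : V -> W) x (df : {linear V -> W}) :
  continuous df ->
  (forall e, 0 < e -> \forall h \near 0, `|f (h + x) - f x - df h| <= e * `|h|) ->
  differentiable f x /\ 'd f x = df :> (V -> W).
Proof.
move=> dfc dfe.
have fE : f \o shift x = cst (f x) + df +o_ 0 id.
  apply/eqaddoP => e e0; near=> h.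
  rewrite /= -![(_ + _ : _ -> _) _]/(_ + _) /= -![(- _ : _ -> _) _]/(- _) /=.
  rewrite opprD addrA; near: h; exact: dfe.
have dE : 'd f x = df :> (V -> W) by exact: diff_unique.
by split => //; apply/diff_locallyP; rewrite dE.
Unshelve. all: by end_near. Qed.

Lemma differential_remainder V W (f : V -> W) x : differentiable f x ->
  forall e, 0 < e ->
    \forall h \near 0, `|f (h + x) - f x - 'd f x h| <= e * `|h|.
Proof.
move=> /diff_locally fE e e0.
move/eqaddoP: fE => /(_ e e0); apply: filterS => h /=.
rewrite -![(_ + _ : _ -> _) _]/(_ + _) /= -![(- _ : _ -> _) _]/(- _) /=.
by rewrite opprD addrA.
Qed.

Lemma near_eq_differentiable V W (f g : V -> W) x :
  (\near x, f x = g x) -> differentiable f x -> differentiable g x.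
Proof.
move=> fg df.
suff [] : differentiable g x /\ 'd g x = 'd f x :> (V -> W) by [].
apply: differentiable_remainder; first exact: diff_continuous.
move=> e e0; have fx : f x = g x by exact: nbhs_singleton fg.
have fg0 : \forall h \near 0, f (h + x) = g (h + x).
  exact: (@near_addr _ x (fun y => f y = g y)) fg.
near=> h.
rewrite -(near fg0 h) // -fx.
near: h; exact: differential_remainder.
Unshelve. all: by end_near. Qed.

Lemma open_near V (U : set V) x : open U -> U x -> \near x, U x.
Proof. by move=> Uo Ux; exact: open_nbhs_nbhs. Qed.

End Differential.

(** * Closure properties of C^k functions *)

Section CkTheory.
Context {R : realType}.
Implicit Types V W Z : normedModType R.

Lemma Ck_sub V W k (U U' : set V) (f : V -> W) :
  U' `<=` U -> Ck k U f -> Ck k U' f.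
Proof.
elim: k f => [|k IH] f UU' /=; first by move=> cf x /UU'/cf.
by move=> [df Df]; split=> [x /UU'/df//|v]; exact: IH.
Qed.

Lemma Ck_ext V W k (U : set V) (f g : V -> W) : open U ->
  (forall x, U x -> f x = g x) -> Ck k U f -> Ck k U g.
Proof.
move=> Uo; elim: k f g => [|k IH] f g fg /=.
  move=> cf x Ux; change (g @ x --> g x); rewrite -(fg x Ux).
  apply: cvg_trans (cf x Ux); apply: near_eq_cvg.
  near=> y; rewrite -fg //; near: y; exact: open_near.
have nfg x : U x -> \near x, f x = g x.
  by move=> Ux; near do rewrite fg //; exact: open_near.
move=> [df Df]; split=> [x Ux|v].
  exact: near_eq_differentiable (nfg _ Ux) (df _ Ux).
by apply: IH (Df v) => x Ux; apply: near_eq_derive; exact: nfg.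
Unshelve. all: by end_near. Qed.

(** The definition of [Ck] speaks of the total function ['D_v f], while a formula for it holds only
    on [U]; openness of [U] makes the two agree near each of its points, which is all that [Ck_ext]
    asks. *)
Lemma CkS V W k (U : set V) (f : V -> W) (df : V -> V -> W) : open U ->
  (forall x, U x -> differentiable f x) ->
  (forall v x, U x -> 'D_v f x = df v x) -> (forall v, Ck k U (df v)) ->
  Ck k.+1 U f.
Proof.
by move=> Uo fd fdf dfC; split => // v; apply: Ck_ext (dfC v) => // x Ux; rewrite fdf.
Qed.

Lemma Ck_pred V W k (U : set V) (f : V -> W) : Ck k.+1 U f -> Ck k U f.
Proof.
elim: k f => [|k IH] f [df Df].
  by move=> x /df; exact: differentiable_continuous.
by split => // v; exact: IH.
Qed.

Lemma Ck_cst V W k (U : set V) (w : W) : Ck k U (fun=> w : W).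
Proof.
elim: k w => [|k IH] w; first by move=> x _; exact: cvg_cst.
split=> [x _|v]; first exact: differentiable_cst.
suff -> : (fun x => 'D_v (fun=> w : W) x) = fun=> 0 by exact: IH.
by apply/funext => x; exact: derive_cst.
Qed.

Lemma Ck_lin V W Z k (U : set V) (l : {linear W -> Z}) (f : V -> W) :
  continuous l -> open U -> Ck k U f -> Ck k U (fun x => l (f x)).
Proof.
move=> lc Uo; elim: k f => [|k IH] f.
  by move=> cf x Ux; apply: continuous_comp; [exact: cf|exact: lc].
move=> [df Df]; apply: (@CkS _ _ _ _ _ (fun v x => l ('D_v f x))) => //.
- by move=> x Ux; apply: differentiable_comp; [exact: df|exact: linear_differentiable].
- move=> v x Ux; have dl := @linear_differentiable _ _ _ l (f x) lc.
  rewrite deriveE; last by apply: differentiable_comp => //; exact: df.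
  by rewrite diff_comp //=; [rewrite diff_lin // deriveE //|]; exact: df.
- by move=> v; apply: IH; exact: Df.
Qed.

Lemma Ck_add V W k (U : set V) (f g : V -> W) : open U ->
  Ck k U f -> Ck k U g -> Ck k U (fun x => f x + g x).
Proof.
move=> Uo; elim: k f g => [|k IH] f g.
  by move=> cf cg x Ux; apply: continuousD; [exact: cf|exact: cg].
move=> [df Df] [dg Dg]; apply: (@CkS _ _ _ _ _ (fun v x => 'D_v f x + 'D_v g x)) => //.
- by move=> x Ux; apply: differentiableD; [exact: df|exact: dg].
- by move=> v x Ux; rewrite deriveD //; apply: diff_derivable; [exact: df|exact: dg].
- by move=> v; apply: IH; [exact: Df|exact: Dg].
Qed.

Lemma Ck_mul V k (U : set V) (f g : V -> R) : open U ->
  Ck k U f -> Ck k U g -> Ck k U (fun x => f x * g x).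
Proof.
move=> Uo; elim: k f g => [|k IH] f g.
  by move=> cf cg x Ux; apply: continuousM; [exact: cf|exact: cg].
move=> Hf Hg; have [df Df] := Hf; have [dg Dg] := Hg.
apply: (@CkS _ _ _ _ _ (fun v x => f x * 'D_v g x + g x * 'D_v f x)) => //.
- by move=> x Ux; apply: differentiableM; [exact: df|exact: dg].
- by move=> v x Ux; rewrite deriveM //; apply: diff_derivable; [exact: df|exact: dg].
- by move=> v; apply: Ck_add => //; apply: IH => //; do ?[exact: Df|exact: Dg|exact: Ck_pred].
Qed.

Lemma Ck_sum V W k (U : set V) n (f : 'I_n -> V -> W) : open U ->
  (forall i, Ck k U (f i)) -> Ck k U (fun x => \sum_(i < n) f i x).
Proof.
move=> Uo fC; elim: n f fC => [|n IH] f fC.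
  rewrite (_ : (fun x => _) = fun=> 0); first exact: Ck_cst.
  by apply/funext => x; rewrite big_ord0.
rewrite (_ : (fun x => _) = fun x => \sum_(i < n) f (widen_ord (leqnSn n) i) x + f ord_max x).
  by apply: Ck_add => //; exact: IH.
by apply/funext => x; rewrite big_ord_recr.
Qed.

End CkTheory.

Section CkComp.
Context {R : realType}.
Implicit Types V W Z : normedModType R.

(** The coordinate as a bundled linear map, so that [Ck_lin] applies to it. *)
Definition coordl m n (i : 'I_m) (j : 'I_n) (M : 'M[R]_(m, n)) : R := M i j.
Lemma coordl_linear m n i j : linear (@coordl m n i j).
Proof. by move=> a x y; rewrite /coordl !mxE. Qed.
HB.instance Definition _ m n i j :=
  GRing.isLinear.Build _ _ _ _ (@coordl m n i j) (@coordl_linear m n i j).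

Lemma coordl_continuous m n i j : continuous (@coordl m n i j).
Proof. exact: coord_continuous. Qed.

Definition scalel W (w : W) (x : R) : W := x *: w.
Lemma scalel_linear W (w : W) : linear (scalel w).
Proof. by move=> a x y; rewrite /scalel scalerDl scalerA. Qed.
HB.instance Definition _ W w :=
  GRing.isLinear.Build _ _ _ _ (@scalel W w) (@scalel_linear W w).

Lemma scalel_cont W (w : W) : continuous (scalel w).
Proof. exact: scalel_continuous. Qed.

Lemma Ck_coord V m n k (U : set V) (f : V -> 'M[R]_(m, n)) i j : open U ->
  Ck k U f -> Ck k U (fun x => f x i j : R).
Proof. by move=> Uo; apply: (@Ck_lin _ _ _ _ _ _ (@coordl m n i j)) => //; exact: coordl_continuous. Qed.

Lemma Ck_scalel V W k (U : set V) (f : V -> R) (w : W) : open U ->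
  Ck k U f -> Ck k U (fun x => f x *: w).
Proof. by move=> Uo; apply: (@Ck_lin _ _ _ _ _ _ (@scalel W w)) => //; exact: scalel_cont. Qed.

Lemma Ck_opp V W k (U : set V) (f : V -> W) : open U ->
  Ck k U f -> Ck k U (fun x => - f x).
Proof.
move=> Uo; apply: (@Ck_lin _ _ _ _ _ _ (-%R : {linear W -> W})) => //.
by move=> x; apply: cvgN; exact: cvg_id.
Qed.

Lemma rV_sum n (v : 'rV[R]_n) : v = \sum_(i < n) v 0 i *: delta_mx 0 i.
Proof. by rewrite [LHS]row_sum_delta. Qed.

Lemma Ck_rV V n k (U : set V) (f : V -> 'rV[R]_n) : open U ->
  (forall i, Ck k U (fun x => f x 0 i : R)) -> Ck k U f.
Proof.
move=> Uo fi; rewrite (_ : f = fun x => \sum_(i < n) f x 0 i *: delta_mx 0 i).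
  by apply: Ck_sum => // i; exact: Ck_scalel.
by apply/funext => x; exact: rV_sum.
Qed.

Lemma derive_comp V W Z (f : V -> W) (g : W -> Z) v x :
  differentiable f x -> differentiable g (f x) ->
  'D_v (fun x => g (f x)) x = 'd g (f x) ('D_v f x).
Proof.
move=> df dg; have dgf : differentiable (g \o f) x by exact: differentiable_comp.
by rewrite (deriveE _ dgf) diff_comp //= deriveE.
Qed.

Lemma derive_comp_rV V Z n (f : V -> 'rV[R]_n) (g : 'rV[R]_n -> Z) v x :
  differentiable f x -> differentiable g (f x) ->
  'D_v (fun x => g (f x)) x =
  \sum_(i < n) ('D_v f x) 0 i *: 'D_(delta_mx 0 i) g (f x).
Proof.
move=> df dg; rewrite derive_comp // [X in 'd g _ X]rV_sum linear_sum.
by apply: eq_bigr => i _; rewrite linearZ (deriveE _ dg).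
Qed.

Lemma derive_comp_R V Z (f : V -> R) (g : R -> Z) v x :
  differentiable f x -> differentiable g (f x) ->
  'D_v (fun x => g (f x)) x = 'D_v f x *: 'D_1 g (f x).
Proof.
move=> df dg; rewrite derive_comp // [in RHS](deriveE _ dg).
by rewrite -linearZ; congr ('d g _ _); rewrite -[LHS]mulr1.
Qed.

(** The chain rule is expanded in partial derivatives: each term is a product of a coordinate of
    ['D_v f] and a partial of [g] composed with [f], so the induction hypothesis applies to the
    partials of [g] with [f] unchanged. *)
Lemma Ck_comp_rV V n k (U : set V) (U' : set 'rV[R]_n)
   (f : V -> 'rV[R]_n) (g : 'rV[R]_n -> R) :
  open U -> open U' -> (forall x, U x -> U' (f x)) ->
  Ck k U f -> Ck k U' g -> Ck k U (fun x => g (f x)).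
Proof.
move=> Uo Uo' UU'; elim: k g => [|k IH] g.
  by move=> cf cg x Ux; apply: continuous_comp; [exact: cf|exact: cg (UU' _ Ux)].
move=> Hf; have [df Df] := Hf; move=> [dg Dg].
apply: (CkS (df := fun v x => \sum_(i < n) ('D_v f x) 0 i * 'D_(delta_mx 0 i) g (f x))) => //.
- by move=> x Ux; apply: differentiable_comp; [exact: df|exact: dg (UU' _ Ux)].
- by move=> v x Ux; rewrite derive_comp_rV; [|exact: df|exact: dg (UU' _ Ux)].
- move=> v; apply: Ck_sum => // i; apply: Ck_mul => //.
    by apply: Ck_coord => //; exact: Df.
  by apply: (IH (fun y => 'D_(delta_mx 0 i) g y)); [exact: Ck_pred|exact: Dg].
Qed.

Lemma Ck_comp_R V k (U : set V) (U' : set R) (f : V -> R) (g : R -> R) :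
  open U -> open U' -> (forall x, U x -> U' (f x)) ->
  Ck k U f -> Ck k U' g -> Ck k U (fun x => g (f x)).
Proof.
move=> Uo Uo' UU'; elim: k g => [|k IH] g.
  by move=> cf cg x Ux; apply: continuous_comp; [exact: cf|exact: cg (UU' _ Ux)].
move=> Hf; have [df Df] := Hf; move=> [dg Dg].
apply: (CkS (df := fun v x => 'D_v f x * 'D_1 g (f x))) => //.
- by move=> x Ux; apply: differentiable_comp; [exact: df|exact: dg (UU' _ Ux)].
- by move=> v x Ux; rewrite (derive_comp_R _ (df _ Ux) (dg _ (UU' _ Ux))).
- move=> v; apply: Ck_mul => //; first exact: Df.
  by apply: (IH (fun y => 'D_1 g y)); [exact: Ck_pred|exact: Dg].
Qed.

Lemma derive_R Z (g : R -> Z) v x : differentiable g x -> 'D_v g x = v *: 'D_1 g x.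
Proof.
move=> dg; rewrite !deriveE // -linearZ; congr ('d g _ _).
by rewrite -[LHS]mulr1.
Qed.

Lemma CkS_R k (U : set R) (f df : R -> R) : open U ->
  (forall x, U x -> is_derive x 1 f (df x)) -> Ck k U df -> Ck k.+1 U f.
Proof.
move=> Uo fd dfC; have fdiff x : U x -> differentiable f x.
  by move=> Ux; apply/derivable1_diffP; have [] := fd x Ux.
apply: (CkS (df := fun v x => df x *: v)) => //.
  move=> v x Ux; rewrite derive_R; last exact: fdiff.
  by have [_ ->] := fd x Ux; rewrite /GRing.scale /= mulrC.
by move=> v; exact: Ck_scalel.
Qed.

Lemma Ck_inv k : Ck k [set x : R | x != 0] (fun x => x^-1).
Proof.
have Uo : open [set x : R | x != 0] by exact: open_neq.
elim: k => [|k IH]; first by move=> x /= x0; exact: inv_continuous.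
apply: (@CkS_R _ _ _ (fun x => - (x^-1 * x^-1))) => //.
  move=> x /= x0.
  have dx : derivable (fun x : R => x^-1) x 1 by apply: derivableV => //; exact: derivable_id.
  apply: is_derive_eq (derivableP dx) _.
  have di : derivable (@id R) x 1 by exact: derivable_id.
  rewrite (@deriveV _ _ id x 1 x0 di).
  by rewrite derive_id /GRing.scale /=; field.
by apply: Ck_opp => //; apply: Ck_mul.
Qed.

(** The derivative is - w^3 / 2 for w = x^(-1/2), a polynomial in the function itself, so regularity
    bootstraps. The induction starts at order one because continuity is read off
    differentiability. *)
Lemma Ck_invsqrt k : Ck k [set x : R | 0 < x] (fun x => (Num.sqrt x)^-1).
Proof.
have Uo : open [set x : R | 0 < x] by exact: open_gt.
suff : Ck k.+1 [set x : R | 0 < x] (fun x => (Num.sqrt x)^-1) by exact: Ck_pred.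
have D x : 0 < x -> is_derive (x:R) (1:R) (fun x : R => (Num.sqrt x)^-1) 
   (- 2^-1 * ((Num.sqrt x)^-1 * ((Num.sqrt x)^-1 * (Num.sqrt x)^-1))).
  move=> x0; have s0 : Num.sqrt x != 0 by rewrite gt_eqF // sqrtr_gt0.
  have ds := is_derive1_sqrt x0.
  have dx : derivable (fun x : R => (Num.sqrt x)^-1) x 1.
    by apply: derivableV => //; exact: ex_derive.
  apply: is_derive_eq (derivableP dx) _.
  by rewrite deriveV // derive_val /GRing.scale /=; field.
elim: k => [|k IH]; last first.
  apply: (@CkS_R _ _ _ (fun x => - 2^-1 * ((Num.sqrt x)^-1 * ((Num.sqrt x)^-1 * (Num.sqrt x)^-1)))) => //.
  by apply: Ck_mul => //; [exact: Ck_cst|do ?apply: Ck_mul => //].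
apply: (@CkS_R _ _ _ (fun x => - 2^-1 * ((Num.sqrt x)^-1 * ((Num.sqrt x)^-1 * (Num.sqrt x)^-1)))) => //.
have c : Ck 0 [set x : R | 0 < x] (fun x => (Num.sqrt x)^-1).
  move=> x x0; apply: differentiable_continuous; apply/derivable1_diffP.
  by have [] := D x x0.
by apply: Ck_mul => //; [exact: Ck_cst|do ?apply: Ck_mul => //].
Qed.

End CkComp.

Section SmoothAt.
Context {R : realType}.
Implicit Types V W Z : normedModType R.

Lemma smooth_near V W (f : V -> W) p : smooth_at p f -> \near p, smooth_at p f.
Proof.
move=> [U [Uo Up] Uf]; near=> x; exists U => //; split => //.
near: x; exact: open_near.
Unshelve. all: by end_near. Qed.

Lemma smooth_diff V W (f : V -> W) p : smooth_at p f -> differentiable f p.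
Proof. by move=> [U [_ Up]] /(_ 1%N)[df _]; exact: df. Qed.

Lemma smooth_cont V W (f : V -> W) p : smooth_at p f -> {for p, continuous f}.
Proof. by move=> /smooth_diff; exact: differentiable_continuous. Qed.

Lemma smooth_derivable V W (f : V -> W) p v : smooth_at p f -> derivable f p v.
Proof. by move=> /smooth_diff; exact: diff_derivable. Qed.

Lemma smooth_derive V W (f : V -> W) p v :
  smooth_at p f -> smooth_at p (fun x => 'D_v f x).
Proof. by move=> [U Up Uf]; exists U => // k; have [_] := Uf k.+1; exact. Qed.

Lemma smooth_ext V W (f g : V -> W) p :
  (\near p, f p = g p) -> smooth_at p f -> smooth_at p g.
Proof.
move=> fg [U [Uo Up] Uf].
have : nbhs p (U `&` [set x | f x = g x]) by apply: filterI => //; exact: open_near.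
rewrite nbhsE => -[U' [U'o U'p] U'U]; exists U' => // k.
apply: (@Ck_ext _ _ _ _ _ f) => // [x /U'U[]//|].
by apply: Ck_sub (Uf k) => x /U'U[].
Qed.

Lemma smooth_cst V W p (w : W) : smooth_at p (fun _ : V => w).
Proof. by exists setT => [|k]; [split => //; exact: openT|exact: Ck_cst]. Qed.

Lemma Ck_id V k : Ck k setT (fun x : V => x).
Proof.
elim: k => [x _|k IH]; first by exact: cvg_id.
apply: (CkS (df := fun v x => v)) => [||v x _|v]; [exact: openT| |exact: derive_id|exact: Ck_cst].
by move=> x _; have [] := is_diff_id x.
Qed.

Lemma smooth_id V (p : V) : smooth_at p (fun x => x).
Proof. by exists setT => [|k]; [split => //; exact: openT|exact: Ck_id]. Qed.

Lemma smooth_join V W Z (f : V -> W) (g : V -> Z) p :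
  smooth_at p f -> smooth_at p g ->
  exists U, [/\ open_nbhs p U, forall k, Ck k U f & forall k, Ck k U g].
Proof.
move=> [U [Uo Up] Uf] [U' [U'o U'p] U'g]; exists (U `&` U'); split.
- by split; [exact: openI|].
- by move=> k; apply: Ck_sub (Uf k) => x [].
- by move=> k; apply: Ck_sub (U'g k) => x [].
Qed.

Lemma smooth_add V W (f g : V -> W) p :
  smooth_at p f -> smooth_at p g -> smooth_at p (fun x => f x + g x).
Proof.
move=> sf sg; have [U [[Uo Up] Uf Ug]] := smooth_join sf sg.
by exists U => // k; exact: Ck_add.
Qed.

Lemma smooth_opp V W (f : V -> W) p :
  smooth_at p f -> smooth_at p (fun x => - f x).
Proof. by move=> [U [Uo Up] Uf]; exists U => // k; exact: Ck_opp. Qed.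

Lemma smooth_mul V (f g : V -> R) p :
  smooth_at p f -> smooth_at p g -> smooth_at p (fun x => f x * g x).
Proof.
move=> sf sg; have [U [[Uo Up] Uf Ug]] := smooth_join sf sg.
by exists U => // k; exact: Ck_mul.
Qed.

Lemma smooth_exp V (f : V -> R) n p :
  smooth_at p f -> smooth_at p (fun x => f x ^+ n).
Proof.
move=> sf; elim: n => [|n IH]; first by under eq_fun do rewrite expr0; exact: smooth_cst.
by under eq_fun do rewrite exprS; exact: smooth_mul.
Qed.

Lemma smooth_sum V W n (f : 'I_n -> V -> W) p :
  (forall i, smooth_at p (f i)) -> smooth_at p (fun x => \sum_(i < n) f i x).
Proof.
elim: n f => [|n IH] f sf; first by under eq_fun do rewrite big_ord0; exact: smooth_cst.
under eq_fun do rewrite big_ord_recr; apply: smooth_add => //.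
exact: IH.
Qed.

Lemma smooth_prod V n (f : 'I_n -> V -> R) p :
  (forall i, smooth_at p (f i)) -> smooth_at p (fun x => \prod_(i < n) f i x).
Proof.
elim: n f => [|n IH] f sf; first by under eq_fun do rewrite big_ord0; exact: smooth_cst.
under eq_fun do rewrite big_ord_recr; apply: smooth_mul => //.
exact: IH.
Qed.

Lemma smooth_scalel V W (f : V -> R) (w : W) p :
  smooth_at p f -> smooth_at p (fun x => f x *: w).
Proof. by move=> [U [Uo Up] Uf]; exists U => // k; exact: Ck_scalel. Qed.

Lemma smooth_coord V m n (f : V -> 'M[R]_(m, n)) i j p :
  smooth_at p f -> smooth_at p (fun x => f x i j : R).
Proof. by move=> [U [Uo Up] Uf]; exists U => // k; exact: Ck_coord. Qed.

Lemma smooth_rV V n (f : V -> 'rV[R]_n) p :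
  (forall i, smooth_at p (fun x => f x 0 i : R)) -> smooth_at p f.
Proof.
move=> fi; apply: (@smooth_ext _ _ (fun x => \sum_(i < n) f x 0 i *: delta_mx 0 i)).
  by apply: filterE => x; rewrite -rV_sum.
by apply: smooth_sum => i; exact: smooth_scalel.
Unshelve. all: by end_near. Qed.

Lemma smooth_scale V n (k : V -> R) (f : V -> 'rV[R]_n) p :
  smooth_at p k -> smooth_at p f -> smooth_at p (fun x => k x *: f x).
Proof.
move=> sk sf; apply: smooth_rV => i; under eq_fun do rewrite mxE.
by apply: smooth_mul => //; exact: smooth_coord.
Qed.

Lemma smooth_pre V W (f : V -> W) p (U : set W) : smooth_at p f ->
  open_nbhs (f p) U ->
  exists U', [/\ open_nbhs p U', forall k, Ck k U' f & forall x, U' x -> U (f x)].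
Proof.
move=> sf Ufp; have [U0 [U0o U0p] U0f] := sf.
have : nbhs p (U0 `&` f @^-1` U).
  by apply: filterI; [exact: open_near|apply: (smooth_cont sf); exact: open_nbhs_nbhs].
rewrite nbhsE => -[U' [U'o U'p] U'U]; exists U'; split => //.
  by move=> k; apply: Ck_sub (U0f k) => x /U'U[].
by move=> x /U'U[].
Qed.

Lemma smooth_comp_rV_R V n (f : V -> 'rV[R]_n) (g : 'rV[R]_n -> R) p :
  smooth_at p f -> smooth_at (f p) g -> smooth_at p (fun x => g (f x)).
Proof.
move=> sf [U Ufp Ug]; have [U' [[U'o U'p] U'f U'U]] := smooth_pre sf Ufp.
by exists U' => // k; apply: (@Ck_comp_rV _ _ _ _ _ U) => //; case: Ufp.
Qed.

Lemma smooth_comp_R_R V (f : V -> R) (g : R -> R) p :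
  smooth_at p f -> smooth_at (f p) g -> smooth_at p (fun x => g (f x)).
Proof.
move=> sf [U Ufp Ug]; have [U' [[U'o U'p] U'f U'U]] := smooth_pre sf Ufp.
by exists U' => // k; apply: (@Ck_comp_R _ _ _ _ U) => //; case: Ufp.
Qed.

Lemma smooth_comp_rV V n m (f : V -> 'rV[R]_n) (g : 'rV[R]_n -> 'rV[R]_m) p :
  smooth_at p f -> smooth_at (f p) g -> smooth_at p (fun x => g (f x)).
Proof.
move=> sf sg; apply: smooth_rV => i.
by apply: (smooth_comp_rV_R (g := fun y => g y 0 i)) => //; exact: smooth_coord.
Qed.

Lemma smooth_comp_R V m (f : V -> R) (g : R -> 'rV[R]_m) p :
  smooth_at p f -> smooth_at (f p) g -> smooth_at p (fun x => g (f x)).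
Proof.
move=> sf sg; apply: smooth_rV => i.
by apply: (smooth_comp_R_R (g := fun y => g y 0 i)) => //; exact: smooth_coord.
Qed.

Lemma smooth_inv V (f : V -> R) p : f p != 0 ->
  smooth_at p f -> smooth_at p (fun x => (f x)^-1).
Proof.
move=> fp0 sf; apply: (smooth_comp_R_R (g := fun x => x^-1)) => //.
by exists [set x | x != 0]; [split => //; exact: open_neq|exact: Ck_inv].
Qed.

Lemma smooth_invsqrt V (f : V -> R) p : 0 < f p ->
  smooth_at p f -> smooth_at p (fun x => (Num.sqrt (f x))^-1).
Proof.
move=> fp0 sf; apply: (smooth_comp_R_R (g := fun x => (Num.sqrt x)^-1)) => //.
by exists [set x | 0 < x]; [split => //; exact: open_gt|exact: Ck_invsqrt].
Qed.

End SmoothAt.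

(** * Rules for computing directional derivatives *)

Section IsDerive.
Context {R : realType}.
Implicit Types V W Z : normedModType R.

Lemma isD_cst V W (x v : V) (w : W) : is_derive x v (fun=> w) 0.
Proof. exact: is_derive_cst. Qed.

Lemma isD_id V (x v : V) : is_derive x v (fun y => y) v.
Proof. exact: is_derive_id. Qed.

Lemma isD_add V W (x v : V) (f g : V -> W) df dg :
  is_derive x v f df -> is_derive x v g dg ->
  is_derive x v (fun y => f y + g y) (df + dg).
Proof. by move=> Hf Hg; exact: is_deriveD. Qed.

Lemma isD_opp V W (x v : V) (f : V -> W) df :
  is_derive x v f df -> is_derive x v (fun y => - f y) (- df).
Proof. by move=> Hf; exact: is_deriveN. Qed.

Lemma isD_eqR V (x v : V) (f : V -> R) (df f' : R) :
  is_derive x v f f' -> f' = df -> is_derive x v f df.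
Proof. exact: is_derive_eq. Qed.

Lemma isD_addR V (x v : V) (f g : V -> R) (df dg : R) :
  is_derive x v f df -> is_derive x v g dg ->
  is_derive x v (fun y => f y + g y) (df + dg).
Proof. exact: isD_add. Qed.

Lemma isD_oppR V (x v : V) (f : V -> R) (df : R) :
  is_derive x v f df -> is_derive x v (fun y => - f y) (- df).
Proof. exact: isD_opp. Qed.

Lemma isD_idR (x v : R) : is_derive x v (fun y => y) v.
Proof. exact: isD_id. Qed.

Lemma isD_cstR V (x v : V) (w : R) : is_derive x v (fun=> w) 0.
Proof. exact: isD_cst. Qed.

Lemma isD_mul V (x v : V) (f g : V -> R) df dg :
  is_derive x v f df -> is_derive x v g dg ->
  is_derive x v (fun y => f y * g y) (df * g x + f x * dg).
Proof.
move=> Hf Hg; apply: is_derive_eq (is_deriveM Hf Hg) _.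
by rewrite /GRing.scale /= addrC; congr (_ + _); rewrite mulrC.
Qed.

Lemma isD_exp V (x v : V) (f : V -> R) df n :
  is_derive x v f df -> is_derive x v (fun y => f y ^+ n) (n%:R * f x ^+ n.-1 * df).
Proof.
move=> Hf; elim: n => [|n IH].
  by under eq_fun do rewrite expr0; rewrite !mul0r; exact: isD_cst.
under eq_fun do rewrite exprS; apply: is_derive_eq (isD_mul Hf IH) _.
case: n {IH} => [|n]; first by rewrite /= expr0; ring.
by rewrite /= exprS -[n.+2%:R]natr1; ring.
Qed.

Lemma isD_inv V (x v : V) (f : V -> R) df : f x != 0 ->
  is_derive x v f df -> is_derive x v (fun y => (f y)^-1) (- df / f x ^+ 2).
Proof.
move=> fx0 [fd fE]; have dv := derivableV fx0 fd.
split; first exact: dv.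
rewrite (deriveV fx0 fd) fE.
by rewrite /GRing.scale /= mulrC mulrN mulNr.
Qed.

Lemma isD_coord V m n (x v : V) (f : V -> 'M[R]_(m, n)) (df : 'M[R]_(m, n)) i j :
  is_derive x v f df -> is_derive x v (fun y => f y i j) (df i j).
Proof.
move=> [fd <-]; have fd' := (derivable_mxP _ _ _).1 fd i j.
by split => //; rewrite derive_mx // mxE.
Qed.

Lemma isD_mx V m n (x v : V) (f : V -> 'M[R]_(m, n)) (df : 'M[R]_(m, n)) :
  (forall i j, is_derive x v (fun y => f y i j) (df i j)) -> is_derive x v f df.
Proof.
move=> H; have fd : derivable f x v.
  by apply/derivable_mxP => i j; have [] := H i j.
split => //.
by rewrite derive_mx //; apply/matrixP => i j; rewrite mxE; have [_] := H i j.
Qed.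

Lemma isD_scale V n (x v : V) (k : V -> R) (f : V -> 'rV[R]_n) dk df :
  is_derive x v k dk -> is_derive x v f df ->
  is_derive x v (fun y => k y *: f y) (dk *: f x + k x *: df).
Proof.
move=> Hk Hf; apply: isD_mx => i j; rewrite !mxE; under eq_fun do rewrite mxE.
by apply: isD_mul => //; exact: isD_coord.
Qed.

Lemma isD_comp V W Z (x v : V) (f : V -> W) (g : W -> Z) df dg :
  is_derive (f x) df g dg -> differentiable f x -> differentiable g (f x) ->
  is_derive x v f df -> is_derive x v (fun y => g (f y)) dg.
Proof.
move=> Dg fd gd Df; have dgf : differentiable (g \o f) x by exact: differentiable_comp.
split; first exact: diff_derivable dgf.
by rewrite derive_comp // -deriveE //; do 2 rewrite derive_val.
Qed.

Lemma isD_diff1 W (f : R -> W) (x : R) df : is_derive x 1 f df -> differentiable f x.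
Proof. by move=> [] /derivable1_diffP. Qed.

Lemma isD_compR (f : R -> R) (g : R -> R) (x : R) df dg :
  is_derive (f x) 1 g dg -> is_derive x 1 f df ->
  is_derive x 1 (fun y => g (f y)) (df * dg).
Proof.
move=> Dg Df; apply: isD_comp (isD_diff1 Df) (isD_diff1 Dg) Df.
have gd := isD_diff1 Dg; split; first exact: diff_derivable.
by rewrite derive_R // (@derive_val _ _ _ _ _ _ _ Dg).
Qed.

Lemma smooth_isD V W (f : V -> W) p v : smooth_at p f -> is_derive p v f ('D_v f p).
Proof. by move=> /smooth_derivable sf; exact: derivableP. Qed.

Lemma smooth_isD1 W (f : R -> W) (p : R) : smooth_at p f -> is_derive p 1 f ('D_1 f p).
Proof. exact: smooth_isD. Qed.

Lemma near_smooth V W (f : V -> W) (x : V) (P : set W) :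
  smooth_at x f -> (\forall y \near f x, P y) -> \forall u \near x, P (f u).
Proof. by move=> /smooth_cont fc Py; exact: (fc _ Py). Qed.

(* Sealed, because unification would otherwise unfold derivatives into limits. *)
Fact der_key : unit. Proof. by []. Qed.
Definition der W (f : R -> W) (u : R) : W := locked_with der_key ('D_(1 : R) f u).

Lemma derE W (f : R -> W) u : 'D_(1 : R) f u = der f u.
Proof. by rewrite /der unlock. Qed.

Lemma smooth_der W (f : R -> W) (p : R) : smooth_at p f -> smooth_at p (der f).
Proof.
move=> /smooth_derive sf; apply: smooth_ext (sf (1 : R)).
by apply: filterE => u; exact: derE.
Qed.

Lemma isD_der W (f : R -> W) (p : R) : smooth_at p f -> is_derive p 1 f (der f p).
Proof. by move=> sf; rewrite -derE; exact: smooth_isD. Qed.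

Lemma der_val W (f : R -> W) (p : R) d : is_derive p 1 f d -> der f p = d.
Proof. by move=> [_]; rewrite derE. Qed.

Lemma der_near W (f g : R -> W) (p : R) : (\forall u \near p, f u = g u) ->
  der f p = der g p.
Proof. by move=> fg; rewrite -!derE; exact: near_eq_derive. Qed.

Lemma near_der W (f g : R -> W) (p : R) : (\forall u \near p, f u = g u) ->
  \forall u \near p, der f u = der g u.
Proof. by move=> /near_join fg; apply: filterS fg => u; exact: der_near. Qed.

End IsDerive.


(** Differentiation by recursion on the shape of the function. Opaque subterms are closed by an
    [is_derive] fact of the context, which is why such facts are introduced just before each call;
    [isde] leaves the equation between computed and claimed derivative. *)
Ltac isd := lazymatch goal with
  | |- is_derive _ _ (fun _ => ?c) _ => first [notypeclasses refine (isD_cstR _ _ _) | notypeclasses refine (isD_cst _ _ _)]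
  | |- is_derive _ _ (fun y => y) _ => first [notypeclasses refine (isD_idR _ _) | notypeclasses refine (isD_id _ _)]
  | |- is_derive _ _ (fun y => (@?f y + @?g y)%R) _ =>
      first [notypeclasses refine (isD_addR (f := f) (g := g) _ _)
            |notypeclasses refine (isD_add (f := f) (g := g) _ _)]; isd
  | |- is_derive _ _ (fun y => (- @?f y)%R) _ =>
      first [notypeclasses refine (isD_oppR (f := f) _)|notypeclasses refine (isD_opp (f := f) _)]; isd
  | |- is_derive _ _ (fun y => (@?f y * @?g y)%R) _ => notypeclasses refine (isD_mul (f := f) (g := g) _ _); isd
  | |- is_derive _ _ (fun y => (@?f y ^+ ?n)%R) _ => notypeclasses refine (isD_exp (f := f) n _); isd
  | |- is_derive _ _ (fun y => (@?f y ^-1)%R) _ => notypeclasses refine (isD_inv (f := f) _ _); [try assumption|isd]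
  | |- is_derive _ _ (fun y => (@?f y *: @?g y)%R) _ => notypeclasses refine (isD_scale (k := f) (f := g) _ _); isd
  | H : is_derive _ _ ?f _ |- is_derive _ _ ?f _ => notypeclasses refine H
  | _ => idtac
  end.
Ltac isde := first [notypeclasses refine (isD_eqR _ _)|notypeclasses refine (is_derive_eq _ _)]; [isd|cbv beta].

(** * Even functions and the normal form of a cusp *)

Section Hadamard.
Context {R : realType}.

(** The mean value theorem with unordered endpoints, so that increments of both signs are treated at
    once. *)
Lemma MVT_dist (f df : R -> R) (x y : R) :
  (forall t : R, `|t - x| <= `|y - x| -> is_derive t 1 f (df t)) ->
  exists2 c, `|c - x| <= `|y - x| & f y - f x = df c * (y - x).
Proof.
move=> fD.
have cts (a b : R) : (forall t : R, t \in `[a, b]%R -> is_derive t 1 f (df t)) ->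
   {within `[a, b], continuous f}.
  move=> H; apply: derivable_within_continuous => t tab.
  by have [] := H t tab.
case: (ltgtP x y) => [xy|yx|<-].
- have fD' t : t \in `[x, y]%R -> is_derive t 1 f (df t).
    by rewrite in_itv /= => /andP[? ?]; apply: fD; rewrite !ger0_norm ?subr_ge0 ?lerD2r // ltW.
  have fD2 (t : R) : t \in `]x, y[%R -> is_derive t 1 f (df t).
    by move=> txy; apply: fD'; exact: subset_itv_oo_cc.
  have [c] := MVT xy fD2 (cts _ _ fD').
  rewrite in_itv /= => /andP[? ?] E; exists c => //.
  by rewrite !ger0_norm ?subr_ge0 ?lerD2r // ltW.
- have fD' t : t \in `[y, x]%R -> is_derive t 1 f (df t).
    by rewrite in_itv /= => /andP[? ?]; apply: fD; rewrite !ler0_norm ?subr_le0 ?lerN2 ?lerD2r // ltW.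
  have fD2 (t : R) : t \in `]y, x[%R -> is_derive t 1 f (df t).
    by move=> txy; apply: fD'; exact: subset_itv_oo_cc.
  have [c] := MVT yx fD2 (cts _ _ fD').
  rewrite in_itv /= => /andP[? ?] E; exists c => //.
    by rewrite !ler0_norm ?subr_le0 ?lerN2 ?lerD2r // ltW.
  by rewrite -[LHS]opprB E -mulrN opprB.
- by exists x => //; rewrite !subrr mulr0.
Qed.

Lemma is_derive_remainder (f : R -> R) (x d : R) :
  (forall e, 0 < e -> \forall h \near 0, `|f (h + x) - f x - h * d| <= e * `|h|) ->
  is_derive x 1 f d.
Proof.
move=> H; have [df dE] := @differentiable_remainder _ _ _ f x (scalel d)
  (@scalel_cont _ _ d) H.
apply: DeriveDef; first exact/derivable1_diffP.
by rewrite deriveE // dE /= /scalel scale1r.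
Qed.

Lemma remainder_is_derive (f : R -> R) (x d : R) : is_derive x 1 f d ->
  forall e, 0 < e -> \forall h \near 0, `|f (h + x) - f x - h * d| <= e * `|h|.
Proof.
move=> [fx <-] e e0; have df : differentiable f x by exact/derivable1_diffP.
apply: filterS (differential_remainder df e0) => h.
have -> // : 'd f x h = h * 'D_1 f x.
by rewrite deriveE // -[LHS]/('d f x h) -{1}[h]mulr1 [LHS]linearZ.
Qed.

Lemma Ck_is_derive k U (f : R -> R) (x : R) : Ck k.+1 U f -> U x ->
  is_derive x 1 f ('D_1 f x).
Proof. by move=> [df _] /df dx; apply: derivableP; exact: diff_derivable. Qed.

(** When Q' = t^k g and Q(0) = 0, this is the integral of s^k g(t s) over s in [0, 1], written
    without integration; its value at 0 is g(0) / (k + 1). *)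
Definition hadamard_quotient k (Q g : R -> R) (t : R) : R :=
  if t == 0 then g 0 / k.+1%:R else Q t / t ^+ k.+1.

Variable r : R.
Let U := [set t : R | `|t| < r].

Lemma open_normlt : open U.
Proof.
have [r0|r0] := ltP 0 r; last first.
  rewrite (_ : U = set0); first exact: open0.
  by apply/seteqP; split => t //; rewrite /U /= ltNge (le_trans r0).
rewrite (_ : U = ball 0 r); first exact: ball_open.
by apply/seteqP; split => t; rewrite /ball /= sub0r normrN.
Qed.

Lemma taylor_remainder_derive k (Q : R -> R) (t gt g0 g1 : R) :
  is_derive t 1 Q (t ^+ k * gt) ->
  is_derive t 1 (fun t => Q t - t ^+ k.+1 * (g0 / k.+1%:R) - t ^+ k.+2 * (g1 / k.+2%:R))
    (t ^+ k * (gt - g0 - t * g1)).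
Proof.
move=> DQ; isde.
have k1 : k.+1%:R != 0 :> R by rewrite pnatr_eq0.
have k2 : k.+2%:R != 0 :> R by rewrite pnatr_eq0.
by rewrite /= !exprS; field; rewrite nat1r k1 -natrD k2.
Qed.

(** Differentiating the integral of s^k g(t s) gives the integral of s^(k+1) g'(t s), a quotient of
    the same kind: by parts, t^(k+1) g - (k+1) Q is the primitive of t^(k+1) g'. The class is
    therefore stable under differentiation, which gives smoothness of every order. *)
Lemma hadamard_quotient_derive k (Q g : R -> R) : (forall m, Ck m U g) ->
  (forall t : R, U t -> is_derive t 1 Q (t ^+ k * g t)) -> Q 0 = 0 ->
  forall t : R, U t -> is_derive t 1 (hadamard_quotient k Q g)
    (hadamard_quotient k.+1 (fun t => t ^+ k.+1 * g t - k.+1%:R * Q t) ('D_1 g) t).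
Proof.
move=> Cg DQ Q0 t Ut; have Dg := Ck_is_derive (Cg 1%N).
have [t0|t0] := eqVneq t 0; last first.
  rewrite /hadamard_quotient (negbTE t0).
  have := DQ t Ut => DQt.
  have tk0 : t ^+ k.+1 != 0 by rewrite expf_neq0.
  apply: (@near_eq_is_derive _ _ _ (fun t => Q t * (t ^+ k.+1)^-1)).
    near=> x; rewrite ifF //; apply/negbTE; near: x.
    by apply: (@open_near R R [set x : R | x != 0] t); [exact: open_neq|].
  isde.
  have tk : t ^+ k != 0 by rewrite expf_neq0.
  by rewrite /= !exprS; field; rewrite tk t0.
subst t; rewrite {2}/hadamard_quotient eqxx.
set d := 'D_1 g 0 / _.
apply: is_derive_remainder => e e0.
have /(remainder_is_derive)/(_ e e0) := Dg 0 Ut.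
move=> /nbhs_ballP[dl /= dl0 gB].
near=> h; rewrite addr0.
have [->|h0] := eqVneq h 0; first by rewrite !(subrr,mul0r,subr0,normr0,mulr0).
have Uh : U h by near: h; apply: (@open_near R R U 0) => //; exact: open_normlt.
have hdl : `|h| < dl by near: h; exact: (@nbhs0_lt R R).
rewrite /hadamard_quotient (negbTE h0) eqxx.
(* [Z] is Q minus its two leading terms. Its derivative is t^k times the first-order Taylor error of
   g, so the mean value theorem bounds Z(h) by e |h|^(k+2), enough after division by h^(k+1). *)
pose Z t := Q t - t ^+ k.+1 * (g 0 / k.+1%:R) - t ^+ k.+2 * d.
have DZ (t : R) : `|t - 0| <= `|h - 0| -> is_derive t 1 Z (t ^+ k * (g t - g 0 - t * 'D_1 g 0)).
  rewrite !subr0 => th; have Ut' : U t by exact: le_lt_trans th Uh.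
  have := DQ t Ut' => DQt.
  exact: taylor_remainder_derive.
have [c] := MVT_dist DZ.
rewrite !subr0 => ch; rewrite {2}/Z Q0 !expr0n /= !mul0r !subr0 => Zh.
have quot X q c0 d0 : X != 0 ->
    q / X - c0 - h * d0 = (q - X * c0 - h * X * d0) / X :> R.
  by move=> X0; field.
have -> : Q h / h ^+ k.+1 - g 0 / k.+1%:R - h * d = Z h / h ^+ k.+1.
  by rewrite /Z [h ^+ k.+2]exprS quot // expf_neq0.
rewrite Zh !normrM normfV !normrX ler_pdivrMr ?exprn_gt0 ?normr_gt0 //.
have gc : `|g c - g 0 - c * 'D_1 g 0| <= e * `|h|.
  apply: le_trans (ler_wpM2l (ltW e0) ch).
  have := gB c; rewrite addr0; apply.
  by rewrite /ball /= sub0r normrN; exact: le_lt_trans ch hdl.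
apply: (@le_trans _ _ (`|h| ^+ k * (e * `|h|) * `|h|)).
  apply: ler_wpM2r => //; apply: ler_pM => //.
  by apply: lerXn2r; rewrite ?nnegrE.
by rewrite le_eqVlt; apply/orP; left; apply/eqP; rewrite exprS; ring.
Unshelve. all: by end_near. Qed.

Lemma hadamard_quotient_smooth n k (Q g : R -> R) : (forall m, Ck m U g) ->
  (forall t : R, U t -> is_derive t 1 Q (t ^+ k * g t)) -> Q 0 = 0 ->
  Ck n U (hadamard_quotient k Q g).
Proof.
elim: n k Q g => [|n IH] k Q g Cg DQ Q0; have D := hadamard_quotient_derive Cg DQ Q0.
  move=> t Ut; apply: differentiable_continuous; apply/derivable1_diffP.
  by have [] := D t Ut.
apply: (CkS_R open_normlt D).
apply: IH; first by move=> m; have [_] := Cg m.+1; exact.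
  move=> t Ut; have := DQ t Ut => DQt; have := Ck_is_derive (Cg 1%N) Ut => Dg.
  isde; rewrite /=; ring.
by rewrite Q0 expr0n /= !(mul0r, mulr0) subr0.
Qed.

Lemma hadamard_lemma (g : R -> R) : (forall m, Ck m U g) -> g 0 = 0 ->
  exists2 g1, forall m, Ck m U g1 & forall t, g t = t * g1 t.
Proof.
move=> Cg g0; exists (hadamard_quotient 0 g ('D_1 g)).
  move=> m; apply: hadamard_quotient_smooth => //.
    by move=> m'; have [_] := Cg m'.+1; exact.
  by move=> t Ut; rewrite expr0 mul1r; exact: Ck_is_derive (Cg 1%N) Ut.
move=> t; rewrite /hadamard_quotient; have [->|t0] := eqVneq t 0.
  by rewrite mul0r.
by rewrite expr1 mulrC divfK.
Qed.

End Hadamard.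

(** * Coefficients of Seeley's extension operator *)

Section Seeley.
Context {R : realType}.
Implicit Types (u v c : nat -> R) (q : R).

Definition sumser u : R := limn (series u).
Definition abssum u := cvgn (series (fun n => `|u n|)).

Lemma abssum_cvg u : abssum u -> cvgn (series u).
Proof. exact: normed_cvg. Qed.

Lemma abssum_le u v : (forall n, `|u n| <= `|v n|) -> abssum v -> abssum u.
Proof. by move=> uv; apply: series_le_cvg. Qed.

Lemma abssumZ a u : abssum u -> abssum (fun n => a * u n).
Proof.
move=> su; rewrite /abssum; under eq_fun do rewrite normrM.
exact: (@is_cvg_seriesZ R _ `|a| su).
Qed.

Lemma abssumD u v : abssum u -> abssum v -> abssum (fun n => u n + v n).
Proof.
move=> su sv; apply: (@series_le_cvg _ _ (fun n => `|u n| + `|v n|)) => //.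
  by move=> n; exact: ler_normD.
exact: (is_cvg_seriesD su sv).
Qed.

Lemma sumserD u v : abssum u -> abssum v ->
  sumser (fun n => u n + v n) = sumser u + sumser v.
Proof. by move=> /abssum_cvg su /abssum_cvg sv; exact: lim_seriesD. Qed.

Lemma sumserZ a u : abssum u -> sumser (fun n => a * u n) = a * sumser u.
Proof. by move=> /abssum_cvg su; exact: (@lim_seriesZ R _ a su). Qed.

Lemma sumser_norm u v : (forall n, `|u n| <= v n) -> abssum v ->
  `|sumser u| <= sumser v.
Proof.
move=> uv sv; have v0 n : `|v n| = v n by rewrite ger0_norm // (le_trans _ (uv n)).
have su : abssum u by apply: abssum_le sv => n; rewrite v0.
apply: (le_trans (lim_series_norm su)).
by apply: lim_series_le => //; exact: abssum_cvg.
Qed.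

Lemma eq_sumser u v : u =1 v -> sumser u = sumser v.
Proof. by move=> uv; congr sumser; apply/funext. Qed.

Lemma sumserS u : abssum (fun n => u n.+1) -> u 0%N = 0 ->
  sumser u = sumser (fun n => u n.+1).
Proof.
move=> su u0; apply/cvg_lim => //; rewrite -cvg_shiftS.
have -> : [sequence series u n.+1]_n = series (fun n => u n.+1).
  by apply/funext => n; rewrite /series /= big_nat_recl // u0 add0r.
exact: abssum_cvg.
Qed.

(* The coefficients of an entire function B with B(4 q) = (1 - 4 q) B(q), which
   therefore vanishes at all the powers 4^k. *)
Fixpoint euler_coeff n : R :=
  if n is m.+1 then - (4 * euler_coeff m / (4 ^+ n - 1)) else 1.
Local Notation b := euler_coeff.

Lemma pow4_gt n : n.+1%:R <= 4 ^+ n.+1 - 1 :> R.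
Proof.
elim: n => [|n IH]; first by rewrite expr1; lra.
by rewrite exprS -natr1; have : 0 <= n%:R :> R by []; lra.
Qed.

Lemma pow4_ge1 n : 1 <= 4 ^+ n :> R. Proof. by apply: exprn_ege1; lra. Qed.

(** Successive terms have ratio 4 q / (4^(n+1) - 1) in absolute value, at most 4 |q| / (n + 1), the
    ratio for the exponential series. *)
Lemma euler_coeff_bound q n : `|b n * q ^+ n| <= exp_coeff (4 * `|q|) n.
Proof.
elim: n => [|n IH]; first by rewrite /exp_coeff /= expr0 mulr1 normr1 fact0 divr1.
have p := pow4_gt n.
have p0 : 0 < 4 ^+ n.+1 - 1 :> R by apply: lt_le_trans p; rewrite ltr0n.
have -> : b n.+1 * q ^+ n.+1 = - (4 * q / (4 ^+ n.+1 - 1)) * (b n * q ^+ n).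
  by rewrite [b n.+1]/= [q ^+ _]exprS; field; rewrite gt_eqF.
have -> : exp_coeff (4 * `|q|) n.+1 = (4 * `|q| / n.+1%:R) * exp_coeff (4 * `|q|) n.
  rewrite /exp_coeff /= factS natrM exprS.
  have ? : n`!%:R != 0 :> R by rewrite pnatr_eq0 -lt0n fact_gt0.
  have ? : n.+1%:R != 0 :> R by rewrite pnatr_eq0.
  by rewrite invfM; ring.
rewrite normrM; apply: ler_pM => //.
rewrite normrN 2!normrM normfV (ger0_norm (ltW p0)) (ger0_norm (_ : 0 <= 4)) //.
by apply: ler_wpM2l; [exact: mulr_ge0|rewrite lef_pV2 ?posrE ?ltr0n].
Qed.

Lemma euler_coeff_abssum q : abssum (fun n => b n * q ^+ n).
Proof.
apply: (@series_le_cvg _ _ (exp_coeff (4 * `|q|))) => //.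
- by move=> n; apply: exp_coeff_ge0; exact: mulr_ge0.
- by move=> n; exact: euler_coeff_bound.
- exact: is_cvg_series_exp_coeff.
Qed.

Lemma euler_sum_eq q :
  sumser (fun n => b n * (4 * q) ^+ n) = (1 - 4 * q) * sumser (fun n => b n * q ^+ n).
Proof.
have s1 := @euler_coeff_abssum (4 * q); have s2 := @euler_coeff_abssum q.
rewrite mulrBl mul1r; apply/eqP; rewrite -subr_eq0 opprB addrA.
pose u n := b n * (4 * q) ^+ n + (-1) * (b n * q ^+ n).
have su : abssum u by apply: abssumD => //; exact: abssumZ.
have uS n : u n.+1 = - (4 * q) * (b n * q ^+ n).
  have p0 : 4 ^+ n.+1 - 1 != 0 :> R.
    by rewrite gt_eqF // (lt_le_trans _ (pow4_gt n)).
  rewrite /u exprMn.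
  have -> : b n.+1 * (4 ^+ n.+1 * q ^+ n.+1) + -1 * (b n.+1 * q ^+ n.+1) =
    b n.+1 * (4 ^+ n.+1 - 1) * q ^+ n.+1 by ring.
  by rewrite [b n.+1]/= mulNr divfK // exprS; ring.
have : sumser u = sumser (fun n => u n.+1).
  apply: sumserS; last by rewrite /u !expr0; ring.
  by rewrite /abssum; under eq_fun do rewrite uS; exact: abssumZ.
rewrite (eq_sumser uS) sumserZ // /u sumserD //; last exact: abssumZ.
by rewrite sumserZ // => E; apply/eqP; lra.
Qed.

Lemma euler_sum0 k : sumser (fun n => b n * (4 ^+ k) ^+ n) = 0.
Proof.
elim: k => [|k IH]; last by rewrite exprS euler_sum_eq IH mulr0.
(* At q = 1/4 the factor 1 - 4 q vanishes, which gives B(1) = 0; the functional equation then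
   propagates the zero to all powers of 4. *)
have := euler_sum_eq 4^-1; rewrite mulfV ?pnatr_eq0 // subrr mul0r.
by rewrite expr0.
Qed.

(* Chosen so that S(4 q) + S(q) = B(q), hence S(4^k) = (-1)^k S(1). *)
Definition seeley0 n : R := b n / (1 + 4 ^+ n).

Lemma seeley0_abssum q : abssum (fun n => seeley0 n * q ^+ n).
Proof.
apply: abssum_le (@euler_coeff_abssum q) => n.
rewrite !normrM; apply: ler_wpM2r => //; rewrite ler_piMr // normfV.
have p := pow4_ge1 n.
by rewrite invf_le1 ger0_norm; lra.
Qed.

Lemma euler_coeff_gt0 d : 0 < b d.*2.
Proof.
elim: d => [//|d IH]; rewrite doubleS /=.
have h n : 0 < 4 ^+ n.+1 - 1 :> R by apply: lt_le_trans (pow4_gt n); rewrite ltr0n.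
by rewrite mulrN mulNr opprK divr_gt0 // mulr_gt0 // divr_gt0 // mulr_gt0.
Qed.

(** S(1) has to be invertible for the normalisation. The terms alternate in sign, and each even term
    outweighs the next odd one: with x = 4^(2 d) >= 1 the pair has the sign of 16 x^2 - 4 x - 5. *)
Lemma seeley0_sum_gt0 : 0 < sumser seeley0.
Proof.
have := @lt_sum_lim_series R seeley0 0; rewrite big_geq //; apply.
  apply: abssum_cvg; have := @seeley0_abssum 1.
  by rewrite /abssum; under eq_fun do rewrite expr1n mulr1.
move=> d; rewrite !add0n /seeley0.
have b0 := euler_coeff_gt0 d; have p := pow4_ge1 d.*2.
rewrite [b d.*2.+1]/= exprS.
move: (b d.*2) (4 ^+ d.*2) b0 p => B x B0 x1.
have -> : B / (1 + x) + - (4 * B / (4 * x - 1)) / (1 + 4 * x) =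
  B * (16 * x ^+ 2 - 4 * x - 5) / ((1 + x) * (4 * x - 1) * (1 + 4 * x)).
  by field; rewrite !gt_eqF //; lra.
apply: divr_gt0; first by apply: mulr_gt0 => //; nra.
by rewrite !mulr_gt0 //; lra.
Qed.

Definition rapid c := forall k, abssum (fun n => c n * (4 ^+ k) ^+ n).

(* Seeley's moment conditions: x |-> sum_n c_n k(- 4^n x) extends a function k on
   the half-line smoothly across 0. *)
Definition reflecting c :=
  rapid c /\ forall i, sumser (fun n => c n * (- 4 ^+ n) ^+ i) = 1.

(** From S(4^i) = (-1)^i S(1), the coefficients of S divided by S(1) have i-th moment at the nodes -
    4^n equal to (-1)^i S(4^i) / S(1) = 1. *)
Lemma reflecting_ex : exists c, reflecting c.
Proof.
have s0 := seeley0_sum_gt0; set s := sumser seeley0 in s0 *.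
exists (fun n => s^-1 * seeley0 n).
have E i n : s^-1 * seeley0 n * (- 4 ^+ n) ^+ i =
   ((-1) ^+ i * s^-1) * (seeley0 n * (4 ^+ i) ^+ n).
  by rewrite exprNn exprAC; ring.
split=> [k|i].
  rewrite /abssum; under eq_fun do rewrite -mulrA.
  by apply: abssumZ; exact: seeley0_abssum.
rewrite (eq_sumser (E i)) sumserZ; last exact: seeley0_abssum.
suff -> : sumser (fun n => seeley0 n * (4 ^+ i) ^+ n) = (-1) ^+ i * s.
  have : (-1) ^+ i * (-1) ^+ i = 1 :> R by rewrite -exprMn mulrNN mulr1 expr1n.
  move: ((-1) ^+ i) => e ee.
  have -> : e * s^-1 * (e * s) = (e * e) * (s^-1 * s) by ring.
  by rewrite ee mul1r mulVf // gt_eqF.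
elim: i => [|i IH].
  by rewrite mul1r; apply: eq_sumser => n; rewrite expr0 expr1n mulr1.
have := euler_sum0 i.
have -> : sumser (fun n => b n * (4 ^+ i) ^+ n) =
  sumser (fun n => seeley0 n * (4 ^+ i.+1) ^+ n + seeley0 n * (4 ^+ i) ^+ n).
  apply: eq_sumser => n; rewrite /seeley0 [4 ^+ i.+1]exprS exprMn.
  by have p := pow4_ge1 n; field; rewrite gt_eqF //; lra.
rewrite sumserD; [|exact: seeley0_abssum|exact: seeley0_abssum].
by rewrite IH [(-1) ^+ i.+1]exprS => H; lra.
Qed.

(** Differentiating k(- 4^n x) brings out the factor - 4^n. The new weights have the old moments
    with index raised by one, so the extension of a derivative is of the same form. *)
Lemma reflecting_shift c : reflecting c -> reflecting (fun n => - 4 ^+ n * c n).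
Proof.
move=> [rc mc]; split=> [k|i].
  have := rc k.+1; rewrite /abssum; under eq_fun do rewrite normrM.
  under [X in _ -> cvgn (series X)]eq_fun do rewrite mulrAC normrM normrM normrN.
  suff -> : (fun n => `|4 ^+ n| * `|(4 ^+ k) ^+ n| * `|c n|) =
            (fun n => `|c n| * `|(4 ^+ k.+1) ^+ n| : R) by [].
  by apply/funext => n; rewrite -normrM [4 ^+ k.+1]exprS exprMn mulrC.
apply: etrans (mc i.+1); apply: eq_sumser => n.
by rewrite exprS; ring.
Qed.

End Seeley.

Ltac nonneg := repeat first [ assumption | by [] | exact: sqr_ge0 | exact: exprn_ge0 | apply: mulr_ge0 | apply: addr_ge0 | exact: ltW ].

(** * Smooth extension across the end of an interval *)

Section Extension.
Context {R : realType}.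
Implicit Types (k l : R -> R) (c : nat -> R).

Definition quadratic_error (k k' : R -> R) (M : R) := forall x y : R, 0 <= x -> 0 <= y ->
  `|k y - k x - (y - x) * k' x| <= M * (y - x) ^+ 2.

Definition bounded_half k := exists2 M : R, 0 <= M & forall x : R, 0 <= x -> `|k x| <= M.

(* One-sided regularity is measured by quadratic Taylor estimates, which survive
   the summation of the reflected copies of k. *)
Fixpoint tame n k : Prop := bounded_half k /\
  if n is m.+1 then exists k', tame m k' /\ exists2 M : R, 0 <= M & quadratic_error k k' M
  else True.

Lemma tame_bounded n k : tame n k -> bounded_half k.
Proof. by case: n => [|n] []. Qed.

Lemma tame_pred n k : tame n.+1 k -> tame n k.
Proof.
elim: n k => [|n IH] k [kb [k' [tk' qk]]]; first by [].
by split => //; exists k'; split => //; exact: IH.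
Qed.

Lemma bounded_halfM k l : bounded_half k -> bounded_half l ->
  bounded_half (fun x => k x * l x).
Proof.
move=> [M M0 kM] [N N0 lN]; exists (M * N); first exact: mulr_ge0.
by move=> x x0; rewrite normrM; apply: ler_pM => //; [exact: kM|exact: lN].
Qed.

Lemma bounded_halfD k l : bounded_half k -> bounded_half l ->
  bounded_half (fun x => k x + l x).
Proof.
move=> [M M0 kM] [N N0 lN]; exists (M + N); first exact: addr_ge0.
move=> x x0; apply: le_trans (ler_normD _ _) _.
by apply: lerD => //; [exact: kM|exact: lN].
Qed.

Lemma tame_add n k l : tame n k -> tame n l -> tame n (fun x => k x + l x).
Proof.
elim: n k l => [|n IH] k l.
  by move=> [kb _] [lb _]; split => //; exact: bounded_halfD.
move=> [kb [k' [tk' [M M0 kM]]]] [lb [l' [tl' [N N0 lN]]]].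
split; first exact: bounded_halfD.
exists (fun x => k' x + l' x); split; first exact: IH.
exists (M + N); first exact: addr_ge0.
move=> x y x0 y0.
have -> : k y + l y - (k x + l x) - (y - x) * (k' x + l' x) =
  (k y - k x - (y - x) * k' x) + (l y - l x - (y - x) * l' x) by ring.
apply: le_trans (ler_normD _ _) _; rewrite [leRHS]mulrDl.
exact: (lerD (kM _ _ x0 y0) (lN _ _ x0 y0)).
Qed.

Lemma tame_cst n a : tame n (fun=> a).
Proof.
elim: n a => [|n IH] a; have ba : bounded_half (fun=> a) by exists `|a|.
  by [].
split => //; exists (fun=> 0); split; first exact: IH.
by exists 0 => // x y _ _; rewrite subrr mulr0 subr0 normr0 mul0r.
Qed.

(** For increments of length at most 1 the quadratic estimate is already linear; for longer ones the
    bound on [k] suffices. This gives one Lipschitz constant on the whole half-line. *)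
Lemma quadratic_lip k k' M C C' : quadratic_error k k' M -> 0 <= M ->
  0 <= C -> (forall x, 0 <= x -> `|k x| <= C) ->
  0 <= C' -> (forall x, 0 <= x -> `|k' x| <= C') ->
  forall x y : R, 0 <= x -> 0 <= y -> `|k y - k x| <= (C' + M + 2 * C) * `|y - x|.
Proof.
move=> kM M0 C0 kC C'0 kC' x y x0 y0.
have [xy|xy] := lerP `|y - x| 1; last first.
  apply: (@le_trans _ _ (2 * C)).
    have := ler_normB (k y) (k x); have := kC x x0; have := kC y y0; lra.
  apply: (@le_trans _ _ ((C' + M + 2 * C) * 1)); first by lra.
  by apply: ler_wpM2l; [rewrite !addr_ge0 // mulr_ge0|exact: ltW].
have -> : k y - k x = (y - x) * k' x + (k y - k x - (y - x) * k' x) by ring.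
apply: le_trans (ler_normD _ _) _.
have h1 : `|(y - x) * k' x| <= C' * `|y - x|.
  by rewrite normrM mulrC; apply: ler_wpM2r => //; exact: kC'.
have h2 : M * (y - x) ^+ 2 <= M * `|y - x|.
  by apply: ler_wpM2l => //; rewrite -real_normK ?num_real // expr2 ler_piMr.
have h3 : 0 <= 2 * C * `|y - x| by rewrite !mulr_ge0.
by have h4 := kM x y x0 y0; lra.
Qed.

(** The error of a product is the two errors multiplied by bounded factors plus the cross term (y -
    x) k'(x) (l(y) - l(x)), which is quadratic because [l] is Lipschitz. *)
Lemma tame_mul n k l : tame n k -> tame n l -> tame n (fun x => k x * l x).
Proof.
elim: n k l => [|n IH] k l.
  by move=> [kb _] [lb _]; split => //; exact: bounded_halfM.
move=> tk tl; have [kb [k' [tk' [M M0 kM]]]] := tk; have [lb [l' [tl' [N N0 lN]]]] := tl.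
split; first exact: bounded_halfM.
exists (fun x => k' x * l x + k x * l' x); split.
  by apply: tame_add; apply: IH => //; exact: tame_pred.
have [C C0 kC] := kb; have [D D0 lD] := lb; have [C' C'0 kC'] := tame_bounded tk'.
have [D' D'0 lD'] := tame_bounded tl'.
have lip := quadratic_lip lN N0 D0 lD D'0 lD'.
exists (M * D + C * N + C' * (D' + N + 2 * D)).
  by rewrite !(addr_ge0, mulr_ge0).
move=> x y x0 y0.
have -> : k y * l y - k x * l x - (y - x) * (k' x * l x + k x * l' x) =
  (k y - k x - (y - x) * k' x) * l y + k x * (l y - l x - (y - x) * l' x)
  + (y - x) * k' x * (l y - l x) by ring.
apply: le_trans (ler_normD _ _) _; rewrite [leRHS]mulrDl; apply: lerD.
  apply: le_trans (ler_normD _ _) _; rewrite [leRHS]mulrDl; apply: lerD.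
    by rewrite normrM mulrAC; apply: ler_pM => //; [exact: kM|exact: lD].
  by rewrite normrM -mulrA; apply: ler_pM => //; [exact: kC|exact: lN].
rewrite 2!normrM -[(y - x) ^+ 2]real_normK ?num_real // expr2.
have -> : C' * (D' + N + 2 * D) * (`|y - x| * `|y - x|) =
  (`|y - x| * C') * ((D' + N + 2 * D) * `|y - x|) by ring.
apply: ler_pM; [exact: mulr_ge0|exact: normr_ge0| |exact: lip].
by apply: ler_wpM2l => //; exact: kC'.
Qed.

Lemma tame_shrink n : tame n (fun x => (1 + x)^-1).
Proof.
have wb : bounded_half (fun x => (1 + x)^-1).
  by exists 1 => // x x0; rewrite ger0_norm ?invr_ge0; [rewrite invf_le1|]; lra.
elim: n => [//|n IH]; split => //.
exists (fun x => (-1) * ((1 + x)^-1 * (1 + x)^-1)); split.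
  by apply: tame_mul; [exact: tame_cst|exact: tame_mul].
exists 1 => // x y x0 y0.
have -> : (1 + y)^-1 - (1 + x)^-1 - (y - x) * (-1 * ((1 + x)^-1 * (1 + x)^-1)) =
   (1 + x)^-1 * (1 + x)^-1 * (1 + y)^-1 * (y - x) ^+ 2.
  by field; rewrite !gt_eqF //; lra.
have v (z : R) : 0 <= z -> 0 <= (1 + z)^-1 <= 1.
  by move=> z0; apply/andP; split; [rewrite invr_ge0|rewrite invf_le1]; lra.
have /andP[vx0 vx1] := v x x0; have /andP[vy0 vy1] := v y y0.
rewrite ger0_norm; last by nonneg.
apply: ler_wpM2r; first exact: sqr_ge0.
by apply: mulr_ile1; [nonneg|nonneg|exact: mulr_ile1|by []].
Qed.

(** The family [h] plays the role of the successive one-sided derivatives on [0, b]. Reflection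
    samples the function at the unbounded points 4^n x, so the bounds must hold on the whole
    half-line; precomposing with b x / (1 + x), whose derivative b / (1 + x)^2 is itself tame,
    achieves this. *)
Lemma tame_comp (h : nat -> R -> R) (b : R) n i : 0 < b ->
  (forall i, exists2 M : R, 0 <= M & forall x : R, 0 <= x <= b -> `|h i x| <= M) ->
  (forall i, exists2 M : R, 0 <= M & forall x y : R, 0 <= x <= b -> 0 <= y <= b ->
     `|h i y - h i x - (y - x) * h i.+1 x| <= M * (y - x) ^+ 2) ->
  tame n (fun x => h i (b * x * (1 + x)^-1)).
Proof.
move=> b0 hb hq.
have mb (x : R) : 0 <= x -> 0 <= b * x * (1 + x)^-1 <= b.
  move=> x0; have x1 : 0 < 1 + x by lra.
  apply/andP; split; first by apply: divr_ge0; nonneg.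
  by rewrite ler_pdivrMr //; nra.
have hbm j : bounded_half (fun x => h j (b * x * (1 + x)^-1)).
  by have [M M0 hM] := hb j; exists M => // x x0; apply: hM; exact: mb.
elim: n i => [|n IH] i; first by split.
split => //.
exists (fun x => h i.+1 (b * x * (1 + x)^-1) * (b * ((1 + x)^-1 * (1 + x)^-1))).
split; first by do ![apply: tame_mul|exact: tame_cst|exact: tame_shrink|exact: IH].
have [M M0 hM] := hq i; have [C C0 hC] := hbm i.+1.
exists (M * b ^+ 2 + C * b); first by nonneg.
move=> x y x0 y0.
have := hM _ _ (mb x x0) (mb y y0); have := hC x x0.
have v (z : R) : 0 <= z -> 0 <= (1 + z)^-1 <= 1.
  by move=> z0; apply/andP; split; [rewrite invr_ge0|rewrite invf_le1]; lra.
have /andP[vx0 vx1] := v x x0; have /andP[vy0 vy1] := v y y0.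
have E : b * y * (1 + y)^-1 - b * x * (1 + x)^-1 = (y - x) * (b * (1 + x)^-1 * (1 + y)^-1).
  by field; rewrite !gt_eqF //; lra.
rewrite E; move: (h i _) (h i.+1 _) (h i _) => Hx H' Hy hC' hE.
have -> : Hy - Hx - (y - x) * (H' * (b * ((1 + x)^-1 * (1 + x)^-1))) =
  (Hy - Hx - (y - x) * (b * (1 + x)^-1 * (1 + y)^-1) * H')
  - H' * (b * ((1 + x)^-1 * (1 + x)^-1 * (1 + y)^-1) * (y - x) ^+ 2).
  by field; rewrite !gt_eqF //; lra.
apply: le_trans (ler_normB _ _) _; rewrite [leRHS]mulrDl; apply: lerD.
  apply: le_trans hE _; rewrite exprMn.
  have -> : M * b ^+ 2 * (y - x) ^+ 2 = M * ((y - x) ^+ 2 * b ^+ 2) by ring.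
  apply: ler_wpM2l => //; apply: ler_wpM2l; first exact: sqr_ge0.
  apply: lerXn2r; rewrite ?nnegrE; [nonneg|exact: ltW|].
  by rewrite -mulrA; apply: ler_piMr; [exact: ltW|exact: mulr_ile1].
rewrite normrM -[leRHS]mulrA; apply: ler_pM => //.
rewrite ger0_norm; last by nonneg.
apply: ler_wpM2r; first exact: sqr_ge0.
by apply: ler_piMr; [exact: ltW|apply: mulr_ile1; [nonneg|nonneg|exact: mulr_ile1|by []]].
Qed.

Definition reflection c k x := sumser (fun n => c n * k (4 ^+ n * x)).

Lemma pow4_ge0 n : 0 <= 4 ^+ n :> R. Proof. exact: exprn_ge0. Qed.

Lemma rapid_abssum c : rapid c -> abssum c.
Proof.
by move=> /(_ 0%N); rewrite /abssum; under eq_fun do rewrite expr0 expr1n mulr1.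
Qed.

Lemma reflection_abssum c k x : rapid c -> bounded_half k -> 0 <= x ->
  abssum (fun n => c n * k (4 ^+ n * x)).
Proof.
move=> /rapid_abssum rc [M M0 kM] x0; apply: (@abssum_le _ _ _ _ (@abssumZ _ M _ rc)) => n.
rewrite !normrM mulrC (ger0_norm M0); apply: ler_wpM2r => //.
by apply: kM; rewrite mulr_ge0 // pow4_ge0.
Qed.

(** The n-th term contributes at most M |c_n| (4^n (y - x))^2, and the weights |c_n| 16^n are
    summable because [c] is rapid. *)
Lemma reflection_error c k k' M : rapid c -> bounded_half k -> bounded_half k' ->
  0 <= M -> quadratic_error k k' M ->
  exists2 N : R, 0 <= N &
    quadratic_error (reflection c k) (reflection (fun n => 4 ^+ n * c n) k') N.
Proof.
move=> rc kb kb' M0 kM.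
have rc' : rapid (fun n => 4 ^+ n * c n).
  move=> i; apply: (@abssum_le _ _ _ _ (rc i.+1)) => n.
  by rewrite [4 ^+ i.+1]exprS exprMn mulrCA !mulrA.
pose v n := M * `|c n * (4 ^+ 2) ^+ n|.
have sv : abssum v.
  by apply: abssumZ; rewrite /abssum; under eq_fun do rewrite normr_id; exact: (rc 2%N).
have v0 n : 0 <= v n by exact: mulr_ge0.
exists (sumser v).
  apply: le_trans (_ : `|sumser (fun=> 0 : R)| <= _) => //.
  by apply: sumser_norm => // n; rewrite normr0.
move=> x y x0 y0.
have sy := reflection_abssum rc kb y0; have sx := reflection_abssum rc kb x0.
have sx' := reflection_abssum rc' kb' x0.
have -> : reflection c k y - reflection c k x - (y - x) * reflection (fun n => 4 ^+ n * c n) k' x =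
  sumser (fun n => c n * (k (4 ^+ n * y) - k (4 ^+ n * x) - (4 ^+ n * y - 4 ^+ n * x) * k' (4 ^+ n * x))).
  set A := (fun n => c n * k (4 ^+ n * y)) in sy *.
  set B := (fun n => c n * k (4 ^+ n * x)) in sx *.
  set D := (fun n => 4 ^+ n * c n * k' (4 ^+ n * x)) in sx' *.
  rewrite (_ : sumser _ = sumser (fun n => A n + ((-1) * B n + (- (y - x)) * D n))).
    have sB := @abssumZ _ (-1) _ sx; have sD := @abssumZ _ (- (y - x)) _ sx'.
    rewrite (sumserD sy (abssumD sB sD)) (sumserD sB sD) !sumserZ //.
    by rewrite /reflection; ring.
  by apply: eq_sumser => n; rewrite /A /B /D; ring.
have key n : `|c n * (k (4 ^+ n * y) - k (4 ^+ n * x) -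
    (4 ^+ n * y - 4 ^+ n * x) * k' (4 ^+ n * x))| <= (y - x) ^+ 2 * v n.
  have p := pow4_ge0 n.
  have -> : (y - x) ^+ 2 * v n = `|c n| * (M * (4 ^+ n * y - 4 ^+ n * x) ^+ 2).
    rewrite /v normrM (ger0_norm (_ : 0 <= (4 ^+ 2) ^+ n)); last by rewrite exprn_ge0 // sqr_ge0.
    by rewrite exprAC; ring.
  by rewrite normrM; apply: ler_wpM2l => //; apply: kM; exact: mulr_ge0.
apply: le_trans (sumser_norm key (@abssumZ _ _ _ sv)) _.
by rewrite sumserZ // mulrC.
Qed.

Definition extend c k (x : R) : R := if 0 <= x then k x else reflection c k (- x).

(** The moment of order zero makes the two branches agree at 0, so the reflected formula may be used
    there as well. *)
Lemma extend_neg c k x : reflecting c -> x <= 0 -> extend c k x = reflection c k (- x).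
Proof.
move=> [rc mc] x0; rewrite /extend; case: ifP => // x0'.
have -> : x = 0 by apply/eqP; rewrite eq_le x0 x0'.
rewrite oppr0 /reflection; have /eq_sumser -> : (fun n => c n * k (4 ^+ n * 0)) =1 (fun n => k 0 * (c n * (- 4 ^+ n) ^+ 0)).
  by move=> n; rewrite mulr0 expr0 mulr1 mulrC.
rewrite sumserZ ?mc ?mulr1 //.
by rewrite /abssum; under eq_fun do rewrite expr0 mulr1; exact: rapid_abssum.
Qed.

(** On each closed half-line the error is quadratic, with a common constant. The point 0 lies on
    both and the values there agree for the function and for the candidate derivative, so the two
    one-sided derivatives glue. *)
Lemma extend_derive c k k' M x : reflecting c -> bounded_half k -> bounded_half k' ->
  0 <= M -> quadratic_error k k' M ->
  is_derive (x : R) 1 (extend c k) (extend (fun n => - 4 ^+ n * c n) k' x).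
Proof.
move=> rc kb kb' M0 kM; have [N N0 rN] := reflection_error rc.1 kb kb' M0 kM.
have rc' := reflecting_shift rc.
have side y : (0 <= x) && (0 <= y) || (x <= 0) && (y <= 0) ->
  `|extend c k y - extend c k x - (y - x) * extend (fun n => - 4 ^+ n * c n) k' x| <= (M + N) * (y - x) ^+ 2.
  move=> /orP[/andP[x0 y0]|/andP[x0 y0]].
    rewrite /extend x0 y0; apply: le_trans (kM _ _ x0 y0) _.
    by rewrite ler_wpM2r ?sqr_ge0 // lerDl.
  rewrite !extend_neg //.
  have -> : reflection (fun n => - 4 ^+ n * c n) k' (- x) =
      - reflection (fun n => 4 ^+ n * c n) k' (- x).
    rewrite -[RHS]mulN1r -sumserZ.
      by apply: eq_sumser => n; rewrite !mulNr mul1r.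
    apply: reflection_abssum => //; last by rewrite oppr_ge0.
    move=> i; apply: (@abssum_le _ _ _ _ (rc'.1 i)) => n.
    by rewrite !mulNr [leRHS]normrN.
  have := rN (- x) (- y); rewrite !oppr_ge0 => /(_ x0 y0).
  have -> : - y - - x = - (y - x) by ring.
  rewrite sqrrN (mulrN (y - x)) -(mulNr (y - x)) => /le_trans; apply.
  by rewrite ler_wpM2r ?sqr_ge0 // lerDr.
apply: is_derive_remainder => e e0.
have MN : 0 < M + N + 1 by rewrite ltr_wpDl ?addr_ge0.
have near_side : \forall h \near (0 : R), (0 <= x) && (0 <= h + x) || (x <= 0) && (h + x <= 0).
  case: (ltgtP x 0) => [x0|x0|->].
  - near=> h; rewrite /=; have : `|h| < - x by near: h; apply: (@nbhs0_lt R R); rewrite oppr_gt0.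
    by rewrite ltr_norml => /andP[_ ?]; lra.
  - near=> h; rewrite /= orbF; have : `|h| < x by near: h; exact: (@nbhs0_lt R R).
    by rewrite ltr_norml => /andP[? _]; lra.
  - by apply: filterE => h; rewrite addr0 /=; exact: le_total.
near=> h; have := side (h + x) (near near_side h _) => /(_ ltac:(by [])).
rewrite addrK => /le_trans; apply; rewrite -real_normK ?num_real // expr2 mulrA.
apply: ler_wpM2r => //.
have : `|h| < e / (M + N + 1) by near: h; apply: (@nbhs0_lt R R); exact: divr_gt0.
rewrite ltr_pdivlMr // => he; have h0 : 0 <= `|h| by []; lra.
Unshelve. all: by end_near. Qed.

(** One order of tameness is spent because continuity is obtained from the derivative. *)
Lemma extend_smooth n c k : reflecting c -> tame n.+1 k -> Ck n setT (extend c k).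
Proof.
elim: n c k => [|n IH] c k rc [kb [k' [tk' [M M0 kM]]]].
  move=> x _; apply: differentiable_continuous; apply/derivable1_diffP.
  by have [] := extend_derive x rc kb (@tame_bounded 0 _ tk') M0 kM.
apply: (@CkS_R _ _ _ _ (extend (fun n => - 4 ^+ n * c n) k')) => [|x _|]; [exact: openT|exact: (extend_derive x rc kb (@tame_bounded n.+1 _ tk') M0 kM)|].
by apply: IH => //; exact: reflecting_shift.
Qed.

Lemma one_sided_extension (h : nat -> R -> R) (b : R) : 0 < b ->
  (forall i, exists2 M : R, 0 <= M & forall x : R, 0 <= x <= b -> `|h i x| <= M) ->
  (forall i, exists2 M : R, 0 <= M & forall x y : R, 0 <= x <= b -> 0 <= y <= b ->
     `|h i y - h i x - (y - x) * h i.+1 x| <= M * (y - x) ^+ 2) ->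
  exists2 H : R -> R, smooth_at (0 : R) H & forall x, 0 <= x < b -> H x = h 0%N x.
Proof.
move=> b0 hb hq; have [c rc] := @reflecting_ex R.
(* The Moebius map x |-> b x / (1 + x) sends the half-line to [0, b[. *)
pose k x := h 0%N (b * x * (1 + x)^-1).
(* The inverse x / (b - x) of that map is smooth near 0 and preserves the sign there, so the
   extension for negative arguments is transported back. *)
exists (fun x => extend c k (x * (b - x)^-1)).
  have sf : smooth_at (0 : R) (fun x : R => x * (b - x)^-1).
    apply: smooth_mul; first exact: smooth_id.
    apply: smooth_inv; first by rewrite subr0 gt_eqF.
    by apply: smooth_add; [exact: smooth_cst|apply: smooth_opp; exact: smooth_id].
  have sg : smooth_at (0 * (b - 0)^-1 : R) (extend c k).
    exists setT; first by split => //; exact: openT.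
    by move=> n; apply: extend_smooth => //; exact: tame_comp hb hq.
  exact: smooth_comp_R_R sf sg.
move=> x /andP[x0 xb]; have bx : 0 < b - x by lra.
rewrite /extend ifT; last by rewrite mulr_ge0 ?invr_ge0 // ltW.
rewrite /k; congr (h _ _); field.
by rewrite subrK !gt_eqF.
Qed.

End Extension.

(** * Whitney's theorem on even functions and the decomposition of a cusp *)

Section Whitney.
Context {R : realType}.

(** Here [df] is the derivative with respect to x^2. The functions M x^2 - f and M x^2 + f have
    derivative 2 x (M -+ df) >= 0 on the nonnegative axis, hence are nondecreasing. *)
Lemma sqr_lipschitz (f df : R -> R) (s t M : R) : 0 <= s -> 0 <= t ->
  (forall x, Num.min s t <= x <= Num.max s t -> is_derive (x : R) 1 f (2 * x * df x)) ->
  (forall x, Num.min s t <= x <= Num.max s t -> `|df x| <= M) ->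
  `|f t - f s| <= M * `|t ^+ 2 - s ^+ 2|.
Proof.
wlog st : s t / s <= t => [W s0 t0|].
  have /orP[st|ts] := le_total s t; first exact: W st s0 t0.
  move=> fD fM; rewrite distrC [`|t ^+ 2 - _|]distrC; apply: W => // x.
    by rewrite minC maxC; exact: fD.
  by rewrite minC maxC; exact: fM.
rewrite (min_idPl st) (max_idPr st) => s0 t0 fD fM.
have sg e : e = 1 \/ e = -1 -> 0 <= M * (t ^+ 2 - s ^+ 2) - e * (f t - f s).
  move=> he.
  have gD (x : R) : s <= x <= t ->
      is_derive x 1 (fun x => M * x ^+ 2 - e * f x) (2 * x * (M - e * df x)).
    by move=> /fD Dx; isde; rewrite /= expr1; ring.
  have gc : {within `[s, t], continuous (fun x => M * x ^+ 2 - e * f x)}.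
    apply: derivable_within_continuous => x; rewrite in_itv /= => /gD Dx.
    by have [] := Dx.
  have [|c] := @MVT_segment R (fun x => M * x ^+ 2 - e * f x)
    (fun x => 2 * x * (M - e * df x)) s t st _ gc.
    by move=> x; rewrite in_itv /= => /andP[/ltW ? /ltW ?]; apply: gD; apply/andP.
  rewrite in_itv /= => cst E.
  have -> : M * (t ^+ 2 - s ^+ 2) - e * (f t - f s) =
    M * t ^+ 2 - e * f t - (M * s ^+ 2 - e * f s) by ring.
  rewrite E; have /andP[sc ct] := cst.
  have := fM c cst; rewrite ler_norml => /andP[m1 m2].
  apply: mulr_ge0; last by rewrite subr_ge0.
  apply: mulr_ge0; first by rewrite mulr_ge0 // (le_trans s0).
  by case: he => ->; lra.
have s2 : 0 <= t ^+ 2 - s ^+ 2 by rewrite subr_ge0 lerXn2r.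
rewrite (ger0_norm s2) ler_norml.
by have := sg 1 (or_introl erefl); have := sg (-1) (or_intror erefl); lra.
Qed.

Lemma minmax_between (s t c x : R) : 0 <= s <= c -> 0 <= t <= c ->
  Num.min s t <= x <= Num.max s t -> 0 <= x <= c.
Proof.
move=> /andP[s0 sc] /andP[t0 tc] /andP[mx xm].
by rewrite (le_trans _ mx) ?le_min ?s0 // (le_trans xm) // ge_max sc.
Qed.

Lemma sqr_between (s t x : R) : 0 <= s -> 0 <= t ->
  Num.min s t <= x <= Num.max s t -> `|x ^+ 2 - s ^+ 2| <= `|t ^+ 2 - s ^+ 2|.
Proof.
move=> s0 t0; have /orP[st|ts] := le_total s t.
  rewrite (min_idPl st) (max_idPr st) => /andP[sx xt].
  have x0 := le_trans s0 sx.
  rewrite !ger0_norm ?subr_ge0 ?lerXn2r ?nnegrE //.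
  by rewrite lerD2r lerXn2r ?nnegrE.
rewrite (min_idPr ts) (max_idPl ts) => /andP[tx xs].
have x0 := le_trans t0 tx.
rewrite distrC [leRHS]distrC !ger0_norm ?subr_ge0 ?lerXn2r ?nnegrE //.
by rewrite lerD2l lerN2 lerXn2r ?nnegrE.
Qed.

Section EvenSequence.
Variable r : R.
Let U := [set t : R | `|t| < r].

Definition smooth_even (e : R -> R) :=
  (forall m, Ck m U e) /\ forall t, U t -> e (- t) = e t.

Lemma odd_quotient_even (g g1 : R -> R) : (forall t, g t = t * g1 t) ->
  (forall t, U t -> g (- t) = - g t) -> forall t, U t -> g1 (- t) = g1 t.
Proof.
move=> gg1 odd t Ut; have [->|t0] := eqVneq t 0; first by rewrite oppr0.
have := odd t Ut; rewrite !gg1 mulNr => /oppr_inj /(mulfI t0).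
exact.
Qed.

Lemma normlt_opp t : U t -> U (- t). Proof. by rewrite /U /= normrN. Qed.

(** The derivative of an even function is odd, so it vanishes at 0 and Hadamard division gives t g1
    with g1 even; half of g1 is the derivative with respect to t^2. *)
Lemma smooth_even_next e : smooth_even e ->
  exists e', smooth_even e' /\ forall t : R, U t -> is_derive t 1 e (2 * t * e' t).
Proof.
move=> [Ce ev]; have De t (Ut : U t) := Ck_is_derive (Ce 1%N) Ut.
have odd t : U t -> 'D_1 e (- t) = - 'D_1 e t.
  move=> Ut; have UNt := normlt_opp Ut.
  have D1 := De _ UNt.
  have id1 : is_derive t 1 (fun x : R => - x) (-1) by isde.
  have := isD_compR D1 id1.
  have D2 : is_derive t 1 (fun y => e (- y)) ('D_1 e t).
    apply: near_eq_is_derive (De _ Ut).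
    near=> y; rewrite ev //; near: y; apply: (@open_near R R U t) => //.
    exact: open_normlt.
  by move=> [_]; have [_ ->] := D2 => ->; rewrite mulN1r opprK.
have Cg m : Ck m U ('D_1 e) by have [_] := Ce m.+1; exact.
(* If r <= 0 the interval [U] is empty and the claims on it are vacuous. *)
have [U0|nU0] := pselect (U 0); last first.
  have nU t : ~ U t by move=> Ut; apply: nU0; rewrite /U /= normr0 (le_lt_trans _ Ut).
  by exists e; split => [|t /nU].
have g0 : 'D_1 e 0 = 0.
  by have := odd 0 U0; rewrite oppr0 => /eqP; rewrite -subr_eq0 opprK -mulr2n mulrn_eq0 /= => /eqP.
have [g1 Cg1 gg1] := hadamard_lemma Cg g0.
exists (fun t => 2^-1 * g1 t); split; first split.
- by move=> m; apply: Ck_mul; [exact: open_normlt|exact: Ck_cst|exact: Cg1].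
- by move=> t Ut; rewrite (odd_quotient_even gg1 odd).
- move=> t Ut; apply: is_derive_eq (De _ Ut) _; rewrite gg1; field.
Unshelve. all: by end_near. Qed.

Lemma smooth_even_sequence e : smooth_even e -> exists E : nat -> R -> R,
  [/\ E 0%N = e, forall i, smooth_even (E i) &
      forall i (t : R), U t -> is_derive t 1 (E i) (2 * t * E i.+1 t)].
Proof.
move=> se.
have /choice[F FP] : forall e, exists e', smooth_even e ->
    smooth_even e' /\ forall t : R, U t -> is_derive t 1 e (2 * t * e' t).
  move=> e1; have [/smooth_even_next[e' He']|ne] := pselect (smooth_even e1).
    by exists e'.
  by exists e1.
exists (fun i => iter i F e).
have s i : smooth_even (iter i F e) by elim: i => //= i /FP[].
by split => // i; have [] := FP _ (s i).
Qed.

End EvenSequence.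

Lemma smooth_ball (f : R -> R) : smooth_at (0 : R) f ->
  exists2 r, 0 < r & forall m, Ck m [set t : R | `|t| < r] f.
Proof.
move=> [U [Uo U0] Uf]; have /nbhs_ballP[r /= r0 rU] : nbhs (0 : R) U by exact: open_nbhs_nbhs.
exists r => // m; apply: Ck_sub (Uf m) => t /= tr; apply: rU.
by rewrite /ball /= sub0r normrN.
Qed.

(* Whitney's theorem on even functions: the derivatives of x |-> e (sqrt x) are
   the E i (sqrt x), where E (i + 1) t = (E i)' t / (2 t). *)
Lemma even_sqr (e : R -> R) : smooth_at (0 : R) e ->
  (\forall t \near (0 : R), e (- t) = e t) ->
  exists2 H : R -> R, smooth_at (0 : R) H & \forall t \near (0 : R), e t = H (t ^+ 2).
Proof.
move=> /smooth_ball[r1 r10 Ce] /nbhs_ballP[r2 /= r20 ev].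
pose r := Num.min r1 r2; have r0 : 0 < r by rewrite lt_min r10 r20.
have se : smooth_even r e.
  split=> [m|t /= tr].
    by apply: Ck_sub (Ce m) => t /=; rewrite lt_min => /andP[].
  by apply: ev; rewrite /ball /= sub0r normrN; move: tr; rewrite lt_min => /andP[].
have [E [E0 sE DE]] := smooth_even_sequence se.
pose c := r / 2; have c0 : 0 < c by rewrite divr_gt0.
have cr t : 0 <= t <= c -> `|t| < r.
  by move=> /andP[t0 tc]; rewrite ger0_norm // (le_lt_trans tc) // /c; lra.
have Eb i : exists2 M : R, 0 <= M & forall t : R, 0 <= t <= c -> `|E i t| <= M.
  have Ec : {within `[0, c], continuous (fun t => `|E i t|)}.
    apply/continuous_in_subspaceT => t; rewrite inE /= in_itv /= => /cr tr.
    by apply: continuous_comp; [exact: ((sE i).1 0%N)|exact: norm_continuous].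
  have [m _ mM] := EVT_max (ltW c0) Ec.
  by exists `|E i m| => // t t0c; apply: mM; rewrite in_itv.
have lip i (M s t : R) : (forall t : R, 0 <= t <= c -> `|E i.+1 t| <= M) ->
    0 <= s <= c -> 0 <= t <= c -> `|E i t - E i s| <= M * `|t ^+ 2 - s ^+ 2|.
  move=> EM sct tct; have /andP[s0 sc] := sct; have /andP[t0 tc] := tct.
  have btw x : Num.min s t <= x <= Num.max s t -> 0 <= x <= c by apply: minmax_between.
  apply: (sqr_lipschitz (df := E i.+1)) => // x /btw xc; last exact: EM.
  by apply: DE; exact: cr.
(* Subtracting x^2 times the constant E_(i+1)(s) leaves a function whose derivative in x^2 is
   E_(i+1)(x) - E_(i+1)(s), already Lipschitz in x^2. A second use of [sqr_lipschitz] makes the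
   error quadratic. *)
have quad i : exists2 M : R, 0 <= M & forall s t : R, 0 <= s <= c -> 0 <= t <= c ->
    `|E i t - E i s - (t ^+ 2 - s ^+ 2) * E i.+1 s| <= M * (t ^+ 2 - s ^+ 2) ^+ 2.
  have [M M0 EM] := Eb i.+2; exists M => // s t sc tc.
  pose f x := E i x - x ^+ 2 * E i.+1 s.
  have -> : E i t - E i s - (t ^+ 2 - s ^+ 2) * E i.+1 s = f t - f s by rewrite /f; ring.
  rewrite -real_normK ?num_real // expr2 mulrA.
  have /andP[s0 sc'] := sc; have /andP[t0 tc'] := tc.
  have btw x : Num.min s t <= x <= Num.max s t -> 0 <= x <= c by apply: minmax_between.
  apply: (sqr_lipschitz (df := fun x => E i.+1 x - E i.+1 s)) => // x xst.
    have xc := btw x xst; have Dx := DE i x (cr x xc).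
    by rewrite /f; isde; rewrite /= expr1; ring.
  apply: le_trans (lip _ _ _ _ EM sc (btw _ xst)) _; apply: ler_wpM2l => //.
  exact: sqr_between.
have c2 : 0 < c ^+ 2 by exact: exprn_gt0.
have sq x : 0 <= x <= c ^+ 2 -> 0 <= Num.sqrt x <= c.
  move=> /andP[x0 xc]; rewrite sqrtr_ge0 /=.
  by have := ler_wsqrtr xc; rewrite sqrtr_sqr ger0_norm // ltW.
have [||H sH HE] := @one_sided_extension R (fun i x => E i (Num.sqrt x)) (c ^+ 2) c2.
- move=> i; have [M M0 EM] := Eb i; exists M => // x xc; apply: EM; exact: sq.
- move=> i; have [M M0 EM] := quad i; exists M => // x y xc yc.
  have := EM _ _ (sq _ xc) (sq _ yc).
  by rewrite !sqr_sqrtr //; [case/andP: xc|case/andP: yc].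
exists H => //; near=> t.
have tc : `|t| < c by near: t; exact: (@nbhs0_lt R R).
rewrite HE; last by rewrite sqr_ge0 /= -real_normK ?num_real // ltrXn2r ?nnegrE // ltW.
rewrite sqrtr_sqr E0; have [t0|/ltW t0] := leP 0 t; first by rewrite ger0_norm.
by rewrite ler0_norm // (se.2 t) //= (lt_trans tc).
Unshelve. all: by end_near. Qed.

Lemma smooth_oppid (g : R -> R) : smooth_at (0 : R) g -> smooth_at (0 : R) (fun t => g (- t)).
Proof.
move=> sg; have so : smooth_at (0 : R) (fun t : R => - t) by apply: smooth_opp; exact: smooth_id.
by have sg' : smooth_at (- 0 : R) g; [rewrite oppr0|exact: smooth_comp_R_R so sg'].
Qed.

Lemma hadamard_smooth (g : R -> R) : smooth_at (0 : R) g -> g 0 = 0 ->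
  exists2 g1 : R -> R, smooth_at (0 : R) g1 & forall t, g t = t * g1 t.
Proof.
move=> /smooth_ball[r r0 Cg] g0; have [g1 Cg1 gg1] := hadamard_lemma Cg g0.
exists g1 => //; exists [set t : R | `|t| < r] => //.
by split; [exact: open_normlt|rewrite /= normr0].
Qed.

(** The even part is G0(t^2). The odd part is t times an even function, so it is t H(t^2); here H(0)
    is the derivative of g at 0, hence zero, and one more division H(x) = x G1(x) produces the
    factor t^3. *)
Lemma cusp_decomposition (g : R -> R) : smooth_at (0 : R) g -> 'D_1 g 0 = 0 ->
  exists G0 G1 : R -> R, [/\ smooth_at (0 : R) G0, smooth_at (0 : R) G1 &
    \forall t \near (0 : R), g t = G0 (t ^+ 2) + t ^+ 3 * G1 (t ^+ 2)].
Proof.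
move=> sg Dg0; have sgN := smooth_oppid sg.
have se : smooth_at (0 : R) (fun t => 2^-1 * (g t + g (- t))).
  by apply: smooth_mul; [exact: smooth_cst|exact: smooth_add].
have so : smooth_at (0 : R) (fun t => 2^-1 * (g t - g (- t))).
  by apply: smooth_mul; [exact: smooth_cst|apply: smooth_add => //; exact: smooth_opp].
have [|G0 sG0 G0E] := even_sqr se.
  by apply: filterE => t; rewrite opprK addrC.
have [|o so1 oE] := hadamard_smooth so; first by rewrite oppr0 subrr mulr0.
have [|H sH HE] := even_sqr so1.
  apply: filterE => t; have [->|t0] := eqVneq t 0; first by rewrite oppr0.
  apply: (mulfI t0); apply: oppr_inj; rewrite -mulNr -!oE opprK -mulrN opprB //.
have o0 : o 0 = 0.
  have D1 : is_derive (0 : R) 1 (fun t => 2^-1 * (g t - g (- t))) 0.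
    have D := smooth_isD1 sg; have DN := smooth_isD1 sgN.
    have : 'D_1 (fun t => g (- t)) 0 = 0.
      have id1 : is_derive (0 : R) 1 (fun x : R => - x) (-1) by isde.
      have D' : is_derive (- 0 : R) 1 g ('D_1 g 0) by rewrite oppr0.
      by have [_ ->] := isD_compR D' id1; rewrite Dg0 mulr0.
    by move=> DN0; isde; rewrite Dg0 DN0; ring.
  have D2 : is_derive (0 : R) 1 (fun t => t * o t) (o 0).
    by have D := smooth_isD1 so1; isde; ring.
  have E : (fun t => 2^-1 * (g t - g (- t))) = (fun t => t * o t) by exact/funext.
  by move: D1; rewrite E => D1; have [_ d1] := D1; have [_ d2] := D2; rewrite -d2 d1.
have H0 : H 0 = 0 by have := nbhs_singleton HE; rewrite o0 expr0n.
have [G1 sG1 G1E] := hadamard_smooth sH H0.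
exists G0, G1; split => //; near=> t.
have <- : 2^-1 * (g t + g (- t)) = G0 (t ^+ 2) by near: t.
have -> : t ^+ 3 * G1 (t ^+ 2) = t * H (t ^+ 2) by rewrite G1E; ring.
have <- : o t = H (t ^+ 2) by near: t.
by rewrite -oE; field.
Unshelve. all: by end_near. Qed.

Lemma cusp_decomposition_rV n (g : R -> 'rV[R]_n) : smooth_at (0 : R) g -> 'D_1 g 0 = 0 ->
  exists G0 G1 : R -> 'rV[R]_n, [/\ smooth_at (0 : R) G0, smooth_at (0 : R) G1 &
    \forall t \near (0 : R), g t = G0 (t ^+ 2) + t ^+ 3 *: G1 (t ^+ 2)].
Proof.
move=> sg Dg0.
have /choice[G GP] : forall i : 'I_n, exists G : (R -> R) * (R -> R),
    [/\ smooth_at (0 : R) G.1, smooth_at (0 : R) G.2 &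
    \forall t \near (0 : R), g t 0 i = G.1 (t ^+ 2) + t ^+ 3 * G.2 (t ^+ 2)].
  move=> i; have [||G0 [G1 [? ? ?]]] := @cusp_decomposition (fun t => g t 0 i).
  - exact: smooth_coord.
  - by have [_ ->] := isD_coord 0 i (smooth_isD1 sg); rewrite Dg0 mxE.
  - by exists (G0, G1).
exists (fun x => \row_i (G i).1 x), (fun x => \row_i (G i).2 x); split.
- by apply: smooth_rV => i; under eq_fun do rewrite mxE; have [] := GP i.
- by apply: smooth_rV => i; under eq_fun do rewrite mxE; have [] := GP i.
- have : \forall t \near (0 : R), forall i, g t 0 i = (G i).1 (t ^+ 2) + t ^+ 3 * (G i).2 (t ^+ 2).
    have Gn i : \forall t \near (0 : R), g t 0 i = (G i).1 (t ^+ 2) + t ^+ 3 * (G i).2 (t ^+ 2).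
      by have [] := GP i.
    exact: (filter_forall _ Gn).
  by apply: filterS => t gt; apply/rowP => i; rewrite !mxE.
Qed.

End Whitney.

(** * The inverse function theorem *)

Section MatrixNorm.
Context {R : realType}.

Lemma rV_norm_le n (v : 'rV[R]_n) (c : R) : 0 <= c -> (forall i, `|v 0 i| <= c) -> `|v| <= c.
Proof.
move=> c0 vc; rewrite /Num.Def.normr /= mx_normrE.
by apply: bigmax_le => // -[i j] _ /=; rewrite ord1.
Qed.

Lemma rV_coord_le n (v : 'rV[R]_n) i : `|v 0 i| <= `|v|.
Proof.
rewrite [leRHS]/Num.Def.normr /= mx_normrE.
exact: (le_bigmax _ (fun ij : 'I_1 * 'I_n => `|v ij.1 ij.2|) (0, i)).
Qed.

Lemma mulmx_norm_le m n (w : 'rV[R]_m) (M : 'M[R]_(m, n)) (e : R) : 0 <= e ->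
  (forall i j, `|M i j| <= e) -> `|w *m M| <= m%:R * e * `|w|.
Proof.
move=> e0 Me; apply: rV_norm_le => [|j]; first by rewrite !mulr_ge0.
rewrite mxE; apply: le_trans (ler_norm_sum _ _ _) _.
apply: (@le_trans _ _ (\sum_(i < m) e * `|w|)).
  by apply: ler_sum => i _; rewrite normrM mulrC; apply: ler_pM => //; exact: rV_coord_le.
by rewrite sumr_const card_ord -mulrA mulr_natl.
Qed.

Lemma mulmx_norm_bound m n (M : 'M[R]_(m, n)) :
  exists2 C, 0 < C & forall w : 'rV[R]_m, `|w *m M| <= C * `|w|.
Proof.
pose e := \sum_i \sum_j `|M i j|.
have e0 : 0 <= e by apply: sumr_ge0 => i _; exact: sumr_ge0.
exists (m%:R * e + 1); first by rewrite ltr_wpDl // mulr_ge0.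
move=> w; apply: (@le_trans _ _ (m%:R * e * `|w|)); last by rewrite ler_wpM2r // lerDl.
apply: mulmx_norm_le => // i j; rewrite /e (bigD1 i) //= (bigD1 j) //=.
by rewrite -addrA lerDl addr_ge0 // sumr_ge0 // => ? _; exact: sumr_ge0.
Qed.

Lemma Ck_mulmxr m n k (M : 'M[R]_(m, n)) : Ck k setT (fun w : 'rV[R]_m => w *m M).
Proof.
have Uo : open [set: 'rV[R]_m] by exact: openT.
apply: Ck_rV => // i; under eq_fun do rewrite mxE.
apply: Ck_sum => // j; apply: Ck_mul => //; last exact: Ck_cst.
by apply: (@Ck_coord _ _ _ _ _ _ (fun x => x)) => //; exact: Ck_id.
Qed.

Lemma mulmxr_continuous m n (M : 'M[R]_(m, n)) : continuous (fun w : 'rV[R]_m => w *m M).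
Proof. by move=> w; exact: (@Ck_mulmxr _ _ 0 M w I). Qed.

Lemma Ck_bigsum (V : normedModType R) k (U : set V) I (r : seq I) (P : pred I) (f : I -> V -> R) : open U ->
  (forall i, Ck k U (f i)) -> Ck k U (fun x => \sum_(i <- r | P i) f i x).
Proof.
move=> Uo fC; elim: r => [|i r IH].
  by under eq_fun do rewrite big_nil; exact: Ck_cst.
under eq_fun do rewrite big_cons; case: (P i) => //.
exact: Ck_add.
Qed.

Lemma Ck_bigprod (V : normedModType R) k (U : set V) I (r : seq I) (P : pred I) (f : I -> V -> R) : open U ->
  (forall i, Ck k U (f i)) -> Ck k U (fun x => \prod_(i <- r | P i) f i x).
Proof.
move=> Uo fC; elim: r => [|i r IH].
  by under eq_fun do rewrite big_nil; exact: Ck_cst.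
under eq_fun do rewrite big_cons; case: (P i) => //.
exact: Ck_mul.
Qed.

Lemma Ck_det (V : normedModType R) k (U : set V) n (A : V -> 'M[R]_n) : open U ->
  (forall i j, Ck k U (fun x => A x i j : R)) -> Ck k U (fun x => \det (A x)).
Proof.
move=> Uo AC; apply: Ck_bigsum => // s; apply: Ck_mul => //; first exact: Ck_cst.
exact: Ck_bigprod.
Qed.

Lemma Ck_invmx (V : normedModType R) k (U : set V) n (A : V -> 'M[R]_n) : open U ->
  (forall x, U x -> A x \in unitmx) ->
  (forall i j, Ck k U (fun x => A x i j : R)) ->
  forall i j, Ck k U (fun x => invmx (A x) i j : R).
Proof.
move=> Uo Au AC i j.
apply: (@Ck_ext _ _ _ _ _ (fun x => (\det (A x))^-1 * cofactor (A x) j i)) => //.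
  by move=> x /Au Ax; rewrite /invmx Ax !mxE.
apply: Ck_mul => //.
  apply: (Ck_comp_R Uo (@open_neq _ 0) _ _ (Ck_inv _)); last exact: Ck_det.
  by move=> x /Au; rewrite unitmxE unitfE.
apply: Ck_mul => //; first exact: Ck_cst.
apply: Ck_det => // i' j'.
by under eq_fun do rewrite !mxE; exact: AC.
Qed.

End MatrixNorm.

Section InverseFunction.
Context {R : realType} {n : nat}.
Implicit Types (F : 'rV[R]_n -> 'rV[R]_n) (p : 'rV[R]_n).

Lemma jacobian_entry F x i j : differentiable F x ->
  jacobian F x i j = ('D_(delta_mx 0 i) F x) 0 j.
Proof. move=> dF; rewrite (deriveEjacobian _ dF). by rewrite -rowE [RHS]mxE. Qed.

(** The mean value theorem holds only for scalar functions, so the contraction estimate below is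
    made one coordinate at a time. *)
Lemma segment_mean_value (f : 'rV[R]_n -> R) x y :
  (forall t : R, 0 <= t <= 1 -> differentiable f (x + t *: (y - x))) ->
  exists2 t : R, 0 <= t <= 1 & f y - f x = 'D_(y - x) f (x + t *: (y - x)).
Proof.
move=> fd; pose l (t : R) := x + t *: (y - x).
have Dl t : is_derive (t : R) 1 l (y - x).
  have D1 := isD_idR t 1; have D2 := isD_cst t (1 : R) (y - x); have D3 := isD_cst t (1 : R) x.
  apply: is_derive_eq (isD_add D3 (isD_scale D1 D2)) _.
  by rewrite add0r scale1r scaler0 addr0.
have Dg (t : R) : 0 <= t <= 1 -> is_derive t 1 (fun t => f (l t)) ('D_(y - x) f (l t)).
  move=> t01; have df := fd t t01.
  have Df : is_derive (l t) (y - x) f ('D_(y - x) f (l t)).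
    by apply: derivableP; exact: diff_derivable.
  exact: (isD_comp Df (isD_diff1 (Dl t)) df (Dl t)).
have [||t] := @MVT_segment R (fun t => f (l t)) (fun t => 'D_(y - x) f (l t)) 0 1 ler01.
- by move=> t; rewrite in_itv /= => /andP[/ltW ? /ltW ?]; apply: Dg; apply/andP.
- by apply: derivable_within_continuous => t; rewrite in_itv /= => /Dg[].
rewrite in_itv /= => t01 E; exists t => //.
by move: E; rewrite /l scale1r [x + (y - x)]addrC subrK scale0r addr0 subr0 mulr1.
Qed.

End InverseFunction.

(** * The contraction argument *)

Section InverseFunctionTheorem.
Context {R : realType} {n : nat}.
Implicit Types (F : 'rV[R]_n -> 'rV[R]_n) (p : 'rV[R]_n).

Variables (F : 'rV[R]_n -> 'rV[R]_n) (p : 'rV[R]_n) (U : set 'rV[R]_n).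
Hypothesis Uo : open U.
Hypothesis FC : forall k, Ck k U F.

Variables (A : 'M[R]_n) (r : R).
Hypothesis r0 : 0 < r.
Hypothesis Au : A \in unitmx.
Let B := [set x : 'rV[R]_n | `|p - x| <= r].
Hypothesis BU : B `<=` U.
(** The simplified Newton map with the fixed matrix [A], close to an inverse of the Jacobian: since
    [A] is invertible, F x = y means that x is fixed by x |-> res x + y A. *)
Let res (x : 'rV[R]_n) : 'rV[R]_n := x - F x *m A.
Hypothesis small : forall x, B x -> forall i j,
  `|(1%:M - jacobian F x *m A) i j| <= (n%:R * 2 + 1)^-1.

Let Fd x : B x -> differentiable F x.
Proof. by move=> /BU Ux; have [dF _] := FC 1; exact: dF. Qed.

Lemma ball_convex x y (t : R) : B x -> B y -> 0 <= t <= 1 -> B (x + t *: (y - x)).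
Proof.
move=> Bx By /andP[t0 t1]; rewrite /B /=.
have -> : p - (x + t *: (y - x)) = (1 - t) *: (p - x) + t *: (p - y).
  by apply/rowP => i; rewrite !mxE; ring.
apply: le_trans (ler_normD _ _) _; rewrite !normrZ (ger0_norm t0) ger0_norm; last by lra.
have -> : r = (1 - t) * r + t * r by ring.
by apply: lerD; apply: ler_wpM2l => //; lra.
Qed.

(** In the sup norm a matrix with entries at most e has norm at most n e, and n / (2 n + 1) <= 1/2.
    The added 1 keeps the bound meaningful for n = 0. *)
Lemma res_contract_mx x (w : 'rV[R]_n) : B x -> `|w *m (1%:M - jacobian F x *m A)| <= 2^-1 * `|w|.
Proof.
move=> Bx; have n0 : 0 <= n%:R :> R by [].
have e0 : 0 <= (n%:R * 2 + 1)^-1 :> R by rewrite invr_ge0; lra.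
apply: le_trans (mulmx_norm_le _ e0 (small Bx)) _; apply: ler_wpM2r => //.
by rewrite ler_pdivrMr; lra.
Qed.

Lemma res_coord_derive (x : 'rV[R]_n) i (v : 'rV[R]_n) : B x -> is_derive x v (fun x => res x 0 i)
  ((v *m (1%:M - jacobian F x *m A)) 0 i).
Proof.
move=> Bx; have DF : is_derive x v F (v *m jacobian F x).
  by rewrite -deriveEjacobian; [exact/derivableP/diff_derivable/Fd|exact: Fd].
have DFA : is_derive x v (fun x => F x *m A) (v *m jacobian F x *m A).
  have dl : differentiable (fun w : 'rV[R]_n => w *m A) (F x).
    exact: (@linear_differentiable _ _ _ (mulmxr A) _ (@mulmxr_continuous _ _ _ A)).
  apply: (isD_comp (g := fun w => w *m A) _ (Fd Bx) dl DF).
  split; first exact: diff_derivable.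
  by rewrite deriveE // (@diff_lin _ _ _ (mulmxr A) _ (@mulmxr_continuous _ _ _ A)).
have := isD_add (isD_id x v) (isD_opp DFA).
by rewrite mulmxBr mulmx1 mulmxA => /(isD_coord 0 i).
Qed.

Lemma res_contract x y : B x -> B y -> `|res y - res x| <= 2^-1 * `|y - x|.
Proof.
move=> Bx By; apply: rV_norm_le => [|i]; first by rewrite mulr_ge0.
have D (t : R) : 0 <= t <= 1 -> forall v, is_derive (x + t *: (y - x)) v (fun x => res x 0 i)
  ((v *m (1%:M - jacobian F (x + t *: (y - x)) *m A)) 0 i).
  by move=> t01 v; apply: res_coord_derive; exact: ball_convex.
have [t t01|t t01 E] := @segment_mean_value _ _ (fun x => res x 0 i) x y.
  have Bz := ball_convex Bx By t01.
  apply: (@differentiable_comp _ _ _ _ res (fun v : 'rV[R]_n => v 0 i)); last exact: differentiable_coord.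
  apply: differentiableB => //; apply: (@differentiable_comp _ _ _ _ F (fun w : 'rV[R]_n => w *m A)).
    exact: Fd.
  exact: (@linear_differentiable _ _ _ (mulmxr A) _ (@mulmxr_continuous _ _ _ A)).
have -> : (res y - res x) 0 i = res y 0 i - res x 0 i.
  by rewrite [LHS]mxE [X in _ + X = _]mxE.
rewrite E.
have [_ ->] := D t t01 (y - x).
apply: le_trans (rV_coord_le _ _) _; apply: res_contract_mx; exact: ball_convex.
Qed.

(** Since y - x is the increment of [res], at most half as long, plus (F y - F x) A, the latter
    carries at least the other half. Injectivity and the Lipschitz bound of the inverse both
    follow. *)
Lemma expansion x y : B x -> B y -> `|y - x| <= 2 * `|(F y - F x) *m A|.
Proof.
move=> Bx By; have := res_contract Bx By.
have -> : y - x = (res y - res x) + (F y - F x) *m A.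
  by rewrite /res mulmxBl; apply/rowP => i; rewrite !mxE; ring.
have := ler_normD (res y - res x) ((F y - F x) *m A); lra.
Qed.

Lemma jacobian_unit x : B x -> jacobian F x \in unitmx.
Proof.
move=> Bx; rewrite -row_free_unit; apply/inj_row_free => w wJ.
have := res_contract_mx w Bx; rewrite mulmxBr mulmx1 mulmxA wJ mul0mx subr0 => H.
have w0 : 0 <= `|w| by [].
by apply/eqP; rewrite -normr_le0; lra.
Qed.

Lemma local_surjectivity y : `|(y - F p) *m A| <= r / 2 -> exists x, B x /\ F x = y.
Proof.
move=> yr; pose T x := res x + y *m A.
have Bp : B p by rewrite /B /= subrr normr0 ltW.
have TB : {homo T : x / B x >-> B x}.
  move=> x Bx; rewrite /B /= distrC.
  have -> : T x - p = (res x - res p) + (y - F p) *m A.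
    by rewrite /T /res mulmxBl; apply/rowP => i; rewrite !mxE; ring.
  apply: le_trans (ler_normD _ _) _.
  have := res_contract Bp Bx; move: Bx; rewrite /B /= distrC; lra.
pose X : completeNormedModType R := HB.pack_for (completeNormedModType R) ('rV[R]_n).
have [q q1 q2] : exists2 x : X, B x & x = @mkfun X X B B T TB x.
  apply: banach_fixed_point.
  - exists (2^-1)%:nng; split => /=; first lra.
    by move=> [x1 x2] [/= B1 B2]; rewrite /mkfun /T opprD addrACA subrr addr0; exact: res_contract.
  - rewrite (_ : B = closed_ball p r); first exact: closed_ball_closed.
    by rewrite closed_ballE.
  - by exists p.
exists q; split => //; apply: (can_inj (mulmxK Au)).
move/eqP: q2; rewrite /mkfun /T /res -addrA eq_sym -subr_eq0.
by rewrite addrAC subrr add0r addrC subr_eq0 => /eqP.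
Qed.

Lemma local_inverse : exists G : 'rV[R]_n -> 'rV[R]_n,
  forall y, `|(y - F p) *m A| <= r / 2 -> B (G y) /\ F (G y) = y.
Proof.
have /choice[G GP] : forall y, exists x, `|(y - F p) *m A| <= r / 2 -> B x /\ F x = y.
  move=> y; have [/local_surjectivity[x xP]|ny] := pselect (`|(y - F p) *m A| <= r / 2); first by exists x.
  by exists p.
by exists G.
Qed.

Section Inverse.
Variable G : 'rV[R]_n -> 'rV[R]_n.
Let N := [set y : 'rV[R]_n | `|(y - F p) *m A| < r / 2].
Hypothesis GP : forall y, N y -> B (G y) /\ F (G y) = y.

Lemma inverse_domain_open : open N.
Proof.
have Nc : continuous (fun y : 'rV[R]_n => `|y *m A - F p *m A|).
  have H k : Ck k setT (fun y : 'rV[R]_n => y *m A - F p *m A).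
    by apply: Ck_add; [exact: openT|exact: Ck_mulmxr|exact: Ck_cst].
  by move=> y; exact: (cvg_norm (H 0%N y I)).
rewrite (_ : N = (fun y : 'rV[R]_n => `|y *m A - F p *m A|) @^-1` [set t | t < r / 2]).
  by apply: open_comp; [move=> y _; exact: Nc|exact: open_lt].
by apply/seteqP; split => y; rewrite /N /= mulmxBl.
Qed.

Lemma inverse_left x : B x -> N (F x) -> G (F x) = x.
Proof.
move=> Bx NFx; have [BG FG] := GP NFx.
apply/eqP; rewrite -subr_eq0 -normr_le0.
by apply: le_trans (expansion Bx BG) _; rewrite FG subrr mul0mx normr0 mulr0.
Qed.

Lemma inverse_lipschitz : exists2 C, 0 < C &
  forall y y', N y -> N y' -> `|G y' - G y| <= C * `|y' - y|.
Proof.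
have [C C0 AC] := mulmx_norm_bound A.
exists (2 * C); first by rewrite mulr_gt0.
move=> y y' /GP[By Fy] /GP[By' Fy'].
apply: le_trans (expansion By By') _; rewrite Fy Fy' -mulrA.
by apply: ler_wpM2l => //; exact: AC.
Qed.

Lemma inverse_differentiable y : N y ->
  differentiable G y /\ forall v, 'D_v G y = v *m invmx (jacobian F (G y)).
Proof.
move=> Ny; have [By Fy] := GP Ny; set J := jacobian F (G y).
have Ju : J \in unitmx by exact: jacobian_unit.
have [C C0 GC] := inverse_lipschitz.
have [K K0 JK] := mulmx_norm_bound (invmx J).
have [] := @differentiable_remainder _ _ _ G y (mulmxr (invmx J)).
- exact: (@mulmxr_continuous _ _ _ (invmx J)).
- move=> e e0.
  (* The increment h of [G] is at most C |k| and the inverse Jacobian costs a factor K, so the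
     tolerance for [F] is e / (C K). *)
  have eCK : 0 < e / (C * K) by rewrite divr_gt0 // mulr_gt0.
  have /nbhs_ballP[d /= d0 dF] := differential_remainder (Fd By) eCK.
  near=> k.
  have Nk : N (k + y).
    near: k; apply: (@near_addr _ _ y N); exact: open_near inverse_domain_open Ny.
  have [Bk Fk] := GP Nk.
  set h := G (k + y) - G y.
  have hk : `|h| <= C * `|k| by have := GC _ _ Ny Nk; rewrite addrK.
  have hd : ball (0 : 'rV[R]_n) d h.
    rewrite -ball_normE /= sub0r normrN; apply: le_lt_trans hk _.
    rewrite -ltr_pdivlMl //; near: k; apply: (@nbhs0_lt _ 'rV[R]_n).
    by rewrite mulr_gt0 ?invr_gt0.
  have := dF h hd; rewrite /h subrK Fk Fy addrK -/h.
  have -> : 'd F (G y) h = h *m J by rewrite -deriveE; [rewrite deriveEjacobian; [|exact: Fd]|exact: Fd].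
  have -> : h - mulmxr (invmx J) k = - ((k - h *m J) *m invmx J).
    by rewrite /= mulmxBl mulmxK // opprB.
  rewrite normrN => H; apply: le_trans (JK _) _.
  apply: (@le_trans _ _ (K * (e / (C * K) * (C * `|k|)))).
    apply: ler_wpM2l; first exact: ltW.
    by apply: le_trans H _; apply: ler_wpM2l => //; exact: ltW.
  by rewrite le_eqVlt; apply/orP; left; apply/eqP; field; rewrite !gt_eqF.
- by move=> dG dGE; split => // v; rewrite deriveE // dGE.
Unshelve. all: by end_near. Qed.

(** Bootstrapping: the derivative of [G] is the inverse Jacobian of [F] at [G], a C^k expression as
    soon as [G] is C^k, so [G] is C^(k+1). *)
Lemma inverse_Ck k : Ck k N G.
Proof.
elim: k => [|k IH].
  by move=> y /inverse_differentiable[dG _]; exact: differentiable_continuous.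
have No := inverse_domain_open.
apply: (CkS (df := fun v y => v *m invmx (jacobian F (G y)))) => //.
- by move=> y /inverse_differentiable[].
- by move=> v y /inverse_differentiable[].
move=> v; apply: Ck_rV => // i; under eq_fun do rewrite mxE.
apply: Ck_sum => // j; apply: Ck_mul => //; first exact: Ck_cst.
apply: Ck_invmx => // [y /GP[By _]|i' j']; first exact: jacobian_unit.
apply: (@Ck_ext _ _ _ _ _ (fun y => ('D_(delta_mx 0 i') F (G y)) 0 j')) => //.
  by move=> y /GP[By _]; rewrite jacobian_entry //; exact: Fd.
apply: (@Ck_comp_rV _ _ _ _ _ U _ (fun x => ('D_(delta_mx 0 i') F x) 0 j')) => //.
  by move=> y /GP[/BU].
by apply: Ck_coord => //; have [_] := FC k.+1; exact.
Qed.

End Inverse.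

End InverseFunctionTheorem.

Lemma inverse_function {R : realType} n (F : 'rV[R]_n -> 'rV[R]_n) (p : 'rV[R]_n) :
  smooth_at p F -> (forall w, 'd F p w = 0 -> w = 0) ->
  exists G : 'rV[R]_n -> 'rV[R]_n, [/\ G (F p) = p, smooth_at (F p) G,
    \forall x \near p, G (F x) = x & \forall y \near F p, F (G y) = y].
Proof.
move=> smooth_surf0 inj; have [U [Uo Up] FC] := smooth_surf0.
have dF : differentiable F p by exact: smooth_diff.
have Ju : jacobian F p \in unitmx.
  rewrite -row_free_unit; apply/inj_row_free => w wJ; apply: inj.
  by rewrite -deriveE // deriveEjacobian.
have [A [JA Au]] : exists A, jacobian F p *m A = 1%:M /\ A \in unitmx.
  by exists (invmx (jacobian F p)); rewrite mulmxV // unitmx_inv.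
have e0 : 0 < (n%:R * 2 + 1)^-1 :> R by rewrite invr_gt0 ltr_wpDl // mulr_ge0.
have small : \forall x \near p, U x /\ forall i j, `|(1%:M - jacobian F x *m A) i j| <= (n%:R * 2 + 1)^-1.
  have [M ME] : exists M : 'rV[R]_n -> 'M[R]_n, forall x, 1%:M - jacobian F x *m A = M x.
    by exists (fun x => 1%:M - jacobian F x *m A).
  have Mp : M p = 0 by rewrite -ME JA subrr.
  have Mc i j : {for p, continuous (fun x => M x i j)}.
    have sJ : smooth_at p (fun x => (i == j)%:R - \sum_(k < n) ('D_(delta_mx 0 i) F x) 0 k * A k j).
      apply: smooth_add; first exact: smooth_cst.
      apply: smooth_opp; apply: smooth_sum => k; apply: smooth_mul; last exact: smooth_cst.
      by apply: smooth_coord; exact: smooth_derive.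
    apply: (smooth_cont (smooth_ext _ sJ)); near=> x.
    rewrite -ME !mxE; congr (_ - _); apply: eq_bigr => k _.
    rewrite jacobian_entry //; apply: smooth_diff; near: x; exact: (smooth_near smooth_surf0).
  have Jn i j : \forall x \near p, `|M x i j| <= (n%:R * 2 + 1)^-1.
    have /cvgrPdist_le H : (fun x => M x i j) @ p --> M p i j by exact: Mc.
    by apply: filterS (H _ e0) => x; rewrite Mp mxE sub0r normrN.
  have Jn' i : \forall x \near p, forall j, `|M x i j| <= (n%:R * 2 + 1)^-1.
    exact: (filter_forall _ (Jn i)).
  have Jn'' : \forall x \near p, forall i j, `|M x i j| <= (n%:R * 2 + 1)^-1.
    exact: (filter_forall _ Jn').
  near=> x; split; first by near: x; exact: (open_near Uo Up).
  by move=> i j; rewrite ME; move: i j; near: x; exact: Jn''.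
have /nbhs_ballP[r1 /= r10 r1P] := small.
pose r := r1 / 2; have r0 : 0 < r by rewrite divr_gt0.
have BP x : `|p - x| <= r -> U x /\ forall i j, `|(1%:M - jacobian F x *m A) i j| <= (n%:R * 2 + 1)^-1.
  move=> xr; apply: r1P; rewrite -ball_normE /=; apply: le_lt_trans xr _.
  by rewrite /r ltr_pdivrMr // mulr_natr mulr2n ltrDl.
have BU x : `|p - x| <= r -> U x by case/BP.
have Bs x : `|p - x| <= r -> forall i j, `|(1%:M - jacobian F x *m A) i j| <= (n%:R * 2 + 1)^-1 by case/BP.
have [G GP] := local_inverse FC r0 Au BU Bs.
have GP' y : `|(y - F p) *m A| < r / 2 -> `|p - G y| <= r /\ F (G y) = y.
  by move=> /ltW /GP.
have NFp : `|(F p - F p) *m A| < r / 2 by rewrite subrr mul0mx normr0 divr_gt0.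
have No := @inverse_domain_open R n F p A r.
have Bp : `|p - p| <= r by rewrite subrr normr0 ltW.
exists G; split.
- exact: (inverse_left FC BU Bs GP').
- exists [set y | `|(y - F p) *m A| < r / 2]; first by split.
  by move=> k; exact: (inverse_Ck Uo FC BU Bs GP').
- near=> x; apply: (inverse_left FC BU Bs GP').
    near: x; have : nbhs p (ball p r) by exact: nbhsx_ballx.
    by apply: filterS => x; rewrite -ball_normE /= => /ltW.
  by near: x; apply: (smooth_cont smooth_surf0); exact: (open_near No NFp).
- by near=> y; apply: (GP' y _).2; near: y; exact: (open_near No NFp).
Unshelve. all: by end_near. Qed.

(** * The quadric model of the space form *)

Section LinearAlgebra.
Context {R : realType}.
Implicit Types (p v w x y z : 'rV[R]_4) (l : 'cV[R]_4).

Lemma detg_functional0 p x y z l : detg p x y z != 0 ->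
  p *m l = 0 -> x *m l = 0 -> y *m l = 0 -> z *m l = 0 -> l = 0.
Proof.
move=> d p0 x0 y0 z0; have Mu : (\matrix_(i < 4) [:: p; x; y; z]`_i) \in unitmx.
  by rewrite unitmxE unitfE.
apply: (can_inj (mulKmx Mu)); rewrite mulmx0; apply/row_matrixP => i.
rewrite row_mul rowK row0.
by case: i => [[|[|[|[|//]]]] ?].
Qed.

Lemma functional_detg p x y z :
  (forall l, p *m l = 0 -> x *m l = 0 -> y *m l = 0 -> z *m l = 0 -> l = 0) ->
  detg p x y z != 0.
Proof.
move=> H; apply/negP; rewrite /detg -det_tr => /det0P[v v0 vM].
have vM' : (\matrix_(i < 4) [:: p; x; y; z]`_i) *m v^T = 0.
  by apply: (can_inj trmxK); rewrite trmx_mul trmxK vM trmx0.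
have k i : [:: p; x; y; z]`_i *m v^T = 0 \/ (4 <= i)%N.
  have [i4|] := ltnP i 4; last by right.
  left; have := congr1 (row (Ordinal i4)) vM'.
  by rewrite row_mul rowK row0.
have vT : v^T = 0.
  by apply: H; [case: (k 0%N)|case: (k 1%N)|case: (k 2)|case: (k 3)].
by move: v0; rewrite -[v]trmxK vT trmx0 eqxx.
Qed.

Lemma mulmx_rows4 (c : 'rV[R]_4) p x y z :
  c *m (\matrix_(i < 4) [:: p; x; y; z]`_i) =
  c 0 0 *: p + c 0 1 *: x + c 0 2%:R *: y + c 0 3%:R *: z.
Proof.
rewrite mulmx_sum_row !big_ord_recl big_ord0 addr0 !rowK /= !addrA.
by congr (_ *: _ + _ *: _ + _ *: _ + _ *: _); congr (c 0 _); apply: val_inj.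
Qed.

Definition row4 (a b c d : R) : 'rV[R]_4 := \row_(i < 4) [:: a; b; c; d]`_i.

Lemma detg_free p x y z (a b c d : R) : detg p x y z != 0 ->
  a *: p + b *: x + c *: y + d *: z = 0 -> [/\ a = 0, b = 0, c = 0 & d = 0].
Proof.
move=> dn0 E; have Mu : (\matrix_(i < 4) [:: p; x; y; z]`_i) \in unitmx.
  by rewrite unitmxE unitfE.
have : row4 a b c d = 0.
  apply: (can_inj (mulmxK Mu)); rewrite mul0mx mulmx_rows4 !mxE /=.
  exact: E.
move=> /rowP H; split.
- by have := H 0; rewrite !mxE.
- by have := H 1; rewrite !mxE.
- by have := H 2%:R; rewrite !mxE.
- by have := H 3%:R; rewrite !mxE.
Qed.

Lemma free_detg p x y z :
  (forall a b c d, a *: p + b *: x + c *: y + d *: z = 0 -> [/\ a = 0, b = 0, c = 0 & d = 0]) ->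
  detg p x y z != 0.
Proof.
move=> H; apply/negP => /det0P[v v0]; rewrite mulmx_rows4 => /H[a b c d].
move/eqP: v0; apply; apply/rowP => i; rewrite mxE.
case: i => [[|[|[|[|//]]]] lti]; [rewrite -[RHS]a|rewrite -[RHS]b|rewrite -[RHS]c|rewrite -[RHS]d];
 by congr (v 0 _); apply: val_inj.
Qed.

Lemma detg_span p x y z w : detg p x y z != 0 ->
  exists a b c d, w = a *: p + b *: x + c *: y + d *: z.
Proof.
move=> dn0; have Mu : (\matrix_(i < 4) [:: p; x; y; z]`_i) \in unitmx.
  by rewrite unitmxE unitfE.
have := mulmx_rows4 (w *m invmx (\matrix_(i < 4) [:: p; x; y; z]`_i)) p x y z.
by rewrite mulmxKV // => ->; do 4 eexists.
Qed.

Lemma free3P x y z : reflect (forall a b c, a *: x + b *: y + c *: z = 0 -> [/\ a = 0, b = 0 & c = 0])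
  (free [:: x; y; z]).
Proof.
have E (k : 'I_3 -> R) : \sum_(i < 3) k i *: [tuple x; y; z]`_i =
   k 0 *: x + k 1 *: y + k 2%:R *: z.
  rewrite !big_ord_recl big_ord0 addr0 /= addrA.
  by congr (_ *: _ + _ *: _ + _ *: _); congr (k _); apply: val_inj.
apply: (iffP (@freeP _ _ _ [tuple x; y; z])) => [H a b c abc|H k].
  have := H (fun i => [:: a; b; c]`_i); rewrite E /= => /(_ abc) K.
  by split; [exact: (K 0)|exact: (K 1)|exact: (K 2%:R)].
rewrite E => /H[a b c] i.
by case: i => [[|[|[|//]]] lti]; [rewrite -[RHS]a|rewrite -[RHS]b|rewrite -[RHS]c]; congr (k _); apply: val_inj.
Qed.

Lemma free2P x y : reflect (forall a b, a *: x + b *: y = 0 -> a = 0 /\ b = 0)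
  (free [:: x; y]).
Proof.
have E (k : 'I_2 -> R) : \sum_(i < 2) k i *: [tuple x; y]`_i = k 0 *: x + k 1 *: y.
  rewrite !big_ord_recl big_ord0 addr0 /=.
  by congr (_ *: _ + _ *: _); congr (k _); apply: val_inj.
apply: (iffP (@freeP _ _ _ [tuple x; y])) => [H a b ab|H k].
  have := H (fun i => [:: a; b]`_i); rewrite E /= => /(_ ab) K.
  by split; [exact: (K 0)|exact: (K 1)].
rewrite E => /H[a b] i.
by case: i => [[|[|//]] lti]; [rewrite -[RHS]a|rewrite -[RHS]b]; congr (k _); apply: val_inj.
Qed.

End LinearAlgebra.

(** * The ambient form and positivity of the metric *)

Section Quadric.
Context {R : realType}.
Variable a : R.
Implicit Types (p V W X Y : 'rV[R]_4).

(** This is [a] times the metric on tangent vectors, free of division and so meaningful for a = 0.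
    The quadric is [aform p p = 1] and its tangent space is the orthogonal complement of p for this
    form. *)
Definition aform V W : R := V 0 0 * W 0 0 + a * sdot V W.

Lemma sdotE V W : sdot V W = V 0 1 * W 0 1 + V 0 2%:R * W 0 2%:R + V 0 3%:R * W 0 3%:R.
Proof.
rewrite /sdot !big_ord_recl big_ord0 addr0 addrA.
by congr (_ * _ + _ * _ + _ * _); congr (_ _ _); apply: val_inj.
Qed.

Lemma aformC V W : aform V W = aform W V.
Proof. by rewrite /aform !sdotE; ring. Qed.

Lemma aformDl V W X : aform (V + W) X = aform V X + aform W X.
Proof. by rewrite /aform !sdotE !mxE; ring. Qed.

Lemma aformZl c V X : aform (c *: V) X = c * aform V X.
Proof. by rewrite /aform !sdotE !mxE; ring. Qed.

Lemma aformDr V W X : aform X (V + W) = aform X V + aform X W.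
Proof. by rewrite aformC aformDl ![aform _ X]aformC. Qed.

Lemma aformZr c V X : aform X (c *: V) = c * aform X V.
Proof. by rewrite aformC aformZl aformC. Qed.

Lemma metricC V W : metric a V W = metric a W V.
Proof. by rewrite /metric !sdotE; ring. Qed.

Lemma metricDl V W X : metric a (V + W) X = metric a V X + metric a W X.
Proof. by rewrite /metric !sdotE !mxE; ring. Qed.

Lemma metricZl c V X : metric a (c *: V) X = c * metric a V X.
Proof. by rewrite /metric !sdotE !mxE; ring. Qed.

Lemma metricZr c V X : metric a X (c *: V) = c * metric a X V.
Proof. by rewrite metricC metricZl metricC. Qed.

Lemma tangentE p V : tangent a p V <-> aform p V = 0.
Proof. by []. Qed.

Lemma M3_aform p : M3 a p -> aform p p = 1.
Proof. by move=> [<- _]; rewrite /aform expr2. Qed.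

Lemma tangent0_time p V : a = 0 -> M3 a p -> aform p V = 0 -> V 0 0 = 0.
Proof.
move=> a0 [_ pos]; rewrite /aform a0 mul0r addr0 => /eqP; rewrite mulf_eq0.
have : 0 < p 0 0 by apply: pos; rewrite a0.
by move=> /gt_eqF -> /eqP.
Qed.

(* For a = 0 the factor a^-1 in the metric is the junk value 0; tangency repairs it. *)
Lemma aform_metric p V W : M3 a p -> aform p V = 0 -> aform V W = a * metric a V W.
Proof.
move=> Mp pV; rewrite /aform /metric mulrDr mulrA; congr (_ + _).
have [a0|a0] := eqVneq a 0; last by rewrite mulfV // mul1r.
by rewrite (tangent0_time a0 Mp pV) !mul0r !mulr0.
Qed.

(** The case a < 0 is the only delicate one: tangent vectors of the hyperboloid are spacelike, by
    Cauchy-Schwarz applied to the spatial parts of p and V in p_0 V_0 = - a p.V. *)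
Lemma metric_pos p V : M3 a p -> aform p V = 0 -> V != 0 -> 0 < metric a V V.
Proof.
move=> Mp pV V0.
have sV : 0 <= sdot V V by rewrite sdotE -!expr2 !addr_ge0 // sqr_ge0.
have V4 : V 0 0 != 0 \/ 0 < sdot V V.
  have [V00|] := eqVneq (V 0 0) 0; last by left.
  right; rewrite lt_neqAle sV andbT eq_sym; apply: contra V0 => /eqP.
  rewrite sdotE -!expr2 => S.
  have h1 : 0 <= V 0 1 ^+ 2 by exact: sqr_ge0.
  have h2 : 0 <= V 0 2%:R ^+ 2 by exact: sqr_ge0.
  have h3 : 0 <= V 0 3%:R ^+ 2 by exact: sqr_ge0.
  have e1 : V 0 1 = 0 by apply/eqP; rewrite -sqrf_eq0; apply/eqP; lra.
  have e2 : V 0 2%:R = 0 by apply/eqP; rewrite -sqrf_eq0; apply/eqP; lra.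
  have e3 : V 0 3%:R = 0 by apply/eqP; rewrite -sqrf_eq0; apply/eqP; lra.
  apply/eqP/rowP => i; rewrite mxE.
  by case: i => [[|[|[|[|//]]]] lti]; [rewrite -[RHS]V00|rewrite -[RHS]e1|rewrite -[RHS]e2|rewrite -[RHS]e3];
   congr (V 0 _); apply: val_inj.
rewrite /metric -expr2; have V2 : 0 <= V 0 0 ^+ 2 by exact: sqr_ge0.
have [a0|a0|a0] := ltgtP a 0.
- have [pp _] := Mp.
  have pS : 0 <= sdot p p by rewrite sdotE -!expr2 !addr_ge0 // sqr_ge0.
  have CS : sdot p V ^+ 2 <= sdot p p * sdot V V.
    rewrite !sdotE -subr_ge0.
    set p1 := p 0 1; set p2 := p 0 2%:R; set p3 := p 0 3%:R.
    set v1 := V 0 1; set v2 := V 0 2%:R; set v3 := V 0 3%:R.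
    have -> : (p1 * p1 + p2 * p2 + p3 * p3) * (v1 * v1 + v2 * v2 + v3 * v3) -
       (p1 * v1 + p2 * v2 + p3 * v3) ^+ 2 =
       (p1 * v2 - p2 * v1) ^+ 2 + (p1 * v3 - p3 * v1) ^+ 2 + (p2 * v3 - p3 * v2) ^+ 2 by ring.
    by rewrite !addr_ge0 // sqr_ge0.
  have E : p 0 0 * V 0 0 = - (a * sdot p V) by move: pV; rewrite /aform; lra.
  have E2 : p 0 0 ^+ 2 * V 0 0 ^+ 2 = a ^+ 2 * sdot p V ^+ 2.
    by rewrite -!exprMn E sqrrN.
  have K : p 0 0 ^+ 2 * V 0 0 ^+ 2 <= a ^+ 2 * (sdot p p * sdot V V).
    by rewrite E2; apply: ler_wpM2l CS; exact: sqr_ge0.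
  have pp1 : p 0 0 ^+ 2 = 1 - a * sdot p p by lra.
  have p2pos : 0 < p 0 0 ^+ 2 by rewrite pp1; nra.
  have [V00|V00] := eqVneq (V 0 0) 0.
    rewrite V00 expr0n mulr0 add0r; case: V4 => //; by rewrite V00 eqxx.
  have Vp : 0 < V 0 0 ^+ 2 by rewrite exprn_even_gt0.
  have sV0 : 0 < sdot V V.
    rewrite lt_neqAle sV andbT eq_sym; apply/negP => /eqP S0.
    by move: K; rewrite S0 !mulr0 leNgt mulr_gt0.
  (* Multiplying by - a p_0^2 > 0 removes a^-1. With p_0^2 = 1 - a p.p the result is the
     Cauchy-Schwarz gap [K] plus the positive term - a V.V. *)
  rewrite -(pmulr_rgt0 _ (_ : 0 < - a * p 0 0 ^+ 2)); last by rewrite mulr_gt0 // oppr_gt0.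
  have -> : - a * p 0 0 ^+ 2 * (a^-1 * V 0 0 ^+ 2 + sdot V V) =
     - (p 0 0 ^+ 2 * V 0 0 ^+ 2) - a * p 0 0 ^+ 2 * sdot V V.
    by field; rewrite lt_eqF.
  have aS : 0 < - a * sdot V V by rewrite mulr_gt0 // oppr_gt0.
  have -> : - (p 0 0 ^+ 2 * V 0 0 ^+ 2) - a * p 0 0 ^+ 2 * sdot V V =
     (a ^+ 2 * (sdot p p * sdot V V) - p 0 0 ^+ 2 * V 0 0 ^+ 2) + - a * sdot V V.
    have -> : a * p 0 0 ^+ 2 = a * (1 - a * sdot p p) by rewrite pp1.
    by ring.
  lra.
- have ai : 0 < a^-1 by rewrite invr_gt0.
  case: V4 => [V00|sV0].
    by rewrite ltr_pwDl // mulr_gt0 // exprn_even_gt0.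
  by rewrite ltr_wpDl // mulr_ge0 // ltW.
- rewrite a0 invr0 mul0r add0r; case: V4 => //.
  by rewrite (tangent0_time a0 Mp pV) eqxx.
Qed.

End Quadric.

(** * Covariant differentiation in the quadric model *)

Section Covariant.
Context {R : realType}.
Variable a : R.
Implicit Types V : normedModType R.

Lemma smooth_sdot V (f g : V -> 'rV[R]_4) p : smooth_at p f -> smooth_at p g ->
  smooth_at p (fun x => sdot (f x) (g x)).
Proof.
by move=> sf sg; apply: smooth_sum => i; apply: smooth_mul; exact: smooth_coord.
Qed.

Lemma smooth_aform V (f g : V -> 'rV[R]_4) p : smooth_at p f -> smooth_at p g ->
  smooth_at p (fun x => aform a (f x) (g x)).
Proof.
move=> sf sg; apply: smooth_add; first by apply: smooth_mul; exact: smooth_coord.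
by apply: smooth_mul; [exact: smooth_cst|exact: smooth_sdot].
Qed.

Lemma smooth_metric V (f g : V -> 'rV[R]_4) p : smooth_at p f -> smooth_at p g ->
  smooth_at p (fun x => metric a (f x) (g x)).
Proof.
move=> sf sg; apply: smooth_add; last exact: smooth_sdot.
by apply: smooth_mul; [exact: smooth_cst|apply: smooth_mul; exact: smooth_coord].
Qed.

Lemma isD_aform V (f g : V -> 'rV[R]_4) (x v : V) (df dg : 'rV[R]_4) :
  is_derive x v f df -> is_derive x v g dg ->
  is_derive x v (fun y => aform a (f y) (g y)) (aform a df (g x) + aform a (f x) dg).
Proof.
move=> Df Dg; have Dfi i := isD_coord 0 i Df; have Dgi i := isD_coord 0 i Dg.
have -> : (fun y => aform a (f y) (g y)) = (fun y => f y 0 0 * g y 0 0 + a * (f y 0 1 * g y 0 1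
   + f y 0 2%:R * g y 0 2%:R + f y 0 3%:R * g y 0 3%:R)).
  by apply/funext => y; rewrite /aform sdotE.
have f0 := Dfi 0; have f1 := Dfi 1; have f2 := Dfi 2%:R; have f3 := Dfi 3%:R.
have g0 := Dgi 0; have g1 := Dgi 1; have g2 := Dgi 2%:R; have g3 := Dgi 3%:R.
by isde; rewrite /aform !sdotE; ring.
Qed.

Lemma isD_metric V (f g : V -> 'rV[R]_4) (x v : V) (df dg : 'rV[R]_4) :
  is_derive x v f df -> is_derive x v g dg ->
  is_derive x v (fun y => metric a (f y) (g y)) (metric a df (g x) + metric a (f x) dg).
Proof.
move=> Df Dg; have Dfi i := isD_coord 0 i Df; have Dgi i := isD_coord 0 i Dg.
have -> : (fun y => metric a (f y) (g y)) = (fun y => a^-1 * (f y 0 0 * g y 0 0) + (f y 0 1 * g y 0 1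
   + f y 0 2%:R * g y 0 2%:R + f y 0 3%:R * g y 0 3%:R)).
  by apply/funext => y; rewrite /metric sdotE.
have f0 := Dfi 0; have f1 := Dfi 1; have f2 := Dfi 2%:R; have f3 := Dfi 3%:R.
have g0 := Dgi 0; have g1 := Dgi 1; have g2 := Dgi 2%:R; have g3 := Dgi 3%:R.
by isde; rewrite /metric !sdotE; ring.
Qed.

Lemma derive_near_cst V (f : V -> R) (c : R) (x v : V) : (\forall y \near x, f y = c) ->
  forall df, is_derive x v f df -> df = 0.
Proof.
move=> fc df [_ <-]; have -> : 'D_v f x = 'D_v (fun=> c) x by exact: near_eq_derive.
exact: derive_cst.
Qed.

Lemma M3_derive_tangent V (f : V -> 'rV[R]_4) (x v : V) : differentiable f x ->
  (\forall y \near x, M3 a (f y)) -> aform a (f x) ('D_v f x) = 0.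
Proof.
move=> df Mf; have Df : is_derive x v f ('D_v f x) by apply: derivableP; exact: diff_derivable.
have ff1 : \forall y \near x, aform a (f y) (f y) = 1 by apply: filterS Mf => y; exact: M3_aform.
have := derive_near_cst ff1 (isD_aform Df Df).
by rewrite aformC; lra.
Qed.

(* The correction term in cov is the one making the derivative tangent. *)
Lemma cov_tangent V (f X : V -> 'rV[R]_4) (x v : V) : differentiable f x -> differentiable X x ->
  (\forall y \near x, M3 a (f y)) -> (\forall y \near x, aform a (f y) (X y) = 0) ->
  aform a (f x) (cov a f v X x) = 0.
Proof.
move=> df dX Mf fX; have Mx := nbhs_singleton Mf.
have Df : is_derive x v f ('D_v f x) by apply: derivableP; exact: diff_derivable.
have DX : is_derive x v X ('D_v X x) by apply: derivableP; exact: diff_derivable.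
have := derive_near_cst fX (isD_aform Df DX).
rewrite /cov aformDr aformZr (M3_aform Mx) mulr1 -(aform_metric _ Mx) 1?addrC //.
exact: M3_derive_tangent.
Qed.

End Covariant.

Section CuspJets.
Context {R : realType}.
Variable a : R.
Variable c : R -> 'rV[R]_4.
Hypothesis sc : smooth_at (0 : R) c.
Let D (f : R -> 'rV[R]_4) : R -> 'rV[R]_4 := 'D_(1 : R) f.

Lemma smooth_covc (X : R -> 'rV[R]_4) : smooth_at (0 : R) X -> smooth_at (0 : R) (covc a c X).
Proof.
move=> sX; apply: smooth_add; first exact: smooth_derive.
apply: smooth_scale => //; apply: smooth_mul; first exact: smooth_cst.
by apply: smooth_metric => //; exact: smooth_derive.
Qed.

Lemma smooth_velocity : smooth_at (0 : R) (velocity c).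
Proof. exact: smooth_derive. Qed.

Lemma derive_scale_near (k : R -> R) (X : R -> 'rV[R]_4) : smooth_at (0 : R) k -> smooth_at (0 : R) X ->
  \forall u \near (0 : R), D (fun u => k u *: X u) u = 'D_1 k u *: X u + k u *: D X u.
Proof.
move=> /smooth_near sk /smooth_near sX; near=> u.
have ku : smooth_at u k by near: u. have Xu : smooth_at u X by near: u.
by rewrite /D; have [_ ->] := isD_scale (smooth_isD1 ku) (smooth_isD1 Xu).
Unshelve. all: by end_near. Qed.

Lemma derive_add_near (X Y : R -> 'rV[R]_4) : smooth_at (0 : R) X -> smooth_at (0 : R) Y ->
  \forall u \near (0 : R), D (fun u => X u + Y u) u = D X u + D Y u.
Proof.
move=> /smooth_near sX /smooth_near sY; near=> u.
have Xu : smooth_at u X by near: u. have Yu : smooth_at u Y by near: u.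
by rewrite /D; have [_ ->] := isD_add (smooth_isD1 Xu) (smooth_isD1 Yu).
Unshelve. all: by end_near. Qed.

Hypothesis c0 : velocity c 0 = 0.

Lemma cusp_covariant_jets : exists a1 a2 a3 b3 : R,
  [/\ covc a c (velocity c) 0 = D (D c) 0 + a1 *: c 0,
      covc a c (covc a c (velocity c)) 0 = D (D (D c)) 0 + a2 *: c 0 &
      covc a c (covc a c (covc a c (velocity c))) 0 =
        D (D (D (D c))) 0 + a3 *: c 0 + b3 *: D (D c) 0].
Proof.
have aux (x y z : 'rV[R]_4) (k k' k'' l l' m : R) :
    x + ((k'' *: z + k' *: 0) + (k' *: 0 + k *: y)) + (l' *: z + l *: 0) + m *: z =
    x + (k'' + l' + m) *: z + k *: y.
  by apply/rowP => i; rewrite !mxE; ring.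
have s1 : smooth_at (0 : R) (D c) by exact: smooth_derive.
have s2 : smooth_at (0 : R) (D (D c)) by exact: smooth_derive.
have s3 : smooth_at (0 : R) (D (D (D c))) by exact: smooth_derive.
pose k1 u := a * metric a (D c u) (D c u).
have sk1 : smooth_at (0 : R) k1 by apply: smooth_mul; [exact: smooth_cst|exact: smooth_metric].
have sdk1 : smooth_at (0 : R) ('D_1 k1) by exact: smooth_derive.
have E1 : covc a c (velocity c) = fun u => D (D c) u + k1 u *: c u by [].
pose W1 u := D (D c) u + k1 u *: c u.
have sW1 : smooth_at (0 : R) W1 by apply: smooth_add => //; exact: smooth_scale.
pose k2 u := a * metric a (D c u) (W1 u).
have sk2 : smooth_at (0 : R) k2 by apply: smooth_mul; [exact: smooth_cst|exact: smooth_metric].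
have E2 : covc a c (covc a c (velocity c)) = fun u => D W1 u + k2 u *: c u by [].
pose W2 u := D (D (D c)) u + ('D_1 k1 u *: c u + k1 u *: D c u) + k2 u *: c u.
have sW2 : smooth_at (0 : R) W2.
  by apply: smooth_add; [apply: smooth_add => //; apply: smooth_add|]; exact: smooth_scale.
have W2E : \forall u \near (0 : R), covc a c (covc a c (velocity c)) u = W2 u.
  have n1 := derive_scale_near sk1 sc.
  have n2 := derive_add_near s2 (smooth_scale sk1 sc).
  by near=> u; rewrite E2 /W2 /W1 (near n2 u) // (near n1 u).
pose k3 u := a * metric a (D c u) (W2 u).
have Dc0 : D c 0 = 0 by exact: c0.
have D0 := smooth_isD1 sc; have D1 := smooth_isD1 s1; have D3 := smooth_isD1 s3.
have Dk1 := smooth_isD1 sk1; have Ddk1 := smooth_isD1 sdk1; have Dk2 := smooth_isD1 sk2.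
have W2D : D W2 0 = D (D (D (D c))) 0 + (('D_1 ('D_1 k1) 0 *: c 0 + 'D_1 k1 0 *: D c 0) +
    ('D_1 k1 0 *: D c 0 + k1 0 *: D (D c) 0)) + ('D_1 k2 0 *: c 0 + k2 0 *: D c 0).
  by rewrite [LHS]/D; have [_ ->] := isD_add (isD_add D3 (isD_add (isD_scale Ddk1 D0) (isD_scale Dk1 D1)))
    (isD_scale Dk2 D0).
exists (k1 0), ('D_1 k1 0 + k2 0), ('D_1 ('D_1 k1) 0 + 'D_1 k2 0 + k3 0), (k1 0); split.
- by rewrite E1.
- rewrite (nbhs_singleton W2E) /W2 Dc0 scaler0 addr0 -addrA -scalerDl //.
- move: (covc a c (covc a c (velocity c))) W2E => Y YE.
  have -> : covc a c Y 0 = D Y 0 + (a * metric a (D c 0) (Y 0)) *: c 0 by [].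
  have -> : D Y 0 = D W2 0 by exact: near_eq_derive.
  rewrite (nbhs_singleton YE) -/(k3 0).
  rewrite W2D Dc0; exact: aux.
Unshelve. all: by end_near. Qed.

End CuspJets.

Local Opaque derive smooth_at Ck.

(** * The singular curve of a swallowtail *)

Section CuspPullback.
Context {R : realType}.
Local Notation D := der.

Lemma product_jet0 (k k1 e e1 : R) : k = 0 -> k1 != 0 -> k1 * e + k * e1 = 0 -> e = 0.
Proof. by move=> -> k10; rewrite mul0r addr0 => /eqP; rewrite mulf_eq0 (negbTE k10) => /eqP. Qed.

Lemma product_jet1 (k k1 k2 e e1 e2 : R) : k = 0 -> e = 0 -> k1 != 0 ->
  k2 * e + k1 * e1 + (k1 * e1 + k * e2) = 0 -> e1 = 0.
Proof.
move=> -> -> k10 E; have /eqP : k1 * e1 = 0 by lra.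
by rewrite mulf_eq0 (negbTE k10) => /eqP.
Qed.

Lemma product_jet2 (k k1 k2 k3 e e1 e2 e3 : R) : k = 0 -> e = 0 -> e1 = 0 -> k1 != 0 ->
  k3 * e + k2 * e1 + (k2 * e1 + k1 * e2) + (k2 * e1 + k1 * e2 + (k1 * e2 + k * e3)) = 0 ->
  e2 = 0.
Proof.
move=> -> -> -> k10 E; have /eqP : k1 * e2 = 0 by lra.
by rewrite mulf_eq0 (negbTE k10) => /eqP.
Qed.

(** Division by a function with a simple zero lowers the order of vanishing by one: in the j-th
    derivative of k e at 0, once the lower jets of e are known to vanish, only j k'(0) e^(j-1)(0) is
    left. *)
Lemma product_jets (k e H : R -> R) : smooth_at (0 : R) k -> smooth_at (0 : R) e ->
  k 0 = 0 -> D k 0 != 0 -> (\forall u \near (0 : R), H u = k u * e u) ->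
  D H 0 = 0 -> D (D H) 0 = 0 -> D (D (D H)) 0 = 0 ->
  [/\ e 0 = 0, D e 0 = 0 & D (D e) 0 = 0].
Proof.
move=> sk se k0 k1 HE H1 H2 H3.
have sk1 := smooth_der sk; have sk2 := smooth_der sk1.
have se1 := smooth_der se; have se2 := smooth_der se1.
pose P1 u := D k u * e u + k u * D e u.
have E1 : \forall u \near (0 : R), D H u = P1 u.
  have := near_der HE; have := smooth_near sk; have := smooth_near se.
  move=> nse nsk nH; near=> u; apply: etrans (near nH u _) _ => //.
  have ku : smooth_at u k by near: u; exact: nsk. have eu : smooth_at u e by near: u; exact: nse.
  exact: (der_val (isD_mul (isD_der ku) (isD_der eu))).
pose P2 u := D (D k) u * e u + D k u * D e u + (D k u * D e u + k u * D (D e) u).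
have E2 : \forall u \near (0 : R), D (D H) u = P2 u.
  have := near_der E1; have := smooth_near sk; have := smooth_near se.
  have := smooth_near sk1; have := smooth_near se1.
  move=> nse1 nsk1 nse nsk nH; near=> u; apply: etrans (near nH u _) _ => //.
  have ku : smooth_at u k by near: u; exact: nsk. have eu : smooth_at u e by near: u; exact: nse.
  have ku1 : smooth_at u (D k) by near: u; exact: nsk1. have eu1 : smooth_at u (D e) by near: u; exact: nse1.
  exact: (der_val (isD_add (isD_mul (isD_der ku1) (isD_der eu))
     (isD_mul (isD_der ku) (isD_der eu1)))).
have E3 : D (D (D H)) 0 = (D (D (D k)) 0 * e 0 + D (D k) 0 * D e 0 +
    (D (D k) 0 * D e 0 + D k 0 * D (D e) 0)) + ((D (D k) 0 * D e 0 + D k 0 * D (D e) 0) +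
    (D k 0 * D (D e) 0 + k 0 * D (D (D e)) 0)).
  have Dk := isD_der sk; have Dk1 := isD_der sk1; have Dk2 := isD_der sk2.
  have De := isD_der se; have De1 := isD_der se1; have De2 := isD_der se2.
  apply: etrans (der_near E2) _.
  exact: (der_val (isD_add (isD_add (isD_mul Dk2 De) (isD_mul Dk1 De1))
    (isD_add (isD_mul Dk1 De1) (isD_mul Dk De2)))).
have e0 : e 0 = 0.
  exact: (product_jet0 k0 k1 (etrans (esym (nbhs_singleton E1)) H1)).
have e1 : D e 0 = 0.
  exact: (product_jet1 k0 e0 k1 (etrans (esym (nbhs_singleton E2)) H2)).
by split; [exact: e0|exact: e1|exact: (product_jet2 k0 e0 e1 k1 (etrans (esym E3) H3))].
Unshelve. all: by end_near. Qed.

(* With L_x, L_y, L_z the partial derivatives of L along the cusp, the derivative of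
   the pullback of L is -12 s s' (L_x + s L_y + s^2 L_z); f, g, h are L_x, L_y, L_z. *)
Lemma pulled_jets (s f g h tf tg th : R -> R) :
  smooth_at (0 : R) s -> s 0 = 0 -> D s 0 != 0 ->
  smooth_at (0 : R) f -> smooth_at (0 : R) g -> smooth_at (0 : R) h ->
  smooth_at (0 : R) tf -> smooth_at (0 : R) tg -> smooth_at (0 : R) th ->
  (\forall u \near (0 : R), D f u = -12 * s u * D s u * tf u) ->
  (\forall u \near (0 : R), D g u = -12 * s u * D s u * tg u) ->
  (\forall u \near (0 : R), D h u = -12 * s u * D s u * th u) ->
  let T u := f u + s u * g u + s u ^+ 2 * h u in
  T 0 = 0 -> D T 0 = 0 -> D (D T) 0 = 0 ->
  [/\ f 0 = 0, g 0 = 0 & h 0 = 6 * tf 0].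
Proof.
move=> ss s0 s1 sf sg sh stf stg sth fE gE hE T T0 T1 T2.
have f0 : f 0 = 0 by move: T0; rewrite /T s0 expr0n /= !mul0r !addr0.
(* [rho] is (T' - s' g) / s after insertion of the formulas for f', g', h'. Its value at 0 is s' (2
   h - 12 tf), which is where the factor 6 comes from. *)
pose rho u := -12 * D s u * tf u + 2 * D s u * h u - 12 * D s u * (s u * tg u)
   - 12 * D s u * (s u ^+ 2 * th u).
have TE : \forall u \near (0 : R), D T u = D s u * g u + s u * rho u.
  have ns := smooth_near ss; have nf := smooth_near sf; have ng := smooth_near sg; have nh := smooth_near sh.
  near=> u.
  have su : smooth_at u s by near: u; exact: ns.
  have fu : smooth_at u f by near: u; exact: nf.
  have gu : smooth_at u g by near: u; exact: ng.
  have hu : smooth_at u h by near: u; exact: nh.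
  have Nf : D f u = -12 * s u * D s u * tf u by near: u; exact: fE.
  have Ng : D g u = -12 * s u * D s u * tg u by near: u; exact: gE.
  have Nh : D h u = -12 * s u * D s u * th u by near: u; exact: hE.
  have Ds := isD_der su; have Df := isD_der fu; have Dg := isD_der gu; have Dh := isD_der hu.
  apply: etrans (der_val (isD_add (isD_add Df (isD_mul Ds Dg)) (isD_mul (isD_exp 2 Ds) Dh))) _.
  rewrite /rho /= expr1 Nf Ng Nh; ring.
have srho : smooth_at (0 : R) rho.
  have sds := smooth_der ss; have ss2 := smooth_exp 2 ss.
  have c12 : smooth_at (0 : R) (fun _ : R => -12 : R) by exact: smooth_cst.
  have c12' : smooth_at (0 : R) (fun _ : R => 12 : R) by exact: smooth_cst.
  have c2 : smooth_at (0 : R) (fun _ : R => 2 : R) by exact: smooth_cst.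
  exact: (smooth_add (smooth_add (smooth_add (smooth_mul (smooth_mul c12 sds) stf)
    (smooth_mul (smooth_mul c2 sds) sh)) (smooth_opp (smooth_mul (smooth_mul c12' sds) (smooth_mul ss stg))))
    (smooth_opp (smooth_mul (smooth_mul c12' sds) (smooth_mul ss2 sth)))).
have g0 : g 0 = 0.
  have E := etrans (esym (nbhs_singleton TE)) T1.
  by apply: (product_jet0 (k := s 0) (k1 := D s 0) (e1 := rho 0)).
split => //.
have E2 : D (D T) 0 = D (D s) 0 * g 0 + D s 0 * D g 0 + (D s 0 * rho 0 + s 0 * D rho 0).
  apply: etrans (der_near TE) _.
  have Ds := isD_der ss; have Dds := isD_der (smooth_der ss); have Dg := isD_der sg.
  exact: (der_val (isD_add (isD_mul Dds Dg) (isD_mul Ds (isD_der srho)))).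
have g1 : D g 0 = 0 by apply: etrans (nbhs_singleton gE) _; rewrite s0 mulr0 !mul0r.
have : D s 0 * rho 0 = 0.
  by have := etrans (esym E2) T2; rewrite g0 g1 s0 !(mulr0, mul0r) !(addr0, add0r).
move/eqP; rewrite mulf_eq0 (negbTE s1) /= /rho s0 expr0n /= !mul0r !mulr0 !subr0 => /eqP E.
have {}E : D s 0 * (2 * h 0 - 12 * tf 0) = 0 by rewrite -[RHS]E; ring.
move/eqP: E; rewrite mulf_eq0 (negbTE s1) /= => /eqP.
by move: (h 0) (tf 0); clear => x y; lra.
Unshelve. all: by end_near. Qed.

Definition row3 (x y z : R) : 'rV[R]_3 := \row_(i < 3) [:: x; y; z]`_i.

Lemma isD_row3 (V : normedModType R) (x v : V) (f g h : V -> R) (df dg dh : R) :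
  is_derive x v f df -> is_derive x v g dg -> is_derive x v h dh ->
  is_derive x v (fun y => row3 (f y) (g y) (h y)) (row3 df dg dh).
Proof.
move=> Df Dg Dh; apply: isD_mx => i j; rewrite mxE; under eq_fun do rewrite mxE.
by case: j => [[|[|[|//]]] lj].
Qed.

Lemma smooth_row3 (V : normedModType R) (x : V) (f g h : V -> R) :
  smooth_at x f -> smooth_at x g -> smooth_at x h ->
  smooth_at x (fun y => row3 (f y) (g y) (h y)).
Proof.
move=> Df Dg Dh; apply: smooth_rV => j; under eq_fun do rewrite mxE.
by case: j => [[|[|[|//]]] lj].
Qed.

Let e3 i : 'rV[R]_3 := delta_mx 0 i.

Lemma isD_comp3 (V : normedModType R) (K : 'rV[R]_3 -> R) (C : V -> 'rV[R]_3) (x v : V) (dC : 'rV[R]_3) :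
  smooth_at (C x) K -> differentiable C x -> is_derive x v C dC ->
  is_derive x v (fun y => K (C y)) (dC 0 0 * 'D_(e3 0) K (C x) + dC 0 1 * 'D_(e3 1) K (C x)
    + dC 0 2%:R * 'D_(e3 2%:R) K (C x)).
Proof.
move=> /smooth_diff dK dC' [_ <-]; split.
  have dKC : differentiable (K \o C) x by exact: differentiable_comp.
  exact: diff_derivable dKC.
apply: etrans (@derive_comp_rV R V R 3 C K v x dC' dK) _; rewrite !big_ord_recl big_ord0 addr0 addrA.
have -> : lift ord0 ord0 = 1 :> 'I_3 by apply: val_inj.
by have -> : lift ord0 (lift ord0 ord0) = 2%:R :> 'I_3 by apply: val_inj.
Qed.

Variable s : R -> R.
Hypotheses (ss : smooth_at (0 : R) s) (s0 : s 0 = 0) (s1 : D s 0 != 0).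
Let C u := row3 (-6 * s u ^+ 2) (-4 * s u ^+ 3) (-3 * s u ^+ 4).
Let T (K : 'rV[R]_3 -> R) u := 'D_(e3 0) K (C u) + s u * 'D_(e3 1) K (C u)
  + s u ^+ 2 * 'D_(e3 2%:R) K (C u).

Lemma C0 : C 0 = 0.
Proof.
rewrite /C s0 !expr0n /= !mulr0; apply/rowP => i; rewrite !mxE.
by case: i => [[|[|[|//]]] lj].
Qed.

Lemma T0 (K : 'rV[R]_3 -> R) : T K 0 = 'D_(e3 0) K 0.
Proof. by rewrite /T C0 s0 expr0n /= !mul0r !addr0. Qed.

Lemma smooth_C : smooth_at (0 : R) C.
Proof. by apply: smooth_row3; apply: smooth_mul; try exact: smooth_cst; exact: smooth_exp. Qed.

Lemma smooth_pullback (K : 'rV[R]_3 -> R) : smooth_at 0 K -> smooth_at (0 : R) (fun u => K (C u)).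
Proof.
move=> sK; have sK0 : smooth_at (C 0) K by rewrite C0.
exact: smooth_comp_rV_R smooth_C sK0.
Qed.

Lemma smooth_T (K : 'rV[R]_3 -> R) : smooth_at 0 K -> smooth_at (0 : R) (T K).
Proof.
move=> sK; have sKi i : smooth_at (0 : R) (fun u => 'D_(e3 i) K (C u)).
  by apply: (smooth_pullback (K := 'D_(e3 i) K)); exact: smooth_derive.
apply: smooth_add; last by apply: smooth_mul; [exact: smooth_exp|exact: (sKi 2%:R)].
by apply: smooth_add; [exact: (sKi 0)|apply: smooth_mul; [exact: ss|exact: (sKi 1)]].
Qed.

Lemma pullback_derive (K : 'rV[R]_3 -> R) : smooth_at 0 K ->
  \forall u \near (0 : R), D (fun u => K (C u)) u = -12 * s u * D s u * T K u.
Proof.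
move=> sK; have nC := smooth_near smooth_C; have ns := smooth_near ss.
have nK : \forall u \near (0 : R), smooth_at (C u) K.
  by apply: (@near_smooth R R _ C 0 (fun y => smooth_at y K) smooth_C); rewrite C0; exact: smooth_near.
near=> u.
have Cu : smooth_at u C by near: u; exact: nC. have Ku : smooth_at (C u) K by near: u; exact: nK.
have su : smooth_at u s by near: u; exact: ns.
have := isD_der su; move: (D s u) => d Ds.
have D1 : is_derive u 1 (fun u => -6 * s u ^+ 2) (-12 * s u * d) by isde; rewrite /=; ring.
have D2 : is_derive u 1 (fun u => -4 * s u ^+ 3) (-12 * s u ^+ 2 * d) by isde; rewrite /=; ring.
have D3 : is_derive u 1 (fun u => -3 * s u ^+ 4) (-12 * s u ^+ 3 * d) by isde; rewrite /=; ring.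
have DC : is_derive u 1 C (row3 (-12 * s u * d) (-12 * s u ^+ 2 * d) (-12 * s u ^+ 3 * d)).
  exact: isD_row3.
rewrite (der_val (isD_comp3 Ku (smooth_diff Cu) DC)) !mxE /= /T.
move: ('D_(e3 0) K (C u)) ('D_(e3 1) K (C u)) ('D_(e3 2%:R) K (C u)) => x y z; ring.
Unshelve. all: by end_near. Qed.

(* If the pullback of L to the cusp vanishes to order four, then so do the
   coefficients of t^2, t^3, t^4 in L(-6 t^2, -4 t^3, -3 t^4). *)
Lemma pullback_jets (L : 'rV[R]_3 -> R) : smooth_at 0 L ->
  let h u := L (C u) in
  D (D h) 0 = 0 -> D (D (D h)) 0 = 0 -> D (D (D (D h))) 0 = 0 ->
  [/\ 'D_(e3 0) L 0 = 0, 'D_(e3 1) L 0 = 0 &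
      'D_(e3 2%:R) L 0 = 6 * 'D_(e3 0) ('D_(e3 0) L) 0].
Proof.
move=> sL h h2 h3 h4.
pose k u := -12 * s u * D s u.
have sDs := smooth_der ss.
have sk : smooth_at (0 : R) k by do ?apply: smooth_mul => //; exact: smooth_cst.
have k0 : k 0 = 0 by rewrite /k s0 mulr0 mul0r.
have k1 : D k 0 != 0.
  have Ds := isD_der ss; have DDs := isD_der sDs.
  have -> : D k 0 = -12 * (D s 0 * D s 0).
    apply: etrans (der_val (isD_mul (isD_mul (isD_cstR (0 : R) (1 : R) (-12)) Ds) DDs)) _.
    rewrite s0; ring.
  by rewrite !mulf_neq0 // oppr_eq0 pnatr_eq0.
have [e0 e1 e2] := product_jets sk (smooth_T sL) k0 k1 (pullback_derive sL) h2 h3 h4.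
have sLi i : smooth_at 0 ('D_(e3 i) L) by exact: smooth_derive.
have sp i := smooth_pullback (sLi i).
have [a0 b0 c0] := pulled_jets ss s0 s1 (sp 0) (sp 1) (sp 2%:R) (smooth_T (sLi 0))
  (smooth_T (sLi 1)) (smooth_T (sLi 2%:R)) (pullback_derive (sLi 0)) (pullback_derive (sLi 1))
  (pullback_derive (sLi 2%:R)) e0 e1 e2.
have EC (K : 'rV[R]_3 -> R) : K (C 0) = K 0 by rewrite C0.
split; [exact: etrans (esym (EC ('D_(e3 0) L))) a0|exact: etrans (esym (EC ('D_(e3 1) L))) b0|].
by apply: etrans (esym (EC ('D_(e3 2%:R) L))) (etrans c0 _); rewrite T0.
Qed.

End CuspPullback.

Section Plane.
Context {R : realType}.
Notation plane := ('rV[R]_2).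

Lemma pt00 : pt 0 0 = 0 :> plane.
Proof. by apply/rowP => i; rewrite !mxE; case: i => [[|[|//]] li]. Qed.

Lemma pt_x (u v : R) : pt u v 0 0 = u. Proof. by rewrite mxE. Qed.
Lemma pt_y (u v : R) : pt u v 0 1 = v. Proof. by rewrite mxE. Qed.

Lemma plane_ext (p q : plane) : p 0 0 = q 0 0 -> p 0 1 = q 0 1 -> p = q.
Proof.
move=> e0 e1; apply/rowP => -[[|[|//]] li].
  by have -> : Ordinal li = 0 by apply: val_inj.
by have -> : Ordinal li = 1 by apply: val_inj.
Qed.

Lemma pt_lin (u v : R) : pt u v = u *: eu + v *: ev.
Proof. by apply: plane_ext; rewrite !mxE /= !(mulr0, mulr1, addr0, add0r). Qed.

Lemma isD_pt0 (u : R) : is_derive u 1 (fun u => pt u 0) eu.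
Proof.
have -> : (fun u : R => pt u 0) = (fun u => u *: eu + 0).
  by apply/funext => w; rewrite pt_lin scale0r.
have D1 := isD_scale (isD_idR u 1) (isD_cst u (1 : R) (@eu R)).
by apply: is_derive_eq (isD_add D1 (isD_cst u 1 0)) _; rewrite scale1r scaler0 !addr0.
Qed.

Lemma smooth_pt0 (u : R) : smooth_at u (fun u => pt u 0).
Proof.
apply: smooth_rV => -[[|[|//]] li]; under eq_fun do rewrite mxE /=.
  exact: smooth_id.
exact: smooth_cst.
Qed.

Lemma near_axis (P : set plane) : (\forall p \near (0 : plane), P p) ->
  \forall u \near (0 : R), P (pt u 0).
Proof. by rewrite -pt00 => nP; exact: (near_smooth (smooth_pt0 0) nP). Qed.

Lemma derive_pt (W : normedModType R) (f : plane -> W) p (a b : R) : differentiable f p ->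
  'D_(pt a b) f p = a *: 'D_eu f p + b *: 'D_ev f p.
Proof. by move=> df; rewrite !(deriveE _ df) pt_lin linearD !linearZ. Qed.

Lemma isD_axis (W : normedModType R) (f : plane -> W) (u : R) : differentiable f (pt u 0) ->
  is_derive u 1 (fun u => f (pt u 0)) ('D_eu f (pt u 0)).
Proof.
move=> df; have D := isD_pt0 u.
have Df : is_derive (pt u 0) eu f ('D_eu f (pt u 0)) by apply: derivableP; exact: diff_derivable.
exact: (isD_comp (f := fun u => pt u 0) (g := f) Df (isD_diff1 D) df D).
Qed.

(** The coefficient of C vanishes to second order and that of B to first order while B itself
    vanishes at p, so differentiation leaves only dx A'. *)
Lemma second_jet (V : normedModType R) (p w : V) (x y dx dy A B C : V -> R)
   (x' y' dx' dy' A' B' C' : R) :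
  is_derive p w x x' -> is_derive p w y y' -> is_derive p w dx dx' -> is_derive p w dy dy' ->
  is_derive p w A A' -> is_derive p w B B' -> is_derive p w C C' ->
  x p = 0 -> y p = 0 -> A p = 0 -> B p = 0 ->
  is_derive p w (fun q => dx q * A q + (6 * y q ^+ 2 * dy q + dx q * y q + x q * dy q) * B q
     + (12 * y q ^+ 3 * dy q + dx q * y q ^+ 2 + x q * (2 * y q * dy q)) * C q) (dx p * A').
Proof.
by move=> ? ? ? ? ? ? ? x0 y0 A0 B0; isde; rewrite x0 y0 A0 B0 !expr0n /=; ring.
Qed.

Lemma std_row3 (p : plane) : std_swallowtail p =
  row3 (p 0 0) (2 * p 0 1 ^+ 3 + p 0 0 * p 0 1) (3 * p 0 1 ^+ 4 + p 0 0 * p 0 1 ^+ 2).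
Proof. by []. Qed.

Lemma isD_std (V : normedModType R) (q : V -> plane) (p w : V) (dq : plane) : is_derive p w q dq ->
  is_derive p w (fun z => std_swallowtail (q z))
   (row3 (dq 0 0) (6 * q p 0 1 ^+ 2 * dq 0 1 + dq 0 0 * q p 0 1 + q p 0 0 * dq 0 1)
     (12 * q p 0 1 ^+ 3 * dq 0 1 + dq 0 0 * q p 0 1 ^+ 2 + q p 0 0 * (2 * q p 0 1 * dq 0 1))).
Proof.
move=> Dq; have := isD_coord 0 0 Dq; have := isD_coord 0 1 Dq => D1 D0.
under eq_fun do rewrite std_row3; apply: isD_row3 => //.
  by isde; rewrite /=; ring.
by isde; rewrite /= expr1; ring.
Qed.

Lemma smooth_std (p : plane) : smooth_at p std_swallowtail.
Proof.
have s0 : smooth_at p (fun q : plane => q 0 0 : R) by apply: (smooth_coord (f := fun q => q)); exact: smooth_id.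
have s1 : smooth_at p (fun q : plane => q 0 1 : R) by apply: (smooth_coord (f := fun q => q)); exact: smooth_id.
have c (k : R) : smooth_at p (fun _ : plane => k) by exact: smooth_cst.
apply: (@smooth_row3 R _ p) => //.
  exact: (smooth_add (smooth_mul (c 2) (smooth_exp 3 s1)) (smooth_mul s0 s1)).
exact: (smooth_add (smooth_mul (c 3) (smooth_exp 4 s1)) (smooth_mul s0 (smooth_exp 2 s1))).
Qed.

Lemma std_parabola (y : R) : std_swallowtail (pt (-6 * y ^+ 2) y) = row3 (-6 * y ^+ 2) (-4 * y ^+ 3) (-3 * y ^+ 4).
Proof. by rewrite std_row3 pt_x pt_y; congr row3; ring. Qed.

Lemma row3_inj (a b c a' b' c' : R) : row3 a b c = row3 a' b' c' -> [/\ a = a', b = b' & c = c'].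
Proof.
move=> /rowP E; split; [have := E 0|have := E 1|have := E 2%:R]; by rewrite !mxE.
Qed.

Lemma row3_0 : row3 0 0 0 = 0 :> 'rV[R]_3.
Proof. by apply/rowP => -[[|[|[|//]]] li]; rewrite !mxE. Qed.

End Plane.

Section Functional.
Context {R : realType}.
Variable l : 'cV[R]_4.

Definition functional (X : 'rV[R]_4) : R := (X *m l) 0 0.

Lemma functionalE X : functional X =
  X 0 0 * l 0 0 + X 0 1 * l 1 0 + X 0 2%:R * l 2%:R 0 + X 0 3%:R * l 3%:R 0.
Proof.
rewrite /functional mxE !big_ord_recl big_ord0 addr0 !addrA.
have -> : lift ord0 ord0 = 1 :> 'I_4 by apply: val_inj.
have -> : lift ord0 (lift ord0 ord0) = 2%:R :> 'I_4 by apply: val_inj.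
by have -> : lift ord0 (lift ord0 (lift ord0 ord0)) = 3%:R :> 'I_4 by apply: val_inj.
Qed.

Lemma functional0P X : functional X = 0 -> X *m l = 0.
Proof. by move=> E; apply/matrixP => i j; rewrite !ord1 [RHS]mxE; exact: E. Qed.

Lemma functionalD X Y : functional (X + Y) = functional X + functional Y.
Proof. by rewrite /functional mulmxDl mxE. Qed.

Lemma functionalZ (k : R) X : functional (k *: X) = k * functional X.
Proof. by rewrite /functional -scalemxAl mxE. Qed.

Lemma isD_functional (V : normedModType R) (x v : V) (f : V -> 'rV[R]_4) (df : 'rV[R]_4) :
  is_derive x v f df -> is_derive x v (fun y => functional (f y)) (functional df).
Proof.
move=> Df; under eq_fun do rewrite functionalE; rewrite functionalE.
have f0 := isD_coord 0 0 Df; have f1 := isD_coord 0 1 Df.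
have f2 := isD_coord 0 2%:R Df; have f3 := isD_coord 0 3%:R Df.
by isde; ring.
Qed.

Lemma smooth_functional (V : normedModType R) (x : V) (f : V -> 'rV[R]_4) :
  smooth_at x f -> smooth_at x (fun y => functional (f y)).
Proof.
move=> sf; under eq_fun do rewrite functionalE.
have c (k : R) : smooth_at x (fun _ : V => k) by exact: smooth_cst.
have fi i := smooth_mul (smooth_coord 0 i sf) (c (l i 0)).
exact: (smooth_add (smooth_add (smooth_add (fi 0) (fi 1)) (fi 2%:R)) (fi 3%:R)).
Qed.

Lemma functional_der (f : R -> 'rV[R]_4) : smooth_at (0 : R) f ->
  \forall u \near (0 : R), der (fun u => functional (f u)) u = functional (der f u).
Proof.
move=> /smooth_near sf; near=> u.
have fu : smooth_at u f by near: u; exact: sf.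
exact: (der_val (isD_functional (isD_der fu))).
Unshelve. all: by end_near. Qed.

Lemma functional_jets (f : R -> 'rV[R]_4) (h : R -> R) : smooth_at (0 : R) f ->
  (\forall u \near (0 : R), h u = functional (f u)) ->
  [/\ der (der h) 0 = functional (der (der f) 0),
      der (der (der h)) 0 = functional (der (der (der f)) 0) &
      der (der (der (der h))) 0 = functional (der (der (der (der f))) 0)].
Proof.
move=> sf hf; have s1 := smooth_der sf; have s2 := smooth_der s1; have s3 := smooth_der s2.
have step (k : R -> R) (g : R -> 'rV[R]_4) : smooth_at (0 : R) g ->
    (\forall u \near (0 : R), k u = functional (g u)) ->
    \forall u \near (0 : R), der k u = functional (der g u).
  move=> sg kg; have n1 := near_der kg; have n2 := functional_der sg.
  near=> u; apply: (@etrans _ _ (der (fun u => functional (g u)) u)).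
    by near: u; exact: n1.
  by near: u; exact: n2.
have h1 := step _ _ sf hf; have h2 := step _ _ s1 h1.
have h3 := step _ _ s2 h2; have h4 := step _ _ s3 h3.
split; [exact: (nbhs_singleton h2)|exact: (nbhs_singleton h3)|exact: (nbhs_singleton h4)].
Unshelve. all: by end_near. Qed.

End Functional.

(** * Second-order jets through the standard swallowtail *)

Section ChartJets.
Context {R : realType}.
Notation plane := ('rV[R]_2).
Let e3 i : 'rV[R]_3 := delta_mx 0 i.

(** The standard map has rank one at 0: its second component is quadratic and its third cubic. When
    L_x = L_y = 0, the quadratic part of L composed with it therefore sees only L_xx and the first
    components of the directions. *)
Lemma second_derive_std (chi : plane -> plane) (L : 'rV[R]_3 -> R) (w w' : plane) :
  smooth_at 0 chi -> chi 0 = 0 -> smooth_at 0 L ->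
  let F q := L (std_swallowtail (chi q)) in
  'D_(e3 0) L 0 = 0 -> 'D_(e3 1) L 0 = 0 ->
  'D_w F 0 = 0 /\
  'D_w' ('D_w F) 0 = ('D_w chi 0) 0 0 * (('D_w' chi 0) 0 0 * 'D_(e3 0) ('D_(e3 0) L) 0).
Proof.
move=> schi chi0 sL F L0 L1.
have sLi i : smooth_at 0 ('D_(e3 i) L) by exact: smooth_derive.
pose sc q := std_swallowtail (chi q).
have ssc : smooth_at 0 sc := smooth_comp_rV schi (smooth_std (chi 0)).
have sc0 : sc 0 = 0.
  by rewrite /sc std_row3 chi0 !mxE !expr0n /= !mulr0 !addr0 row3_0.
have sLsc i : smooth_at (sc 0) ('D_(e3 i) L) by rewrite sc0; exact: sLi.
have DLi i v : is_derive 0 v (fun q => 'D_(e3 i) L (sc q)) ('D_v (fun q => 'D_(e3 i) L (sc q)) 0).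
  exact: (smooth_isD v (smooth_comp_rV_R ssc (sLsc i))).
have nL : \forall q \near (0 : plane), smooth_at (sc q) L.
  by apply: (@near_smooth R _ _ sc 0 (fun y => smooth_at y L) ssc); rewrite sc0; exact: smooth_near.
have nsc := smooth_near ssc; have nchi := smooth_near schi.
have D1 : \forall q \near (0 : plane), 'D_w F q =
    ('D_w chi q) 0 0 * 'D_(e3 0) L (sc q) +
    (6 * chi q 0 1 ^+ 2 * ('D_w chi q) 0 1 + ('D_w chi q) 0 0 * chi q 0 1 + chi q 0 0 * ('D_w chi q) 0 1)
      * 'D_(e3 1) L (sc q) +
    (12 * chi q 0 1 ^+ 3 * ('D_w chi q) 0 1 + ('D_w chi q) 0 0 * chi q 0 1 ^+ 2
      + chi q 0 0 * (2 * chi q 0 1 * ('D_w chi q) 0 1)) * 'D_(e3 2%:R) L (sc q).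
  near=> q.
  have scq : smooth_at q chi by near: q; exact: nchi.
  have sscq : smooth_at q sc by near: q; exact: nsc.
  have sLq : smooth_at (sc q) L by near: q; exact: nL.
  have Dsc := isD_std (smooth_isD w scq).
  have [_ E] := isD_comp3 sLq (smooth_diff sscq) Dsc.
  apply: etrans E _.
  by rewrite /row3 !mxE.
split.
  apply: etrans (nbhs_singleton D1) _.
  by rewrite chi0 sc0 !mxE L0 L1 !expr0n /= !(mulr0, mul0r, addr0, add0r).
have sdc : smooth_at 0 ('D_w chi) by exact: smooth_derive.
have Dc := smooth_isD w' schi; have Ddc := smooth_isD w' sdc.
have E0 i : chi 0 0 i = 0 by rewrite chi0 mxE.
have EL i : 'D_(e3 i) L 0 = 0 -> 'D_(e3 i) L (sc 0) = 0 by rewrite sc0.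
have [_ E] := second_jet (isD_coord 0 0 Dc) (isD_coord 0 1 Dc) (isD_coord 0 0 Ddc) (isD_coord 0 1 Ddc)
  (DLi 0 w') (DLi 1 w') (DLi 2%:R w') (E0 0) (E0 1) (EL 0 L0) (EL 1 L1).
apply: etrans (etrans (near_eq_derive _ D1) E) _; congr (_ * _).
have Dsc : is_derive 0 w' sc (row3 (('D_w' chi 0) 0 0) 0 0).
  have := isD_std Dc; rewrite !E0; move: ('D_w' chi 0) => d.
  by rewrite !expr0n /= !(mulr0, mul0r, addr0, add0r).
have [_ E1] := isD_comp3 (sLsc 0) (smooth_diff ssc) Dsc.
apply: etrans E1 _; rewrite sc0.
move: ('D_(delta_mx 0 0) ('D_(delta_mx 0 0) L) 0) (('D_w' chi 0) 0 0) => x d.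
move: ('D_(delta_mx 0 1) ('D_(delta_mx 0 0) L) 0) ('D_(delta_mx 0 2%:R) ('D_(delta_mx 0 0) L) 0) => y z.
by rewrite /row3 !mxE /= !mul0r !addr0.
Unshelve. all: by end_near. Qed.

End ChartJets.

(** * A swallowtail and its singular curve in charts *)

Section SwallowtailChart.
Context {R : realType}.
Notation plane := ('rV[R]_2).
Variables (f : plane -> 'rV[R]_4) (phi chi : plane -> plane).
Variable Phi : 'rV[R]_4 -> 'rV[R]_3.
Hypotheses (sf : smooth_at 0 f) (sphi : smooth_at 0 phi) (schi : smooth_at 0 chi).
Hypothesis sPhi : smooth_at (f 0) Phi.
Hypotheses (phi0 : phi 0 = 0) (chi0 : chi 0 = 0).
Hypothesis phiK : \forall p \near (0 : plane), phi (chi p) = p.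
Hypothesis PhiE : \forall p \near (0 : plane), Phi (f p) = std_swallowtail (chi p).
Hypothesis adm : admissible f.

Let near_schi : \forall p \near (0 : plane), smooth_at p chi := smooth_near schi.
Let near_sf : \forall p \near (0 : plane), smooth_at p f := smooth_near sf.
Let near_sphi : \forall p \near (0 : plane), smooth_at (chi p) phi.
Proof. by apply: (@near_smooth R _ _ chi 0 (fun y => smooth_at y phi) schi); rewrite chi0; exact: smooth_near. Qed.
Let near_sPhi : \forall p \near (0 : plane), smooth_at (f p) Phi.
Proof. by apply: (@near_smooth R _ _ f 0 (fun y => smooth_at y Phi) sf); exact: smooth_near. Qed.

Lemma dchi_inj : \forall p \near (0 : plane), forall w, 'D_w chi p = 0 -> w = 0.
Proof.
have nphiK := near_join phiK.
near=> p => w dw.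
have sp : smooth_at p chi by near: p; exact: near_schi.
have spp : smooth_at (chi p) phi by near: p; exact: near_sphi.
have pK : \forall q \near p, phi (chi q) = q by near: p; exact: nphiK.
have : 'D_w (fun q => phi (chi q)) p = 'D_w (fun q => q) p by exact: near_eq_derive.
rewrite derive_id (derive_comp _ (smooth_diff sp) (smooth_diff spp)) dw linear0.
by move=> <-.
Unshelve. all: by end_near. Qed.

(** Admissibility gives a kernel vector of df at an axis point, and Phi o f = std o chi carries it
    to a nonzero kernel vector (dx, dy) of dstd at (x, y). That means dx = 0 and (6 y^2 + x) dy =
    0. *)
Lemma singular_parabola : \forall u \near (0 : R),
  chi (pt u 0) 0 0 = -6 * chi (pt u 0) 0 1 ^+ 2.
Proof.
have nPhiE := near_join PhiE; have ninj := dchi_inj.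
suff : \forall p \near (0 : plane), (p : plane) 0 1 = 0 -> chi p 0 0 = -6 * chi p 0 1 ^+ 2.
  by move=> /near_axis; apply: filterS => u; apply; rewrite pt_y.
near=> p => p1.
have sp : smooth_at p chi by near: p; exact: near_schi.
have sfp : smooth_at p f by near: p; exact: near_sf.
have sPhip : smooth_at (f p) Phi by near: p; exact: near_sPhi.
have inj : forall w, 'D_w chi p = 0 -> w = 0 by near: p; exact: ninj.
have PE : \forall q \near p, Phi (f q) = std_swallowtail (chi q) by near: p; exact: nPhiE.
have /iffRL/(_ p1)/negP nfree : ~~ free [:: du f p; dv f p] <-> p 0 1 = 0 by near: p; exact: adm.
have [w w0 dfw] : exists2 w, w != 0 & 'D_w f p = 0.
  apply: contrapT => H; apply: nfree; apply/free2P => a b ab.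
  have [w0|w0] := eqVneq (pt a b) 0.
    by split; [rewrite -(pt_x a b) w0 mxE|rewrite -(pt_y a b) w0 mxE].
  case: H; exists (pt a b) => //.
  by rewrite (derive_pt _ _ (smooth_diff sfp)).
have dchi : 'D_w chi p != 0 by apply: contra w0 => /eqP /inj ->.
have Dc := smooth_isD w sp.
have : 'D_w (fun q => Phi (f q)) p = 'D_w (fun q => std_swallowtail (chi q)) p by exact: near_eq_derive.
rewrite (derive_comp _ (smooth_diff sfp) (smooth_diff sPhip)) dfw linear0.
have [_ ->] := isD_std Dc.
rewrite -row3_0 => /row3_inj[dx0 dy0 _].
have dy : 'D_w chi p 0 1 != 0.
  by apply: contra dchi => /eqP dy1; apply/eqP; apply: plane_ext; rewrite ?[RHS]mxE.
move: dx0 dy0 dy; move: ('D_w chi p 0 0) ('D_w chi p 0 1) => dx dy <-.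
move: (chi p 0 0) (chi p 0 1) => x y /esym E dy0.
have /eqP : dy * (6 * y ^+ 2 + x) = 0 by lra.
by rewrite mulf_eq0 (negbTE dy0) /= => /eqP; lra.
Unshelve. all: by end_near. Qed.

Definition cusp_param (u : R) : R := chi (pt u 0) 0 1.
Local Notation s := cusp_param.
Local Notation C := (fun u => row3 (-6 * s u ^+ 2) (-4 * s u ^+ 3) (-3 * s u ^+ 4)).

Lemma smooth_chi_axis : smooth_at (0 : R) (fun u => chi (pt u 0)).
Proof.
have sc : smooth_at (pt 0 0) chi by rewrite pt00.
exact: (smooth_comp_rV (smooth_pt0 0) sc).
Qed.


Lemma cusp_param_smooth : smooth_at (0 : R) s.
Proof. by apply: smooth_coord; exact: smooth_chi_axis. Qed.

Lemma cusp_param0 : s 0 = 0. Proof. by rewrite /cusp_param pt00 chi0 mxE. Qed.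

Lemma chi_axis : \forall u \near (0 : R), chi (pt u 0) = pt (-6 * s u ^+ 2) (s u).
Proof. by apply: filterS singular_parabola => u E; apply: plane_ext; rewrite (pt_x, pt_y). Qed.

Lemma std_axis : \forall u \near (0 : R), std_swallowtail (chi (pt u 0)) = C u.
Proof. by apply: filterS chi_axis => u ->; rewrite std_parabola. Qed.

Lemma dchi_axis : \forall u \near (0 : R), 'D_eu chi (pt u 0) = pt (-12 * s u * der s u) (der s u).
Proof.
have ns := smooth_near cusp_param_smooth; have nc := near_axis near_schi.
have ne := near_join chi_axis.
near=> u.
have su : smooth_at u s by near: u; exact: ns.
have scu : smooth_at (pt u 0) chi by near: u; exact: nc.
have e : \forall v \near u, chi (pt v 0) = pt (-6 * s v ^+ 2) (s v) by near: u; exact: ne.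
have D1 := isD_axis (smooth_diff scu).
have Ds := isD_der su.
have D2 : is_derive u 1 (fun u => pt (-6 * s u ^+ 2) (s u)) (pt (-12 * s u * der s u) (der s u)).
  move: (der s u) Ds => d Ds; apply: isD_mx => i j; rewrite mxE; under eq_fun do rewrite mxE.
  by case: j => [[|[|//]] lj] /=; [isde; rewrite /=; ring|exact: Ds].
apply: etrans (esym (der_val D1)) (etrans (der_near e) (der_val D2)).
Unshelve. all: by end_near. Qed.

Lemma eu_neq0 : eu != 0 :> plane.
Proof. by apply/negP => /eqP /rowP/(_ 0); rewrite !mxE /= => /eqP; rewrite oner_eq0. Qed.

Lemma der_cusp_param_neq0 : \forall u \near (0 : R), der s u != 0.
Proof.
have ninj := near_axis dchi_inj; have nd := dchi_axis.
near=> u.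
have inj : forall w, 'D_w chi (pt u 0) = 0 -> w = 0 by near: u; exact: ninj.
have E : 'D_eu chi (pt u 0) = pt (-12 * s u * der s u) (der s u) by near: u; exact: nd.
apply/negP => /eqP d0; move/eqP: eu_neq0; apply; apply: inj.
by rewrite E d0 mulr0 pt00.
Unshelve. all: by end_near. Qed.

Lemma cusp_param_eq0 : \forall u \near (0 : R), s u = 0 -> u = 0.
Proof.
have nK := near_axis phiK; have nc := chi_axis.
near=> u => su0.
have K : phi (chi (pt u 0)) = pt u 0 by near: u; exact: nK.
have E : chi (pt u 0) = pt (-6 * s u ^+ 2) (s u) by near: u; exact: nc.
move: K; rewrite E su0 expr0n mulr0 pt00 phi0 => /rowP/(_ 0).
by rewrite !mxE.
Unshelve. all: by end_near. Qed.

Lemma C_derive (u d : R) : is_derive u 1 s d ->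
  is_derive u 1 C (row3 (-12 * s u * d) (-12 * s u ^+ 2 * d) (-12 * s u ^+ 3 * d)).
Proof. by move=> Ds; apply: isD_row3; isde; rewrite /=; ring. Qed.

(** dPhi maps the velocity to - 12 s s' (1, s, s^2). Near 0 the factor s' is nonzero and s vanishes
    only at u = 0. *)
Lemma velocity_eq0 : \forall u \near (0 : R), der (fun u => f (pt u 0)) u = 0 -> u = 0.
Proof.
have nP := near_join (near_axis PhiE); have na := near_join std_axis.
have nf := near_axis near_sf; have nPhi := near_axis near_sPhi.
have ns := smooth_near cusp_param_smooth; have nd := der_cusp_param_neq0; have n0 := cusp_param_eq0.
near=> u => g0.
have PE : \forall v \near u, Phi (f (pt v 0)) = std_swallowtail (chi (pt v 0)) by near: u; exact: nP.
have AE : \forall v \near u, std_swallowtail (chi (pt v 0)) = C v by near: u; exact: na.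
have sfu : smooth_at (pt u 0) f by near: u; exact: nf.
have sPu : smooth_at (f (pt u 0)) Phi by near: u; exact: nPhi.
have su : smooth_at u s by near: u; exact: ns.
have d0 : der s u != 0 by near: u; exact: nd.
have s0 : s u = 0 -> u = 0 by near: u; exact: n0.
have sg : smooth_at u (fun u => f (pt u 0)) by exact: smooth_comp_rV (smooth_pt0 u) sfu.
have D2 := C_derive (isD_der su).
have E : 'd Phi (f (pt u 0)) (der (fun u => f (pt u 0)) u) =
   row3 (-12 * s u * der s u) (-12 * s u ^+ 2 * der s u) (-12 * s u ^+ 3 * der s u).
  apply: etrans (etrans (der_near AE) (der_val D2)).
  apply: etrans (der_near PE); rewrite -!derE.
  by apply: esym; apply: (derive_comp (f := fun u => f (pt u 0)) (g := Phi)); exact: smooth_diff.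
apply: s0; move: E; rewrite g0 linear0 -row3_0 => /row3_inj[/esym/eqP E _ _].
by move: E; rewrite mulf_eq0 (negbTE d0) orbF mulf_eq0 oppr_eq0 pnatr_eq0 /= => /eqP.
Unshelve. all: by end_near. Qed.

Variables (a : R) (Psi : 'rV[R]_3 -> 'rV[R]_4).
Hypothesis sPsi : smooth_at 0 Psi.
Hypothesis fE : \forall p \near (0 : plane), f p = Psi (std_swallowtail (chi p)).
Hypothesis PhiK : \forall y \near (0 : 'rV[R]_3), Phi (Psi y) = y.
Hypothesis MPsi : \forall y \near (0 : 'rV[R]_3), M3 a (Psi y).
Local Notation g := (fun u => f (pt u 0)).
Let e3 i : 'rV[R]_3 := delta_mx 0 i.

Lemma cusp_axis0 : C 0 = 0.
Proof. by cbv beta; rewrite cusp_param0 !expr0n /= !mulr0 row3_0. Qed.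

Lemma std0 : std_swallowtail (chi 0) = 0.
Proof. by rewrite -pt00 (nbhs_singleton std_axis) cusp_axis0. Qed.

Lemma Psi0 : Psi 0 = f 0.
Proof. by rewrite (nbhs_singleton fE) std0. Qed.

Lemma axis_chart : \forall u \near (0 : R), g u = Psi (C u).
Proof.
have n1 := near_axis fE; have n2 := std_axis; near=> u.
have <- : std_swallowtail (chi (pt u 0)) = C u by near: u; exact: n2.
by near: u; exact: n1.
Unshelve. all: by end_near. Qed.

Lemma smooth_axis : smooth_at (0 : R) g.
Proof. by apply: smooth_comp_rV (smooth_pt0 0) _; rewrite pt00. Qed.

Lemma velocity_at0 : der g 0 = 0.
Proof.
have D2 := C_derive (isD_der cusp_param_smooth).
have sPsi' : smooth_at (C 0) Psi by rewrite cusp_axis0.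
apply: etrans (der_near axis_chart) _; rewrite -derE.
apply: etrans (derive_comp (f := C) (g := Psi) _ (isD_diff1 D2) (smooth_diff sPsi')) _.
by rewrite derE (der_val D2) cusp_param0 !expr0n /= !(mulr0, mul0r) row3_0 linear0.
Qed.

Lemma dPsi_comb (b c d : R) : 'D_(row3 b c d) Psi 0 =
  b *: 'D_(e3 0) Psi 0 + c *: 'D_(e3 1) Psi 0 + d *: 'D_(e3 2%:R) Psi 0.
Proof.
have dP := smooth_diff sPsi.
rewrite !(deriveE _ dP) -!linearZ -!linearD; congr ('d Psi _ _).
apply/rowP => -[[|[|[|//]]] li]; rewrite !mxE /= !(mulr0, mulr1, addr0, add0r) //.
Qed.

(** The three partial derivatives are independent because Phi o Psi = id, and they lie in the
    tangent space at f(0), which does not contain f(0) itself. *)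
Lemma dPsi_detg : detg (f 0) ('D_(e3 0) Psi 0) ('D_(e3 1) Psi 0) ('D_(e3 2%:R) Psi 0) != 0.
Proof.
apply: free_detg => k b c d; rewrite -!addrA.
rewrite (addrA (b *: _)) -(dPsi_comb b c d) => E.
have dP := smooth_diff sPsi.
have T := M3_derive_tangent (row3 b c d) dP MPsi.
have M0 : M3 a (f 0) by rewrite -Psi0; exact: nbhs_singleton MPsi.
have k0 : k = 0.
  have : aform a (f 0) (k *: f 0 + 'D_(row3 b c d) Psi 0) = 0.
    by rewrite E -(scale0r (f 0)) aformZr mul0r.
  by rewrite aformDr aformZr (M3_aform M0) mulr1 -Psi0 T addr0.
move: E; rewrite k0 scale0r add0r => E.
have sPhi' : smooth_at (Psi 0) Phi by rewrite Psi0.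
have : 'D_(row3 b c d) (fun y => Phi (Psi y)) 0 = 'D_(row3 b c d) (fun y => y) 0.
  exact: near_eq_derive.
rewrite derive_id (derive_comp _ dP (smooth_diff sPhi')) E linear0 -row3_0.
by move=> /row3_inj[<- <- <-].
Qed.


Lemma dchi_inj0 w : 'D_w chi 0 = 0 -> w = 0.
Proof. exact: (nbhs_singleton dchi_inj). Qed.

Lemma dchi_eu : 'D_eu chi 0 = pt 0 (der s 0).
Proof. by have := nbhs_singleton dchi_axis; rewrite pt00 cusp_param0 mulr0 mul0r. Qed.

(** The axis direction is sent to (0, s'(0)), tangent to the parabola at its vertex; an injective
    differential must give the v-direction a first component. *)
Lemma dchi_ev : ('D_ev chi 0) 0 0 != 0.
Proof.
apply/negP => /eqP d0; have s1 := nbhs_singleton der_cusp_param_neq0.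
have : pt (('D_ev chi 0) 0 1) (- der s 0) = 0.
  apply: dchi_inj0; rewrite (derive_pt _ _ (smooth_diff schi)) dchi_eu.
  move: d0; move: ('D_ev chi 0) (der s 0) => q d q0.
  by apply: plane_ext; rewrite !mxE /= ?q0 ?mulr0 ?addr0 //; ring.
move=> /rowP/(_ 1); rewrite !mxE /= => /eqP; rewrite oppr_eq0.
by rewrite (negbTE s1).
Qed.

Lemma cusp_functional_eq0 (l : 'cV[R]_4) (al be ga : R) :
  'D_ev ('D_ev f) 0 = al *: f 0 + be *: 'D_ev ('D_eu f) 0 + ga *: 'D_ev f 0 ->
  functional l (f 0) = 0 -> functional l (der (der g) 0) = 0 ->
  functional l (der (der (der g)) 0) = 0 -> functional l (der (der (der (der g))) 0) = 0 ->
  l = 0.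
Proof.
move=> fvvE l0 l2 l3 l4.
pose L x := functional l (Psi x).
have sL : smooth_at 0 L by exact: smooth_functional.
have hE : \forall u \near (0 : R), L (C u) = functional l (g u).
  by apply: filterS axis_chart => u ->.
have [h2 h3 h4] := functional_jets smooth_axis hE.
have [L0 L1 L2] := pullback_jets cusp_param_smooth cusp_param0 (nbhs_singleton der_cusp_param_neq0) sL
  (etrans h2 l2) (etrans h3 l3) (etrans h4 l4).
have FE : \forall q \near (0 : plane), functional l (f q) = L (std_swallowtail (chi q)).
  by apply: filterS fE => q ->.
have J w w' : functional l ('D_w f 0) = 0 /\ functional l ('D_w' ('D_w f) 0) =
    ('D_w chi 0) 0 0 * (('D_w' chi 0) 0 0 * 'D_(e3 0) ('D_(e3 0) L) 0).
  have [J1 J2] := second_derive_std w w' schi chi0 sL L0 L1.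
  have Fw : \forall q \near (0 : plane), functional l ('D_w f q) = 'D_w (fun q => L (std_swallowtail (chi q))) q.
    have nFE := near_join FE; near=> q.
    have sfq : smooth_at q f by near: q; exact: near_sf.
    have e : \forall p \near q, functional l (f p) = L (std_swallowtail (chi p)) by near: q; exact: nFE.
    have [_ E] := isD_functional l (smooth_isD w sfq).
    apply: etrans (esym E) _; exact: near_eq_derive.
  split; first exact: etrans (nbhs_singleton Fw) J1.
  have sdf : smooth_at 0 ('D_w f) by exact: smooth_derive.
  have [_ E] := isD_functional l (smooth_isD w' sdf).
  apply: etrans (esym E) (etrans _ J2); exact: near_eq_derive.
have [lv _] := J ev ev.
(* The image of the u-direction under dchi has no first component, so the formula [J] kills f_uv
   whatever L_xx is; only f_vv detects L_xx. *)
have luv : functional l ('D_ev ('D_eu f) 0) = 0.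
  by have [_ ->] := J eu ev; rewrite dchi_eu pt_x mul0r.
have lvv : functional l ('D_ev ('D_ev f) 0) = 0.
  by rewrite fvvE !functionalD !functionalZ l0 lv luv !mulr0 !addr0.
have L00 : 'D_(e3 0) ('D_(e3 0) L) 0 = 0.
  have := J ev ev; rewrite lvv => -[_]; have := dchi_ev.
  move: (('D_ev chi 0) 0 0) ('D_(e3 0) ('D_(e3 0) L) 0) => d x d0 /esym/eqP.
  by rewrite !mulf_eq0 (negbTE d0) => /eqP.
have lPsi i : 'D_(e3 i) L 0 = 0 -> 'D_(e3 i) Psi 0 *m l = 0.
  move=> E; apply: functional0P; apply: etrans _ E.
  by have [_ ->] := isD_functional l (smooth_isD (e3 i) sPsi).
apply: (detg_functional0 dPsi_detg (functional0P l0) (lPsi _ L0) (lPsi _ L1)).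
by apply: lPsi; apply: etrans L2 _; rewrite L00 mulr0.
Unshelve. all: by end_near. Qed.

Lemma cusp_detg (al be ga : R) :
  'D_ev ('D_ev f) 0 = al *: f 0 + be *: 'D_ev ('D_eu f) 0 + ga *: 'D_ev f 0 ->
  detg (f 0) (der (der g) 0) (der (der (der g)) 0) (der (der (der (der g))) 0) != 0.
Proof.
move=> fvvE; apply: functional_detg => l l0 l2 l3 l4.
by apply: (cusp_functional_eq0 (l := l) fvvE); rewrite /functional (l0, l2, l3, l4) mxE.
Qed.

End SwallowtailChart.

(** * Genericity of a cusp as a determinant of ordinary derivatives *)

Section GenericCusp.
Context {R : realType}.
Variables (a : R) (c : R -> 'rV[R]_4).
Hypothesis sc : smooth_at (0 : R) c.
Hypothesis Mc : \forall u \near (0 : R), M3 a (c u).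

Lemma der_fun (W : normedModType R) (X : R -> W) : 'D_(1 : R) X = der X.
Proof. by apply/funext => u; exact: derE. Qed.

Lemma cusp_jets : velocity c 0 = 0 -> exists a1 a2 a3 b3 : R,
  [/\ covc a c (velocity c) 0 = der (der c) 0 + a1 *: c 0,
      covc a c (covc a c (velocity c)) 0 = der (der (der c)) 0 + a2 *: c 0 &
      covc a c (covc a c (covc a c (velocity c))) 0 =
        der (der (der (der c))) 0 + a3 *: c 0 + b3 *: der (der c) 0].
Proof.
move=> /(cusp_covariant_jets a sc)[a1 [a2 [a3 [b3 H]]]]; exists a1, a2, a3, b3.
by rewrite -!der_fun; exact: H.
Qed.

Lemma comb_jets (p x y z : 'rV[R]_4) (k1 k2 k3 b3 k l m : R) :
  k *: (x + k1 *: p) + l *: (y + k2 *: p) + m *: (z + k3 *: p + b3 *: x) =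
  (k * k1 + l * k2 + m * k3) *: p + (k + m * b3) *: x + l *: y + m *: z.
Proof. by apply/rowP => i; rewrite !mxE; ring. Qed.

Lemma generic_cusp_of_detg : (\forall u \near (0 : R), velocity c u = 0 <-> u = 0) ->
  detg (c 0) (der (der c) 0) (der (der (der c)) 0) (der (der (der (der c))) 0) != 0 ->
  generic_space_cusp a c.
Proof.
move=> cv d0; have [_ /(_ erefl) c0] := nbhs_singleton cv.
have [a1 [a2 [a3 [b3 [E1 E2 E3]]]]] := cusp_jets c0.
have free3 : free [:: covc a c (velocity c) 0; covc a c (covc a c (velocity c)) 0;
    covc a c (covc a c (covc a c (velocity c))) 0].
  apply/free3P => k l m; rewrite E1 E2 E3 comb_jets => /(detg_free d0)[_ K -> m0].
  by move: K; rewrite m0 mul0r addr0.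
split=> //; split=> //.
apply/free2P => k l kl; have [] := free3P _ _ _ free3 k l 0; last by [].
by rewrite scale0r addr0.
Qed.

Lemma velocity_tangent : \forall u \near (0 : R), aform a (c u) (velocity c u) = 0.
Proof.
have ns := smooth_near sc; have nM := near_join Mc; near=> u.
have cu : smooth_at u c by near: u; exact: ns.
have Mu : \forall v \near u, M3 a (c v) by near: u; exact: nM.
exact: (M3_derive_tangent (1 : R) (smooth_diff cu) Mu).
Unshelve. all: by end_near. Qed.

Lemma covc_tangent (X : R -> 'rV[R]_4) : smooth_at (0 : R) X ->
  (\forall u \near (0 : R), aform a (c u) (X u) = 0) ->
  \forall u \near (0 : R), aform a (c u) (covc a c X u) = 0.
Proof.
move=> sX tX; have ns := smooth_near sc; have nM := near_join Mc.
have nX := smooth_near sX; have nt := near_join tX; near=> u.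
have cu : smooth_at u c by near: u; exact: ns.
have Xu : smooth_at u X by near: u; exact: nX.
have Mu : \forall v \near u, M3 a (c v) by near: u; exact: nM.
have tu : \forall v \near u, aform a (c v) (X v) = 0 by near: u; exact: nt.
exact: (cov_tangent (1 : R) (smooth_diff cu) (smooth_diff Xu) Mu tu).
Unshelve. all: by end_near. Qed.

(** The corrected vectors lie in the tangent space at p, complementary to the line of p, so their
    independence amounts to a basis of R^4 together with p; removing the corrections is a triangular
    change. *)
Lemma detg_jets (p x y z : 'rV[R]_4) (a1 a2 a3 b3 : R) : aform a p p = 1 ->
  aform a p (x + a1 *: p) = 0 -> aform a p (y + a2 *: p) = 0 ->
  aform a p (z + a3 *: p + b3 *: x) = 0 ->
  free [:: x + a1 *: p; y + a2 *: p; z + a3 *: p + b3 *: x] -> detg p x y z != 0.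
Proof.
move=> pp t1 t2 t3 /free3P fr; apply: free_detg => k l m n E.
have E' : (k - (l - n * b3) * a1 - m * a2 - n * a3) *: p + ((l - n * b3) *: (x + a1 *: p) + m *: (y + a2 *: p) +
   n *: (z + a3 *: p + b3 *: x)) = 0.
  by rewrite -E; apply/rowP => i; rewrite !mxE; ring.
have K0 : k - (l - n * b3) * a1 - m * a2 - n * a3 = 0.
  have : aform a p 0 = 0 by rewrite -(scale0r p) aformZr mul0r.
  rewrite -E' aformDr aformZr pp mulr1 aformDr [aform a p (_ *: _ + _)]aformDr.
  by rewrite (aformZr a _ (x + _)) (aformZr a _ (y + _)) (aformZr a _ (z + _ + _)) t1 t2 t3 !mulr0 !addr0.
move: E'; rewrite K0 scale0r add0r => /fr[l0 m0 n0].
have l0' : l = 0 by move: l0; rewrite n0 mul0r subr0.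
by split=> //; move: K0; rewrite l0' m0 n0 !mul0r !subr0 mul0r subr0.
Qed.

Lemma detg_of_generic_cusp : velocity c 0 = 0 ->
  free [:: covc a c (velocity c) 0; covc a c (covc a c (velocity c)) 0;
           covc a c (covc a c (covc a c (velocity c))) 0] ->
  detg (c 0) (der (der c) 0) (der (der (der c)) 0) (der (der (der (der c))) 0) != 0.
Proof.
move=> c0; have [a1 [a2 [a3 [b3 [E1 E2 E3]]]]] := cusp_jets c0.
have sv := smooth_velocity sc; have sv1 := smooth_covc a sc sv; have sv2 := smooth_covc a sc sv1.
have t0 := velocity_tangent; have t1 := covc_tangent sv t0; have t2 := covc_tangent sv1 t1.
have t3 := covc_tangent sv2 t2.
have := nbhs_singleton t3; have := nbhs_singleton t2; have := nbhs_singleton t1.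
rewrite E1 E2 E3; apply: detg_jets.
exact: M3_aform (nbhs_singleton Mc).
Qed.

End GenericCusp.

(** * The unit normal and the second derivatives at the swallowtail point *)

Section Normal.
Context {R : realType}.
Notation plane := ('rV[R]_2).
Variables (a : R) (f nu : plane -> 'rV[R]_4).
Hypothesis sf : smooth_at 0 f.
Hypothesis Mf : \forall p \near (0 : plane), M3 a (f p).
Hypothesis Nnu : unit_normal a f nu.
Hypothesis fu0 : 'D_eu f 0 = 0.

Lemma metric0r (X : 'rV[R]_4) : metric a X 0 = 0.
Proof. by rewrite -(scale0r 0) metricZr mul0r. Qed.

Lemma cov_eu0 : cov a f ev (du f) 0 = 'D_ev ('D_eu f) 0.
Proof. by rewrite /cov /du fu0 metric0r mulr0 scale0r addr0. Qed.

Lemma derive_tangent w : \forall p \near (0 : plane), aform a (f p) ('D_w f p) = 0.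
Proof.
have ns := smooth_near sf; have nM := near_join Mf; near=> p.
have fp : smooth_at p f by near: p; exact: ns.
have Mp : \forall q \near p, M3 a (f q) by near: p; exact: nM.
exact: (M3_derive_tangent w (smooth_diff fp) Mp).
Unshelve. all: by end_near. Qed.

Lemma normal_span (p X Y Z n : 'rV[R]_4) : M3 a p -> detg p Y Z n != 0 ->
  aform a p X = 0 -> aform a p Y = 0 -> aform a p Z = 0 -> aform a p n = 0 ->
  metric a n n = 1 -> metric a X n = 0 -> metric a Y n = 0 -> metric a Z n = 0 ->
  exists be ga, X = be *: Y + ga *: Z.
Proof.
move=> Mp d0 tX tY tZ tn nn nX nY nZ.
have [x [y [z [t E]]]] := detg_span X d0; exists y, z.
have x0 : x = 0.
  by move: tX; rewrite E !aformDr !aformZr tY tZ tn (M3_aform Mp) !mulr0 !addr0 mulr1.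
have t0 : t = 0.
  move: nX; rewrite E x0 scale0r add0r (metricDl a (_ + _)) metricDl !metricZl nY nZ nn.
  by rewrite !mulr0 !add0r mulr1.
by rewrite E x0 t0 !scale0r add0r addr0.
Qed.

Lemma second_derivative_span : metric a (cov a f ev (dv f) 0) (nu 0) = 0 ->
  exists al be ga : R,
    'D_ev ('D_ev f) 0 = al *: f 0 + be *: 'D_ev ('D_eu f) 0 + ga *: 'D_ev f 0.
Proof.
move=> s0; have [snu N d0] := Nnu.
have [t0 n1 _ nv] := nbhs_singleton N.
have M0 := nbhs_singleton Mf.
have sfw w : smooth_at 0 ('D_w f) by exact: smooth_derive.
have Tw w w' : aform a (f 0) (cov a f w' ('D_w f) 0) = 0.
  exact: (cov_tangent w' (smooth_diff sf) (smooth_diff (sfw w)) Mf (derive_tangent w)).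
(* Differentiate <f_u, nu> = 0 in v; the term containing the derivative of nu disappears because
   f_u(0) = 0. *)
have nuv : metric a (cov a f ev (du f) 0) (nu 0) = 0.
  have nu0 : \forall p \near (0 : plane), metric a ('D_eu f p) (nu p) = 0.
    by apply: filterS N => p Np; case: Np => _ _ h _; exact: h.
  have := derive_near_cst nu0 (isD_metric a (smooth_isD ev (sfw eu)) (smooth_isD ev snu)).
  by rewrite fu0 cov_eu0 (metricC a 0) metric0r addr0.
have [be [ga E]] := normal_span M0 (lt0r_neq0 d0) (Tw ev ev) (Tw eu ev)
  (nbhs_singleton (derive_tangent ev)) t0 n1 s0 nuv nv.
exists (- (a * metric a ('D_ev f 0) ('D_ev f 0))), be, ga.
have E' : 'D_ev ('D_ev f) 0 + (a * metric a ('D_ev f 0) ('D_ev f 0)) *: f 0 = be *: 'D_ev ('D_eu f) 0 + ga *: 'D_ev f 0.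
  by apply: etrans E _; rewrite cov_eu0.
rewrite -addrA -E' scaleNr addrCA addNr addr0 //.
Qed.

End Normal.

Section Swallowtail.
Context {R : realType}.
Notation plane := ('rV[R]_2).

Lemma swallowtail_axis (a : R) (f : plane -> 'rV[R]_4) (g := fun u : R => f (pt u 0)) :
  swallowtail a f ->
  [/\ smooth_at (0 : R) g, 'D_eu f 0 = 0, \forall u \near (0 : R), velocity g u = 0 <-> u = 0 &
  forall al be ga : R,
    'D_ev ('D_ev f) 0 = al *: f 0 + be *: 'D_ev ('D_eu f) 0 + ga *: 'D_ev f 0 ->
    detg (g 0) (der (der g) 0) (der (der (der g)) 0) (der (der (der (der g))) 0) != 0].
Proof.
move=> [sf Mf [phi [Phi [[phi0 sphi [chi [chi0 schi _ phiK]]] [Phi0 sPhi [Psi [Psi0 sPsi PsiK MPsi]]] E]]] adm].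
have phiK' : \forall p \near (0 : plane), phi (chi p) = p.
  by apply: filterS phiK => p /(_ I)[].
have PhiK : \forall y \near (0 : 'rV[R]_3), Phi (Psi y) = y by apply: filterS MPsi => y /(_ I)[].
have MPsi' : \forall y \near (0 : 'rV[R]_3), M3 a (Psi y) by apply: filterS MPsi => y /(_ I)[].
have PhiE : \forall p \near (0 : plane), Phi (f p) = std_swallowtail (chi p).
  have nE : \forall p \near (0 : plane), Phi (f (phi (chi p))) = std_swallowtail (chi p).
    apply: (@near_smooth R _ _ chi 0 (fun y => Phi (f (phi y)) = std_swallowtail y) schi).
    by rewrite chi0.
  by apply: filterS2 nE phiK' => p e1 e2; rewrite -{1}e2.
have fE : \forall p \near (0 : plane), f p = Psi (std_swallowtail (chi p)).
  have nK : \forall p \near (0 : plane), M3 a (f p) -> setT (Phi (f p)) /\ Psi (Phi (f p)) = f p.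
    exact: (@near_smooth R _ _ f 0 (fun x => M3 a x -> setT (Phi x) /\ Psi (Phi x) = x) sf PsiK).
  apply: filterS3 nK Mf PhiE => p K Mp <-.
  by have [_ ->] := K Mp.
have g0 : der g 0 = 0 by exact: (velocity_at0 sf sphi schi sPhi chi0 phiK' PhiE adm sPsi fE).
have sf0 : smooth_at (pt 0 0) f by rewrite pt00.
have sg : smooth_at (0 : R) g := smooth_axis sf.
split => //.
- have := isD_axis (smooth_diff sf0); rewrite pt00 => /der_val <-; exact: g0.
- have n0 := velocity_eq0 sf sphi schi sPhi phi0 chi0 phiK' PhiE adm.
  near=> u.
  have n0u : der g u = 0 -> u = 0 by near: u; exact: n0.
  have -> : velocity g u = der g u by rewrite -derE.
  by split=> [//|->].
- move=> al be ga /(cusp_detg sf sphi schi sPhi chi0 phiK' PhiE adm sPsi fE PhiK MPsi').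
  by rewrite /g pt00.
Unshelve. all: by end_near. Qed.

Lemma nongeneric_swallowtail_cusp (a : R) (f : plane -> 'rV[R]_4) :
  nongeneric_swallowtail a f -> generic_space_cusp a (fun u : R^o => f (pt u 0)).
Proof.
move=> [swf [nu Nnu /eqP]]; rewrite /sigmaS sgr_eq0 => /eqP s0.
have [sg fu0 cv dg] := swallowtail_axis swf.
have [sf Mf _ _] := swf.
have [al [be [ga /dg d0]]] := second_derivative_span sf Mf Nnu fu0 s0.
exact: (generic_cusp_of_detg sg (near_axis Mf) cv d0).
Qed.

Lemma detg_neq0_eq (p x y z p' x' y' z' : 'rV[R]_4) : p = p' -> x = x' -> y = y' -> z = z' ->
  detg p x y z != 0 -> detg p' x' y' z' != 0.
Proof. by move=> -> -> -> ->. Qed.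

(** Passing through the determinant of iterated derivatives reduces invariance under change of
    representative to [near_der]. *)
Lemma generic_space_cusp_ext (a : R) (c d : R -> 'rV[R]_4) : (\forall u \near (0 : R), c u = d u) ->
  generic_space_cusp a c -> generic_space_cusp a d.
Proof.
move=> cd [[sc Mc cv _] fr].
have sd : smooth_at (0 : R) d by exact: smooth_ext cd sc.
have vel (e : R -> 'rV[R]_4) u : velocity e u = der e u by rewrite -derE.
apply: (generic_cusp_of_detg sd).
- by apply: filterS2 cd Mc => u <-.
- have n1 := near_der cd; near=> u.
  have E : der c u = der d u by near: u; exact: n1.
  have : velocity c u = 0 <-> u = 0 by near: u; exact: cv.
  by rewrite (vel c u) (vel d u) E.
- have c0 : velocity c 0 = 0 by have [_ ->] := nbhs_singleton cv.
  have n1 := near_der cd; have n2 := near_der n1; have n3 := near_der n2; have n4 := near_der n3.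
  exact: (detg_neq0_eq (nbhs_singleton cd) (nbhs_singleton n2) (nbhs_singleton n3) (nbhs_singleton n4)
    (detg_of_generic_cusp sc Mc c0 fr)).
Unshelve. all: by end_near. Qed.

Lemma asymptotic_nongeneric (a : R) (f : plane -> 'rV[R]_4) :
  asymptotic_swallowtail a f -> nongeneric_swallowtail a f.
Proof.
move=> [swf [nu Nnu k0]]; split=> //; exists nu => //.
have [sf Mf _ _] := swf; have [_ _ d0] := Nnu.
have M0 := nbhs_singleton Mf.
(* The quotient defining the curvature would be 0 by convention if its denominator vanished. The
   orientation condition excludes this by forcing f_v(0) to be nonzero. *)
have fv0 : dv f 0 != 0.
  apply/negP => /eqP fv0; move/lt0r_neq0: d0; rewrite fv0 => d0.
  have [] := detg_free (a := 0) (b := 0) (c := 1) (d := 0) d0; last by move=> _ _ /eqP; rewrite oner_eq0.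
  by rewrite !scale0r scaler0 !addr0.
have := nbhs_singleton k0; rewrite /kappa_nu eqxx pt00 => /eqP.
have pos := metric_pos M0 (nbhs_singleton (derive_tangent sf Mf ev)) fv0.
by rewrite mulf_eq0 invr_eq0 (gt_eqF pos) orbF /sigmaS => /eqP ->; rewrite sgr0.
Qed.

Lemma nongeneric_cusp_not_asymptotic (a : R) (c : R^o -> 'rV[R]_4) : nongeneric_space_cusp a c ->
  ~ exists2 f : plane -> 'rV[R]_4, asymptotic_swallowtail a f & along f c.
Proof.
move=> [_ ng] [f /asymptotic_nongeneric/nongeneric_swallowtail_cusp gf fc].
by apply: ng; apply: generic_space_cusp_ext fc gf.
Qed.

End Swallowtail.

(** * Asymptotic swallowtails along a generic cusp *)

Section Conormal.
Context {R : realType}.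
Implicit Types p x y z q X : 'rV[R]_4.

(** The triple vector product of R^4: the coordinates of the linear form [detg p x y]. *)
Definition conormal p x y : 'rV[R]_4 := \row_j detg p x y (delta_mx 0 j).

Lemma detg_linear p x y (c d : R) X Y :
  detg p x y (c *: X + d *: Y) = c * detg p x y X + d * detg p x y Y.
Proof.
apply: (determinant_multilinear (i0 := ord_max)).
- by rewrite !rowK.
- by apply/row_matrixP => i; rewrite !row_rowsub !rowK lift_max; case: i => [[|[|[|//]]] li].
- by apply/row_matrixP => i; rewrite !row_rowsub !rowK lift_max; case: i => [[|[|[|//]]] li].
Qed.

Lemma detgZ p x y (c : R) X : detg p x y (c *: X) = c * detg p x y X.
Proof. by rewrite -[c *: X]addr0 -(scale0r (0 : 'rV_4)) detg_linear mul0r addr0. Qed.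

Lemma detgD p x y X Y : detg p x y (X + Y) = detg p x y X + detg p x y Y.
Proof. by rewrite -[X]scale1r -[Y]scale1r detg_linear !mul1r !scale1r. Qed.

Lemma detg_dependent p x y (k l m : R) : detg p x y (k *: p + l *: x + m *: y) = 0.
Proof.
apply/eqP/negPn/negP => /detg_free H.
have [] := H k l m (-1); first by rewrite scaleN1r subrr.
by move=> _ _ _ /eqP; rewrite oppr_eq0 oner_eq0.
Qed.

Lemma detg_conormal p x y X : detg p x y X = X 0 0 * conormal p x y 0 0 + sdot X (conormal p x y).
Proof.
rewrite sdotE !mxE {1}[X]rV_sum !big_ord_recl big_ord0 addr0 !detgD !detgZ !addrA.
by congr (_ * detg _ _ _ (delta_mx _ _) + _ * detg _ _ _ (delta_mx _ _) + _ * detg _ _ _ (delta_mx _ _)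
  + _ * detg _ _ _ (delta_mx _ _)); rewrite ?[X 0 _]/(X 0 _) //; try (congr (X 0 _)); apply: val_inj.
Qed.

(** The dual of the conormal for the ambient form: the factor [a] in the time coordinate cancels
    a^-1 in the metric. For a = 0 that coordinate is zero, as tangency requires. *)
Definition normal (a : R) p x y : 'rV[R]_4 := let w := conormal p x y in
  row4 (a * w 0 0) (w 0 1) (w 0 2%:R) (w 0 3%:R).

Lemma aform_normal a p x y X : aform a X (normal a p x y) = a * detg p x y X.
Proof. by rewrite detg_conormal /aform !sdotE /normal /row4 !mxE /=; ring. Qed.

Lemma metric_normal a q p x y X : M3 a q -> aform a q X = 0 ->
  metric a X (normal a p x y) = detg p x y X.
Proof.
move=> Mq tX; rewrite detg_conormal /metric !sdotE /normal /row4 !mxE /=.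
have [a0|a0] := eqVneq a 0; first by rewrite (tangent0_time a0 Mq tX); ring.
by field.
Qed.

Lemma normal_neq0 a q p x y e : M3 a q -> detg p x y q = 0 -> detg p x y e != 0 ->
  normal a p x y != 0.
Proof.
move=> [_ Mq] dq de; apply/negP => /eqP n0.
have w1 : conormal p x y 0 1 = 0 by move/rowP/(_ 1): n0; rewrite /normal /row4 !mxE.
have w2 : conormal p x y 0 2%:R = 0 by move/rowP/(_ 2%:R): n0; rewrite /normal /row4 !mxE.
have w3 : conormal p x y 0 3%:R = 0 by move/rowP/(_ 3%:R): n0; rewrite /normal /row4 !mxE.
(* For a = 0 the normal has lost this coordinate. It is recovered from the vanishing of the form on
   q, where only q_0 w_0 remains and q_0 > 0. *)
have w0 : conormal p x y 0 0 = 0.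
  have [a0|a0] := eqVneq a 0.
    move: dq; rewrite detg_conormal sdotE w1 w2 w3 !mulr0 !addr0 => /eqP.
    rewrite mulf_eq0 => /orP[/eqP q0|/eqP //].
    by have := Mq; rewrite a0 lexx q0 ltxx => /(_ isT).
  move/rowP/(_ 0): n0; rewrite /normal /row4 [LHS]mxE [RHS]mxE /= => /eqP.
  by rewrite mulf_eq0 (negbTE a0) => /eqP.
by move/eqP: de; apply; rewrite detg_conormal sdotE w0 w1 w2 w3 !mulr0 !addr0.
Qed.

Lemma smooth_bigsum (V : normedModType R) (I : Type) (r : seq I) (f : I -> V -> R) (v : V) :
  (forall i, smooth_at v (f i)) -> smooth_at v (fun u => \sum_(i <- r) f i u).
Proof.
move=> sf; elim: r => [|i r IH].
  by under eq_fun do rewrite big_nil; exact: smooth_cst.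
by under eq_fun do rewrite big_cons; exact: smooth_add.
Qed.

Lemma smooth_det (V : normedModType R) n (M : V -> 'M[R]_n) (v : V) :
  (forall i j, smooth_at v (fun u => M u i j)) -> smooth_at v (fun u => \det (M u)).
Proof.
move=> sM; apply: smooth_bigsum => s; apply: smooth_mul; first exact: smooth_cst.
exact: smooth_prod.
Qed.

Lemma smooth_detg (V : normedModType R) (P Q S T : V -> 'rV[R]_4) (v : V) :
  smooth_at v P -> smooth_at v Q -> smooth_at v S -> smooth_at v T ->
  smooth_at v (fun u => detg (P u) (Q u) (S u) (T u)).
Proof.
move=> sP sQ sS sT; apply: smooth_det => i j; under eq_fun do rewrite mxE.
by case: i => [[|[|[|[|//]]]] li]; exact: (smooth_coord 0 j).
Qed.

Lemma smooth_normal (V : normedModType R) a (P Q S : V -> 'rV[R]_4) (v : V) :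
  smooth_at v P -> smooth_at v Q -> smooth_at v S ->
  smooth_at v (fun u => normal a (P u) (Q u) (S u)).
Proof.
move=> sP sQ sS.
have sw j : smooth_at v (fun u => conormal (P u) (Q u) (S u) 0 j).
  by under eq_fun do rewrite mxE; apply: smooth_detg => //; exact: smooth_cst.
apply: smooth_rV => i; under eq_fun do rewrite mxE.
case: i => [[|[|[|[|//]]]] li] /=; try exact: sw.
by apply: smooth_mul; [exact: smooth_cst|exact: sw].
Qed.

Lemma smooth_near_neq0 (V : normedModType R) (f : V -> R) (v : V) : smooth_at v f ->
  f v != 0 -> \forall u \near v, f u != 0.
Proof.
move=> sf f0; apply: (@near_smooth R V _ f v (fun y : R => y != 0) sf).
by apply: (@open_near R R [set y : R | y != 0] (f v)); [exact: open_neq|].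
Qed.

End Conormal.

(** * The explicit surface through a cusp *)

Section Sheet.
Context {R : realType}.
Notation plane := ('rV[R]_2).
Implicit Types (V : normedModType R).

Lemma isD_curve V n (p w : V) (X : V -> R) (dX : R) (G : R -> 'rV[R]_n) :
  differentiable X p -> smooth_at (X p) G -> is_derive p w X dX ->
  is_derive p w (fun q => G (X q)) (dX *: der G (X p)).
Proof.
move=> dXp sG DX; have dG := smooth_diff sG.
have DG : is_derive (X p) dX G (dX *: der G (X p)).
  split; first exact: diff_derivable.
  by rewrite derive_R // derE.
exact: (isD_comp DG dXp dG DX).
Qed.

(* With x = t^2, y = t^3, z = 0 this is the cusp t |-> G0(t^2) + t^3 G1(t^2). *)
Definition sheet (G0 G1 V0 V1 : R -> 'rV[R]_4) (x y z : R) : 'rV[R]_4 :=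
  G0 x + y *: G1 x + z *: (V0 x + y *: V1 x).

Lemma smooth_sheet V (p : V) (G0 G1 V0 V1 : R -> 'rV[R]_4) (X Y Z : V -> R) :
  smooth_at p X -> smooth_at p Y -> smooth_at p Z ->
  smooth_at (X p) G0 -> smooth_at (X p) G1 -> smooth_at (X p) V0 -> smooth_at (X p) V1 ->
  smooth_at p (fun q => sheet G0 G1 V0 V1 (X q) (Y q) (Z q)).
Proof.
move=> sX sY sZ s0 s1 s2 s3.
have c0 := smooth_comp_R sX s0; have c1 := smooth_comp_R sX s1.
have c2 := smooth_comp_R sX s2; have c3 := smooth_comp_R sX s3.
exact: (smooth_add (smooth_add c0 (smooth_scale sY c1))
  (smooth_scale sZ (smooth_add c2 (smooth_scale sY c3)))).
Qed.

Lemma isD_sheet V (p w : V) (G0 G1 V0 V1 : R -> 'rV[R]_4) (X Y Z : V -> R) (dX dY dZ : R) :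
  differentiable X p -> smooth_at (X p) G0 -> smooth_at (X p) G1 ->
  smooth_at (X p) V0 -> smooth_at (X p) V1 ->
  is_derive p w X dX -> is_derive p w Y dY -> is_derive p w Z dZ ->
  is_derive p w (fun q => sheet G0 G1 V0 V1 (X q) (Y q) (Z q))
   (dX *: sheet (der G0) (der G1) (der V0) (der V1) (X p) (Y p) (Z p) +
    dY *: (G1 (X p) + Z p *: V1 (X p)) + dZ *: (V0 (X p) + Y p *: V1 (X p))).
Proof.
move=> dXp s0 s1 s2 s3 DX DY DZ.
have D0 := isD_curve dXp s0 DX; have D1 := isD_curve dXp s1 DX.
have D2 := isD_curve dXp s2 DX; have D3 := isD_curve dXp s3 DX.
apply: is_derive_eq (isD_add (isD_add D0 (isD_scale DY D1)) (isD_scale DZ (isD_add D2 (isD_scale DY D3)))) _.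
rewrite /sheet.
move: (G1 (X p)) (V0 (X p)) (V1 (X p)) (der G0 (X p)) (der G1 (X p)) (der V0 (X p)) (der V1 (X p)).
move: (X p) (Y p) (Z p) => x y z A0 A1 A2 B0 B1 B2 B3.
by apply/rowP => i; rewrite !mxE; ring.
Qed.

Variables (G0 G1 V0 V1 : R -> 'rV[R]_4) (d : R).
Hypotheses (s0 : smooth_at (0 : R) G0) (s1 : smooth_at (0 : R) G1).
Hypotheses (s2 : smooth_at (0 : R) V0) (s3 : smooth_at (0 : R) V1).
Hypothesis indep : detg (G0 0) (der G0 0) (G1 0) (V0 0) != 0.

(* The standard swallowtail in the coordinates (u, v), where the first standard
   coordinate is v - 6 u^2 and the second u, followed by the quadratic coordinate
   change of sheet3; d is a free parameter. *)
Definition surf_x (p : plane) : R := p 0 0 ^+ 2 - 6^-1 * p 0 1.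
Definition surf_y (p : plane) : R := p 0 0 ^+ 3 - 4^-1 * (p 0 0 * p 0 1) + d / 12 * p 0 1 ^+ 2.
Definition surf_z (p : plane) : R := 12^-1 * p 0 1 ^+ 2.

Definition surf (p : plane) : 'rV[R]_4 := sheet G0 G1 V0 V1 (surf_x p) (surf_y p) (surf_z p).

(** The term d z vanishes on the singular curve, so it does not move the cusp; it supplies the one
    direction that the other constants cannot reach when V'(0) is made zero. *)
Definition sheet3 (x : 'rV[R]_3) : 'rV[R]_4 :=
  let z := x 0 2%:R + 12^-1 * x 0 0 ^+ 2 in
  sheet G0 G1 V0 V1 (- 6^-1 * x 0 0) (- 4^-1 * x 0 1 + d * z) z.

Definition chart (p : plane) : plane := pt (p 0 1 - 6 * p 0 0 ^+ 2) (p 0 0).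
Definition chart_inv (q : plane) : plane := pt (q 0 1) (q 0 0 + 6 * q 0 1 ^+ 2).

Lemma surf_sheet3 p : surf p = sheet3 (std_swallowtail (chart p)).
Proof.
rewrite /surf /sheet3 std_row3 /row3 !mxE /= /surf_x /surf_y /surf_z.
move: (p 0 0) (p 0 1) => u v.
by congr (sheet _ _ _ _ _ _ _); field.
Qed.

Lemma chartK p : chart_inv (chart p) = p.
Proof. by apply: plane_ext; rewrite /chart_inv /chart !(pt_x, pt_y) //; ring. Qed.

Lemma chart_invK p : chart (chart_inv p) = p.
Proof. by apply: plane_ext; rewrite /chart_inv /chart !(pt_x, pt_y) //; ring. Qed.

Lemma smooth_pt V (p : V) (X Y : V -> R) : smooth_at p X -> smooth_at p Y ->
  smooth_at p (fun q => pt (X q) (Y q)).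
Proof.
by move=> sX sY; apply: smooth_rV => -[[|[|//]] li]; under eq_fun do rewrite mxE.
Qed.

Lemma smooth_entry n (p : 'rV[R]_n) i : smooth_at p (fun q : 'rV[R]_n => q 0 i : R).
Proof. by apply: (smooth_coord (f := fun q => q)); exact: smooth_id. Qed.

Lemma smooth_chart p : smooth_at p chart.
Proof.
apply: smooth_pt; last exact: smooth_entry.
apply: (smooth_add (smooth_entry p 1)); apply: smooth_opp.
by apply: smooth_mul; [exact: smooth_cst|apply: smooth_exp; exact: smooth_entry].
Qed.

Lemma smooth_chart_inv p : smooth_at p chart_inv.
Proof.
apply: smooth_pt; first exact: smooth_entry.
apply: (smooth_add (smooth_entry p 0)).
by apply: smooth_mul; [exact: smooth_cst|apply: smooth_exp; exact: smooth_entry].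
Qed.

Lemma chart_inv0 : chart_inv 0 = 0.
Proof. by apply: plane_ext; rewrite !mxE /= ?expr0n /=; ring. Qed.

Lemma chart0 : chart 0 = 0. Proof. by rewrite -{1}chart_inv0 chart_invK. Qed.

Lemma chart_inv_germ : diffeo_germ setT setT 0 0 chart_inv.
Proof.
split; [exact: chart_inv0|exact: smooth_chart_inv|].
exists chart; split; [exact: chart0|exact: smooth_chart| |]; apply: filterE => p _; split=> //.
  exact: chart_invK.
exact: chartK.
Qed.

Lemma smooth_surf_x p : smooth_at p surf_x.
Proof.
apply: (smooth_add (smooth_exp 2 (smooth_entry p 0))); apply: smooth_opp.
by apply: smooth_mul; [exact: smooth_cst|exact: smooth_entry].
Qed.

Lemma smooth_surf_y p : smooth_at p surf_y.
Proof.
have c (k : R) : smooth_at p (fun _ : plane => k) by exact: smooth_cst.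
apply: (smooth_add _ (smooth_mul (c _) (smooth_exp 2 (smooth_entry p 1)))).
apply: (smooth_add (smooth_exp 3 (smooth_entry p 0))); apply: smooth_opp.
exact: (smooth_mul (c _) (smooth_mul (smooth_entry p 0) (smooth_entry p 1))).
Qed.

Lemma smooth_surf_z p : smooth_at p surf_z.
Proof. by apply: smooth_mul; [exact: smooth_cst|exact: (smooth_exp 2 (smooth_entry p 1))]. Qed.

Lemma surf_coords0 : [/\ surf_x 0 = 0, surf_y 0 = 0 & surf_z 0 = 0].
Proof. by rewrite /surf_x /surf_y /surf_z !mxE !expr0n /= !(mulr0, subr0, addr0). Qed.

Lemma surf_x0 : surf_x 0 = 0. Proof. by case: surf_coords0. Qed.

Lemma near_surf_x (P : R -> Prop) : (\forall x \near (0 : R), P x) -> \forall p \near (0 : plane), P (surf_x p).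
Proof. by rewrite -{1}surf_x0 => nP; exact: (near_smooth (smooth_surf_x 0) nP). Qed.

Lemma smooth_surf : smooth_at 0 surf.
Proof.
by apply: (smooth_sheet (smooth_surf_x 0) (smooth_surf_y 0) (smooth_surf_z 0)); rewrite surf_x0.
Qed.

(** [surfX], [surfY] and [surfZ] are the partial derivatives of [sheet] in its three arguments,
    evaluated along the surface. *)
Definition surfX p := sheet (der G0) (der G1) (der V0) (der V1) (surf_x p) (surf_y p) (surf_z p).
Definition surfY p := G1 (surf_x p) + surf_z p *: V1 (surf_x p).
Definition surfZ p := V0 (surf_x p) + surf_y p *: V1 (surf_x p).

Definition surf_v (p : plane) := (- 6^-1) *: surfX p + (- 4^-1 * p 0 0 + d / 6 * p 0 1) *: surfY p
  + (6^-1 * p 0 1) *: surfZ p.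
Definition surf_h (p : plane) := (- 4^-1 + 2 * d * p 0 0) *: surfY p + (2 * p 0 0) *: surfZ p.

(* The factor v in F_u + 12 u F_v makes v = 0 the singular set. *)
Lemma surf_derive : \forall p \near (0 : plane),
  'D_eu surf p = p 0 1 *: surf_h p - (12 * p 0 0) *: surf_v p /\ 'D_ev surf p = surf_v p.
Proof.
have n0 := near_surf_x (smooth_near s0); have n1 := near_surf_x (smooth_near s1).
have n2 := near_surf_x (smooth_near s2); have n3 := near_surf_x (smooth_near s3).
near=> p.
have x0 : smooth_at (surf_x p) G0 by near: p; exact: n0.
have x1 : smooth_at (surf_x p) G1 by near: p; exact: n1.
have x2 : smooth_at (surf_x p) V0 by near: p; exact: n2.
have x3 : smooth_at (surf_x p) V1 by near: p; exact: n3.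
have D0 w : is_derive p w (fun p : plane => p 0 0) (w 0 0) := isD_coord 0 0 (isD_id p w).
have D1 w : is_derive p w (fun p : plane => p 0 1) (w 0 1) := isD_coord 0 1 (isD_id p w).
have DX w : is_derive p w surf_x (2 * p 0 0 * w 0 0 - 6^-1 * w 0 1).
  by have := D0 w; have := D1 w => H1 H0; rewrite /surf_x /surf_y /surf_z; isde; rewrite /=; ring.
have DY w : is_derive p w surf_y (3 * p 0 0 ^+ 2 * w 0 0 - 4^-1 * (w 0 0 * p 0 1 + p 0 0 * w 0 1) +
    d / 12 * (2 * p 0 1 * w 0 1)).
  by have := D0 w; have := D1 w => H1 H0; rewrite /surf_x /surf_y /surf_z; isde; rewrite /=; ring.
have DZ w : is_derive p w surf_z (6^-1 * p 0 1 * w 0 1).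
  by have := D0 w; have := D1 w => H1 H0; rewrite /surf_x /surf_y /surf_z; isde; rewrite /=; field.
have DS w := isD_sheet (smooth_diff (smooth_surf_x p)) x0 x1 x2 x3 (DX w) (DY w) (DZ w).
have [_ Eu] := DS eu; have [_ Ev] := DS ev.
split.
  apply: etrans Eu _; rewrite -/(surfX p) -/(surfY p) -/(surfZ p) /surf_h /surf_v pt_x pt_y.
  move: (surfX p) (surfY p) (surfZ p) (p 0 0) (p 0 1) => A B C u v.
  by apply/rowP => i; rewrite !mxE; field.
apply: etrans Ev _; rewrite -/(surfX p) -/(surfY p) -/(surfZ p) /surf_v pt_x pt_y.
move: (surfX p) (surfY p) (surfZ p) (p 0 0) (p 0 1) => A B C u v.
by apply/rowP => i; rewrite !mxE; field.
Unshelve. all: by end_near. Qed.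

End Sheet.

(** * Radial projection onto the quadric *)

Section Retraction.
Context {R : realType}.
Variable a : R.
Implicit Types x : 'rV[R]_4.

Definition radial_proj x : 'rV[R]_4 := (Num.sqrt (aform a x x))^-1 *: x.

Lemma M3_open_cone x0 : M3 a x0 -> \forall x \near x0, 0 < aform a x x /\ (a <= 0 -> 0 < x 0 0).
Proof.
move=> Mx0.
have sQ : smooth_at x0 (fun x => aform a x x).
  by apply: smooth_aform; exact: smooth_id.
have Q0 : 0 < aform a x0 x0 by rewrite (M3_aform Mx0).
have nQ : \forall x \near x0, 0 < aform a x x.
  apply: (@near_smooth R _ _ (fun x => aform a x x) x0 (fun y : R => 0 < y) sQ).
  by apply: (@open_near R R [set y : R | 0 < y]); [exact: open_gt|].
have [a0|a0] := leP a 0; last by near=> x; split; [near: x; exact: nQ|].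
have s0 : smooth_at x0 (fun x : 'rV[R]_4 => x 0 0 : R) by exact: smooth_entry.
have n0 : \forall x \near x0, (0 : R) < (x : 'rV[R]_4) 0 0.
  apply: (@near_smooth R _ _ (fun x : 'rV[R]_4 => x 0 0 : R) x0 (fun y : R => 0 < y) s0).
  by apply: (@open_near R R [set y : R | 0 < y]); [exact: open_gt|exact: (Mx0.2 a0)].
by near=> x; split; [near: x; exact: nQ|move=> _; near: x; exact: n0].
Unshelve. all: by end_near. Qed.

Lemma aform_scale2 (k : R) x : aform a (k *: x) (k *: x) = k ^+ 2 * aform a x x.
Proof. by rewrite aformZl aformZr mulrA. Qed.

Lemma radial_proj_M3 x : 0 < aform a x x -> (a <= 0 -> 0 < x 0 0) -> M3 a (radial_proj x).
Proof.
move=> Q0 x0; have sQ : 0 < Num.sqrt (aform a x x) by rewrite sqrtr_gt0.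
split.
  have : aform a (radial_proj x) (radial_proj x) = 1.
    rewrite aform_scale2 exprVn sqr_sqrtr ?(ltW Q0) // mulVf //; exact: lt0r_neq0.
  by rewrite /aform -expr2.
by move=> /x0 x00; rewrite /radial_proj mxE mulr_gt0 // invr_gt0.
Qed.

Lemma smooth_invnorm x0 : M3 a x0 -> smooth_at x0 (fun x => (Num.sqrt (aform a x x))^-1).
Proof.
move=> Mx0; have sQ : smooth_at x0 (fun x => aform a x x).
  by apply: smooth_aform; exact: smooth_id.
by apply: (smooth_invsqrt _ sQ); rewrite (M3_aform Mx0).
Qed.

Lemma smooth_radial_proj x0 : M3 a x0 -> smooth_at x0 radial_proj.
Proof. by move=> Mx0; apply: smooth_scale; [exact: smooth_invnorm|exact: smooth_id]. Qed.

Lemma radial_proj_scale (k : R) x : 0 < k -> M3 a (k *: x) -> radial_proj x = k *: x.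
Proof.
move=> k0 /M3_aform; rewrite aform_scale2 => E; rewrite /radial_proj; congr (_ *: _).
have kn : k != 0 by rewrite gt_eqF.
have -> : aform a x x = k^-1 ^+ 2.
  by apply: (mulfI (expf_neq0 2 kn)); rewrite E -exprMn mulfV // expr1n.
by rewrite sqrtr_sqr ger0_norm ?invrK // invr_ge0 ltW.
Qed.

Lemma radial_proj_id x : M3 a x -> radial_proj x = x.
Proof. by move=> Mx; rewrite -[RHS]scale1r; apply: radial_proj_scale; rewrite ?scale1r. Qed.

End Retraction.

(** * The target chart in which the surface is a standard swallowtail *)

Section ChartGerm.
Context {R : realType}.
Notation plane := ('rV[R]_2).
Variables (a d : R) (G0 G1 V0 V1 : R -> 'rV[R]_4).
Hypotheses (s0 : smooth_at (0 : R) G0) (s1 : smooth_at (0 : R) G1).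
Hypotheses (s2 : smooth_at (0 : R) V0) (s3 : smooth_at (0 : R) V1).
Hypothesis indep : detg (G0 0) (der G0 0) (G1 0) (V0 0) != 0.
Hypothesis M0 : M3 a (G0 0).
Local Notation L := (sheet3 G0 G1 V0 V1 d).

Lemma sheet0 (A0 A1 A2 A3 : R -> 'rV[R]_4) : sheet A0 A1 A2 A3 0 0 0 = A0 0.
Proof. by rewrite /sheet !scale0r !addr0. Qed.

Lemma L0 : L 0 = G0 0.
Proof. by rewrite /sheet3 !mxE expr0n /= !(mulr0, addr0) sheet0. Qed.

Lemma smooth_L : smooth_at 0 L.
Proof.
have c (k : R) : smooth_at (0 : 'rV[R]_3) (fun=> k) by exact: smooth_cst.
have e i := smooth_entry (0 : 'rV[R]_3) i.
have sz := smooth_add (e 2%:R) (smooth_mul (c 12^-1) (smooth_exp 2 (e 0))).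
have sx := smooth_mul (c (- 6^-1)) (e 0).
have sy := smooth_add (smooth_mul (c (- 4^-1)) (e 1)) (smooth_mul (c d) sz).
by apply: (smooth_sheet sx sy sz); rewrite mxE mulr0.
Qed.

(* A local diffeomorphism of R^4 whose inverse provides the chart of M3. *)
Definition cone_map (w : 'rV[R]_4) : 'rV[R]_4 := (1 + w 0 3%:R) *: L (row3 (w 0 0) (w 0 1) (w 0 2%:R)).

Lemma row3_00 : row3 ((0 : 'rV[R]_4) 0 0) ((0 : 'rV[R]_4) 0 1) ((0 : 'rV[R]_4) 0 2%:R) = 0.
Proof. by rewrite !mxE row3_0. Qed.

Lemma cone_map0 : cone_map 0 = G0 0.
Proof. by rewrite /cone_map row3_00 mxE addr0 scale1r L0. Qed.

Lemma smooth_cone_map : smooth_at 0 cone_map.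
Proof.
have e i := smooth_entry (0 : 'rV[R]_4) i.
apply: smooth_scale; first by apply: smooth_add => //; exact: smooth_cst.
apply: (smooth_comp_rV (smooth_row3 (e 0) (e 1) (e 2%:R))).
by rewrite row3_00; exact: smooth_L.
Qed.

Lemma cone_map_inj w : 'd cone_map 0 w = 0 -> w = 0.
Proof.
rewrite -(deriveE _ (smooth_diff smooth_cone_map)).
have e i : is_derive 0 w (fun w : 'rV[R]_4 => w 0 i) (w 0 i) := isD_coord 0 i (isD_id 0 w).
pose X (w : 'rV[R]_4) : R := - 6^-1 * w 0 0.
pose Z (w : 'rV[R]_4) : R := w 0 2%:R + 12^-1 * w 0 0 ^+ 2.
pose Y (w : 'rV[R]_4) : R := - 4^-1 * w 0 1 + d * Z w.
have X0 : X 0 = 0 by rewrite /X mxE mulr0.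
have Z0 : Z 0 = 0 by rewrite /Z !mxE expr0n mulr0 addr0.
have Y0 : Y 0 = 0 by rewrite /Y Z0 mxE !mulr0 addr0.
have DX : is_derive 0 w X (- 6^-1 * w 0 0) by have := e 0 => e0; rewrite /X; isde; ring.
have DZ : is_derive 0 w Z (w 0 2%:R).
  by have := e 0; have := e 2%:R => e2 e0; rewrite /Z; isde; rewrite !mxE /=; ring.
have DY : is_derive 0 w Y (- 4^-1 * w 0 1 + d * w 0 2%:R).
  by have := e 1 => e1; rewrite /Y; isde; ring.
have sX : smooth_at 0 X by apply: smooth_mul; [exact: smooth_cst|exact: smooth_entry].
have DL := isD_sheet (smooth_diff sX) (G0 := G0) (G1 := G1) (V0 := V0) (V1 := V1).
rewrite X0 in DL; have {}DL := DL _ _ _ _ _ _ s0 s1 s2 s3 DX DY DZ.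
rewrite Y0 Z0 sheet0 !scale0r !addr0 in DL.
have D1 : is_derive 0 w (fun w : 'rV[R]_4 => 1 + w 0 3%:R) (w 0 3%:R).
  by have := e 3%:R => e3; isde; ring.
have D2 := isD_scale D1 DL.
have D3 : is_derive 0 w cone_map (w 0 3%:R *: G0 0 + 1 *: ((- 6^-1 * w 0 0) *: der G0 0 +
    (- 4^-1 * w 0 1 + d * w 0 2%:R) *: G1 0 + w 0 2%:R *: V0 0)).
  move: D2; rewrite X0 Y0 Z0 sheet0 mxE addr0 => D2.
  have <- : (fun y : 'rV[R]_4 => (1 + y 0 3%:R) *: sheet G0 G1 V0 V1 (X y) (Y y) (Z y)) = cone_map.
    by apply/funext => y; rewrite /cone_map /sheet3 /row3 !mxE.
  exact: D2.
have [_ ->] := D3; rewrite scale1r !addrA => /(detg_free indep)[w3 w0 w1 w2].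
have {}w0 : w 0 0 = 0 by lra.
have {}w1 : w 0 1 = 0 by move: w1; rewrite w2 mulr0; lra.
apply/rowP => i; rewrite [RHS]mxE.
by case: i => [[|[|[|[|//]]]] li]; [rewrite -[RHS]w0|rewrite -[RHS]w1|rewrite -[RHS]w2|rewrite -[RHS]w3];
  congr (w _ _); apply: val_inj.
Qed.

Definition Psi_chart (x : 'rV[R]_3) := radial_proj a (L x).

Lemma Psi_chart0 : Psi_chart 0 = G0 0.
Proof. by rewrite /Psi_chart L0 radial_proj_id. Qed.

Lemma near_L_cone : \forall x \near (0 : 'rV[R]_3), 0 < aform a (L x) (L x) /\ (a <= 0 -> 0 < L x 0 0).
Proof.
apply: (@near_smooth R _ _ L 0 (fun x => 0 < aform a x x /\ (a <= 0 -> 0 < x 0 0)) smooth_L).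
by rewrite L0; exact: M3_open_cone.
Qed.

Lemma smooth_Psi_chart : smooth_at 0 Psi_chart.
Proof. by apply: (smooth_comp_rV smooth_L); rewrite L0; exact: smooth_radial_proj. Qed.

(** The image of Psi is a hypersurface, so the inverse function theorem is applied in R^4 to
    [cone_map], whose fourth coordinate is a radial factor; Phi forgets that factor. A point of the
    quadric near G0(0) is a positive multiple of some L(x), hence equals its radial projection. *)
Lemma Psi_chart_germ : exists Phi : 'rV[R]_4 -> 'rV[R]_3,
  diffeo_germ (M3 a) setT (G0 0) 0 Phi /\ \forall x \near (0 : 'rV[R]_3), Phi (Psi_chart x) = x.
Proof.
have [H [H0 sH HK KH]] := inverse_function smooth_cone_map cone_map_inj.
rewrite cone_map0 in H0 sH KH.
pose Phi y := row3 (H y 0 0) (H y 0 1) (H y 0 2%:R).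
have sPhi : smooth_at (G0 0) Phi.
  by apply: smooth_row3; exact: smooth_coord.
have Phi0 : Phi (G0 0) = 0 by rewrite /Phi H0 row3_00.
pose mu x := (Num.sqrt (aform a (L x) (L x)))^-1.
have smu : smooth_at 0 mu.
  apply: (@smooth_comp_rV_R R _ _ L (fun x => (Num.sqrt (aform a x x))^-1)); first exact: smooth_L.
  by rewrite L0; exact: smooth_invnorm.
have mu0 : mu 0 = 1 by rewrite /mu L0 (M3_aform M0) sqrtr1 invr1.
(* The last coordinate makes the radial factor 1 + w_3 equal to the normalising factor mu(x), so
   that [cone_map (W x)] is Psi(x). *)
pose W (x : 'rV[R]_3) := row4 (x 0 0) (x 0 1) (x 0 2%:R) (mu x - 1).
have W0 : W 0 = 0.
  apply/rowP => i; rewrite /W /row4 !mxE mu0 subrr.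
  by case: i => [[|[|[|[|//]]]] li].
have sW : smooth_at 0 W.
  apply: smooth_rV => i; under eq_fun do rewrite mxE.
  case: i => [[|[|[|[|//]]]] li] /=; try exact: smooth_entry.
  by apply: smooth_add => //; exact: smooth_cst.
have EW x : cone_map (W x) = Psi_chart x.
  rewrite /cone_map /W /row4 !mxE /= addrCA subrr addr0 /Psi_chart /radial_proj /mu; congr (_ *: L _).
  by apply/rowP => i; rewrite /row3 mxE; case: i => [[|[|[|//]]] li]; congr (x _ _); apply: val_inj.
have PhiK : \forall x \near (0 : 'rV[R]_3), Phi (Psi_chart x) = x.
  have nW : \forall x \near (0 : 'rV[R]_3), H (cone_map (W x)) = W x.
    by apply: (@near_smooth R _ _ W 0 (fun w => H (cone_map w) = w) sW); rewrite W0.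
  apply: filterS nW => x; rewrite EW => HE; rewrite /Phi HE /W /row4 !mxE /=.
  by apply/rowP => i; rewrite /row3 mxE; case: i => [[|[|[|//]]] li]; congr (x _ _); apply: val_inj.
exists Phi; split=> //; split=> //; exists Psi_chart; split.
- exact: Psi_chart0.
- exact: smooth_Psi_chart.
- have sk : smooth_at (G0 0) (fun x => 1 + H x 0 3%:R).
    by apply: smooth_add; [exact: smooth_cst|exact: (smooth_coord 0 3%:R sH)].
  have nk : \forall x \near G0 0, 0 < 1 + H x 0 3%:R.
    apply: (@near_smooth R _ _ (fun x => 1 + H x 0 3%:R) (G0 0) (fun y : R => 0 < y) sk).
    by apply: (@open_near R R [set y : R | 0 < y]); [exact: open_gt|rewrite /= H0 mxE addr0].
  near=> x => Mx; split=> //.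
  have E : cone_map (H x) = x by near: x; exact: KH.
  have k0 : 0 < 1 + H x 0 3%:R by near: x; exact: nk.
  by rewrite -[RHS]E /Psi_chart; apply: radial_proj_scale => //; rewrite -/(cone_map (H x)) E.
- near=> x => _; split; last by near: x; exact: PhiK.
  have [q0 x0] : 0 < aform a (L x) (L x) /\ (a <= 0 -> 0 < L x 0 0) by near: x; exact: near_L_cone.
  exact: radial_proj_M3.
Unshelve. all: by end_near. Qed.

End ChartGerm.

(** * The projected surface is an asymptotic swallowtail *)

Section AsymptoticSheet.
Context {R : realType}.
Notation plane := ('rV[R]_2).
Variables (a d : R) (G0 G1 V0 V1 : R -> 'rV[R]_4).
Hypotheses (s0 : smooth_at (0 : R) G0) (s1 : smooth_at (0 : R) G1).
Hypotheses (s2 : smooth_at (0 : R) V0) (s3 : smooth_at (0 : R) V1).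
Hypothesis indep : detg (G0 0) (der G0 0) (G1 0) (V0 0) != 0.
Let Gam (t : R) : 'rV[R]_4 := G0 (t ^+ 2) + t ^+ 3 *: G1 (t ^+ 2).
Local Notation F := (surf G0 G1 V0 V1 d).
Local Notation Fv := (surf_v G0 G1 V0 V1 d).
Local Notation Fh := (surf_h G1 V0 V1 d).
Hypothesis HM : \forall t \near (0 : R), M3 a (Gam t).
(** [HV] serves the curvature at 0, which is defined through f_vv, and [HD] the curvature at u != 0,
    defined through f_uu, the second derivative of the cusp. *)
Hypothesis HV : der (der G0) 0 + 6 *: V0 0 = 0.
Hypothesis HD : \forall t \near (0 : R), detg (Gam t) (Fv (pt t 0)) (Fh (pt t 0)) (der (der Gam) t) = 0.

Definition sheet_map (p : plane) : 'rV[R]_4 := radial_proj a (F p).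
Local Notation f := sheet_map.
Let m (p : plane) : R := (Num.sqrt (aform a (F p) (F p)))^-1.

Lemma Gam0 : Gam 0 = G0 0.
Proof. by rewrite /Gam !expr0n /= scale0r addr0. Qed.

Lemma M3_G0 : M3 a (G0 0). Proof. by rewrite -Gam0; exact: nbhs_singleton HM. Qed.

Lemma surf_axis (t : R) : F (pt t 0) = Gam t.
Proof.
rewrite /surf /sheet /surf_x /surf_y /surf_z pt_x pt_y !(expr0n, mulr0, subr0, addr0) /=.
by rewrite ?(mulr0, addr0, subr0) !scale0r addr0.
Qed.

Lemma surf0 : F 0 = G0 0. Proof. by rewrite -pt00 surf_axis Gam0. Qed.

Lemma m0 : m 0 = 1. Proof. by rewrite /m surf0 (M3_aform M3_G0) sqrtr1 invr1. Qed.

Lemma smooth_surf0 : smooth_at 0 F. Proof. exact: smooth_surf. Qed.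

Lemma smooth_scale_factor : smooth_at 0 m.
Proof.
apply: (@smooth_comp_rV_R R _ _ F (fun x => (Num.sqrt (aform a x x))^-1) 0 smooth_surf0).
by rewrite surf0; exact: smooth_invnorm M3_G0.
Qed.

Lemma smooth_sheet_map : smooth_at 0 f.
Proof. exact: (smooth_scale smooth_scale_factor smooth_surf0). Qed.

Lemma M3_sheet_map : \forall p \near (0 : plane), M3 a (f p).
Proof.
have n : \forall p \near (0 : plane), 0 < aform a (F p) (F p) /\ (a <= 0 -> 0 < F p 0 0).
  apply: (@near_smooth R _ _ F 0 (fun x => 0 < aform a x x /\ (a <= 0 -> 0 < x 0 0)) smooth_surf0).
  by rewrite surf0; exact: M3_open_cone M3_G0.
by apply: filterS n => p [Q0 p0]; exact: radial_proj_M3.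
Qed.

Lemma scale_gt0 : \forall p \near (0 : plane), 0 < m p.
Proof.
apply: (@near_smooth R _ _ m 0 (fun y : R => 0 < y) smooth_scale_factor).
by apply: (@open_near R R [set y : R | 0 < y]); [exact: open_gt|rewrite /= m0].
Qed.

Lemma sheet_mapE p : f p = m p *: F p. Proof. by []. Qed.

Lemma sheet_map0 : f 0 = G0 0.
Proof. by rewrite sheet_mapE m0 scale1r surf0. Qed.

Lemma sheet_map_axis : \forall t \near (0 : R), f (pt t 0) = Gam t.
Proof. by apply: filterS HM => t Mt; rewrite /sheet_map surf_axis radial_proj_id. Qed.

Lemma smooth_surfX : smooth_at 0 (surfX G0 G1 V0 V1 d).
Proof.
have D (A : R -> 'rV[R]_4) : smooth_at (0 : R) A -> smooth_at (surf_x (0 : plane)) (der A).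
  by move=> sA; rewrite surf_x0; have := smooth_der sA.
exact: (smooth_sheet (smooth_surf_x 0) (smooth_surf_y d 0) (smooth_surf_z 0) (D _ s0) (D _ s1) (D _ s2) (D _ s3)).
Qed.

Lemma smooth_surfY : smooth_at 0 (surfY G1 V1).
Proof.
have c1 : smooth_at 0 (fun p : plane => G1 (surf_x p)) by apply: (smooth_comp_R (smooth_surf_x 0)); rewrite surf_x0.
have c3 : smooth_at 0 (fun p : plane => V1 (surf_x p)) by apply: (smooth_comp_R (smooth_surf_x 0)); rewrite surf_x0.
exact: (smooth_add c1 (smooth_scale (smooth_surf_z 0) c3)).
Qed.

Lemma smooth_surfZ : smooth_at 0 (surfZ V0 V1 d).
Proof.
have c2 : smooth_at 0 (fun p : plane => V0 (surf_x p)) by apply: (smooth_comp_R (smooth_surf_x 0)); rewrite surf_x0.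
have c3 : smooth_at 0 (fun p : plane => V1 (surf_x p)) by apply: (smooth_comp_R (smooth_surf_x 0)); rewrite surf_x0.
exact: (smooth_add c2 (smooth_scale (smooth_surf_y d 0) c3)).
Qed.

Lemma smooth_surf_v : smooth_at 0 Fv.
Proof.
have c (k : R) : smooth_at (0 : plane) (fun=> k) by exact: smooth_cst.
have e i := smooth_entry (0 : plane) i.
exact: (smooth_add (smooth_add (smooth_scale (c _) smooth_surfX)
  (smooth_scale (smooth_add (smooth_mul (c _) (e 0)) (smooth_mul (c _) (e 1))) smooth_surfY))
  (smooth_scale (smooth_mul (c _) (e 1)) smooth_surfZ)).
Qed.

Lemma smooth_surf_h : smooth_at 0 Fh.
Proof.
have c (k : R) : smooth_at (0 : plane) (fun=> k) by exact: smooth_cst.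
have e i := smooth_entry (0 : plane) i.
exact: (smooth_add (smooth_scale (smooth_add (c _) (smooth_mul (c _) (e 0))) smooth_surfY)
  (smooth_scale (smooth_mul (c _) (e 0)) smooth_surfZ)).
Qed.

Lemma surf_v0 : Fv 0 = - 6^-1 *: der G0 0.
Proof.
rewrite /surf_v !mxE !mulr0 addr0 !scale0r !addr0 /surfX.
by have [-> -> ->] := @surf_coords0 R d; rewrite sheet0.
Qed.

Lemma surfY0 : surfY G1 V1 0 = G1 0.
Proof. by rewrite /surfY; have [-> _ ->] := @surf_coords0 R d; rewrite scale0r addr0. Qed.

Lemma surfZ0 : surfZ V0 V1 d 0 = V0 0.
Proof. by rewrite /surfZ; have [-> -> _] := @surf_coords0 R d; rewrite scale0r addr0. Qed.

Lemma surf_h0 : Fh 0 = - 4^-1 *: G1 0.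
Proof. by rewrite /surf_h !mxE !mulr0 addr0 scale0r addr0 surfY0. Qed.

Lemma near_indep : \forall p \near (0 : plane), detg (F p) (Fv p) (Fh p) (V0 0) != 0.
Proof.
apply: (smooth_near_neq0 (f := fun p => detg (F p) (Fv p) (Fh p) (V0 0))).
  by apply: smooth_detg; [exact: smooth_surf0|exact: smooth_surf_v|exact: smooth_surf_h|exact: smooth_cst].
rewrite surf0 surf_v0 surf_h0; apply: free_detg => k l n o.
rewrite !scalerA => /(detg_free indep)[-> l0 n0 ->]; split=> //; lra.
Qed.

Lemma sheet_map_derive : \forall p \near (0 : plane),
  'D_ev f p = 'D_ev m p *: F p + m p *: Fv p /\
  'D_eu f p = 'D_eu m p *: F p + m p *: (p 0 1 *: Fh p - (12 * p 0 0) *: Fv p).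
Proof.
have nd := surf_derive d s0 s1 s2 s3; have nm := smooth_near smooth_scale_factor; have nF := smooth_near smooth_surf0.
near=> p.
have sm : smooth_at p m by near: p; exact: nm.
have sFp : smooth_at p F by near: p; exact: nF.
have [Eu Ev] : 'D_eu F p = p 0 1 *: Fh p - (12 * p 0 0) *: Fv p /\ 'D_ev F p = Fv p.
  by near: p; exact: nd.
have [_ Du] := isD_scale (smooth_isD eu sm) (smooth_isD eu sFp).
have [_ Dv] := isD_scale (smooth_isD ev sm) (smooth_isD ev sFp).
split; [apply: etrans Dv _|apply: etrans Du _].
  by rewrite Ev.
by rewrite Eu.
Unshelve. all: by end_near. Qed.

(** For F the relation F_u = - 12 u F_v on the axis is immediate. Scaling by m adds multiples of F,
    but f_u and f_v are both tangent and f is not, so the surplus multiple of f vanishes. *)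
Lemma axis_relation : \forall p \near (0 : plane), (p : plane) 0 1 = 0 ->
  'D_eu f p = - (12 * p 0 0) *: 'D_ev f p.
Proof.
have nd := sheet_map_derive; have nM := M3_sheet_map; have nm := scale_gt0.
have nt : \forall p \near (0 : plane), aform a (f p) ('D_eu f p) = 0 /\ aform a (f p) ('D_ev f p) = 0.
  exact: (filterI (derive_tangent smooth_sheet_map nM eu) (derive_tangent smooth_sheet_map nM ev)).
near=> p => p1.
have [Ev Eu] : 'D_ev f p = 'D_ev m p *: F p + m p *: Fv p /\
  'D_eu f p = 'D_eu m p *: F p + m p *: (p 0 1 *: Fh p - (12 * p 0 0) *: Fv p) by near: p; exact: nd.
have Mp : M3 a (f p) by near: p; exact: nM.
have mp : 0 < m p by near: p; exact: nm.
have [tu tv] : aform a (f p) ('D_eu f p) = 0 /\ aform a (f p) ('D_ev f p) = 0 by near: p; exact: nt.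
have key (x y A B : 'rV[R]_4) (k l n u : R) : aform a x x = 1 -> x = n *: A -> n != 0 ->
   y = l *: A + n *: B -> aform a x y = 0 ->
   aform a x (k *: A + n *: (0 *: A - u *: B)) = 0 -> k *: A + n *: (0 *: A - u *: B) = - u *: y.
  move=> xx xA n0 yE xy.
  have -> : k *: A + n *: (0 *: A - u *: B) = - u *: y + ((k + u * l) / n) *: x.
    by rewrite yE xA; apply/rowP => i; rewrite !mxE; field.
  by rewrite aformDr !aformZr xy xx mulr0 add0r mulr1 => ->; rewrite scale0r addr0.
have Eu' : 'D_eu f p = 'D_eu m p *: F p + m p *: (0 *: F p - (12 * p 0 0) *: Fv p).
  by apply: etrans Eu _; rewrite p1 !scale0r.
refine (etrans Eu' _).
apply: (key _ _ _ _ _ _ _ _ (M3_aform Mp) (sheet_mapE p) (lt0r_neq0 mp) Ev tv).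
exact: etrans (congr1 _ (esym Eu')) tu.
Unshelve. all: by end_near. Qed.

Lemma sheet_map_admissible : admissible f.
Proof.
have nd := sheet_map_derive; have na := axis_relation; have nm := scale_gt0; have ni := near_indep.
near=> p.
have [Ev Eu] : 'D_ev f p = 'D_ev m p *: F p + m p *: Fv p /\
  'D_eu f p = 'D_eu m p *: F p + m p *: (p 0 1 *: Fh p - (12 * p 0 0) *: Fv p) by near: p; exact: nd.
have ax : p 0 1 = 0 -> 'D_eu f p = - (12 * p 0 0) *: 'D_ev f p by near: p; exact: na.
have mp : 0 < m p by near: p; exact: nm.
have ip : detg (F p) (Fv p) (Fh p) (V0 0) != 0 by near: p; exact: ni.
split=> [/negP nf|/ax E].
  apply/eqP/negPn/negP => v0; apply: nf; apply/free2P => k l.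
  rewrite /du /dv Eu Ev => E.
  have E' : (k * 'D_eu m p + l * 'D_ev m p) *: F p + (m p * (l - k * (12 * p 0 0))) *: Fv p +
     (m p * (k * p 0 1)) *: Fh p + 0 *: V0 0 = 0.
    rewrite -[RHS]E; move: (F p) (Fv p) (Fh p) ('D_eu m p) ('D_ev m p) => x y z b c.
    by apply/rowP => i; rewrite !mxE; ring.
  have [_ /eqP l0 /eqP k0 _] := detg_free ip E'.
  move: k0; rewrite !mulf_eq0 (negbTE v0) (gt_eqF mp) orbF /= => /eqP k0.
  by move: l0; rewrite k0 mul0r subr0 mulf_eq0 (gt_eqF mp) => /eqP.
apply/negP => /free2P/(_ 1 (12 * p 0 0)) H.
have [] := H; last by move=> /eqP; rewrite oner_eq0.
by rewrite /du /dv E scale1r -scalerDl addNr scale0r.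
Unshelve. all: by end_near. Qed.

Lemma sheet_map_swallowtail : swallowtail a f.
Proof.
have [Phi [gP PhiK]] := Psi_chart_germ d s0 s1 s2 s3 indep M3_G0.
split; [exact: smooth_sheet_map|exact: M3_sheet_map| |exact: sheet_map_admissible].
exists chart_inv, Phi; split; [exact: chart_inv_germ|by rewrite sheet_map0|].
have nK : \forall p \near (0 : plane), Phi (Psi_chart a d G0 G1 V0 V1 (std_swallowtail p)) = std_swallowtail p.
  apply: (@near_smooth R _ _ std_swallowtail 0
    (fun x => Phi (Psi_chart a d G0 G1 V0 V1 x) = x) (smooth_std 0)).
  by rewrite std_row3 !mxE !expr0n /= !mulr0 !addr0 row3_0.
by apply: filterS nK => p; rewrite /sheet_map surf_sheet3 chart_invK.
Qed.

Definition sheet_normal (p : plane) : 'rV[R]_4 := normal a (F p) (Fv p) (Fh p).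
Local Notation nrm := sheet_normal.

Lemma smooth_sheet_normal : smooth_at 0 nrm.
Proof. exact: (smooth_normal a smooth_surf0 smooth_surf_v smooth_surf_h). Qed.

(* Since F_u + 12 u F_v = v h, the covector detg(F, F_v, h, .) annihilates f, f_u and f_v. *)
Lemma sheet_normal_spec : \forall p \near (0 : plane),
  [/\ aform a (f p) (nrm p) = 0, 0 < metric a (nrm p) (nrm p),
     metric a ('D_eu f p) (nrm p) = 0, metric a ('D_ev f p) (nrm p) = 0 &
     forall X, aform a (f p) X = 0 -> metric a X (nrm p) = detg (F p) (Fv p) (Fh p) X].
Proof.
have nd := sheet_map_derive; have nM := M3_sheet_map; have ni := near_indep.
have nt : \forall p \near (0 : plane), aform a (f p) ('D_eu f p) = 0 /\ aform a (f p) ('D_ev f p) = 0.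
  exact: (filterI (derive_tangent smooth_sheet_map nM eu) (derive_tangent smooth_sheet_map nM ev)).
near=> p.
have [Ev Eu] : 'D_ev f p = 'D_ev m p *: F p + m p *: Fv p /\
  'D_eu f p = 'D_eu m p *: F p + m p *: (p 0 1 *: Fh p - (12 * p 0 0) *: Fv p) by near: p; exact: nd.
have Mp : M3 a (f p) by near: p; exact: nM.
have ip : detg (F p) (Fv p) (Fh p) (V0 0) != 0 by near: p; exact: ni.
have [tu tv] : aform a (f p) ('D_eu f p) = 0 /\ aform a (f p) ('D_ev f p) = 0 by near: p; exact: nt.
have spec X : aform a (f p) X = 0 -> metric a X (nrm p) = detg (F p) (Fv p) (Fh p) X.
  exact: metric_normal Mp.
have df : detg (F p) (Fv p) (Fh p) (f p) = 0.
  rewrite sheet_mapE; have := detg_dependent (F p) (Fv p) (Fh p) (m p) 0 0.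
  by rewrite !scale0r !addr0.
have tn : aform a (f p) (nrm p) = 0 by rewrite aform_normal df mulr0.
split=> //.
- exact: (metric_pos Mp tn (normal_neq0 Mp df ip)).
- apply: etrans (spec _ tu) _; rewrite Eu.
  rewrite -[RHS](detg_dependent (F p) (Fv p) (Fh p) ('D_eu m p) (- (m p * (12 * p 0 0))) (m p * p 0 1)).
  congr (detg _ _ _ _); move: (F p) (Fv p) (Fh p) ('D_eu m p) (m p) (p 0 0) (p 0 1) => x y z b c u v.
  by apply/rowP => i; rewrite !mxE; ring.
- apply: etrans (spec _ tv) _; rewrite Ev.
  rewrite -[RHS](detg_dependent (F p) (Fv p) (Fh p) ('D_ev m p) (m p) 0).
  by rewrite scale0r addr0.
Unshelve. all: by end_near. Qed.

Lemma sheet_map_eu0 : 'D_eu f 0 = 0.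
Proof.
have := nbhs_singleton axis_relation; rewrite !mxE mulr0 oppr0 => H.
by apply: etrans (H erefl) _; rewrite scale0r.
Qed.

Lemma surf_vv_alg (X A P Q B D1 C D2 H : 'rV[R]_4) (e1 e2 : R) : A + 6 *: C = 0 ->
  e1 = 0 -> e2 = 0 -> H = - 4^-1 *: B ->
  0 *: X + - 6^-1 *: (- 6^-1 *: A + 0 *: P + 0 *: Q) + (d / 6 *: B + e1 *: D1) + (6^-1 *: C + e2 *: D2) =
  (- (2 / 3 * d)) *: H.
Proof.
move=> /rowP E -> -> ->; apply/rowP => i; move: (E i); rewrite !mxE => e.
have -> : A 0 i = - 6 * C 0 i by lra.
by field.
Qed.

(** At 0, F_vv is (G0'' + 6 V0) / 36 + (d / 6) G1. [HV] removes the first part, and h(0) = - G1(0) /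
    4 turns the second into - (2 d / 3) h(0). *)
Lemma surf_vv : is_derive 0 ev Fv ((- (2 / 3 * d)) *: Fh 0).
Proof.
have D i : is_derive 0 ev (fun p : plane => p 0 i) (ev 0 i) := isD_coord 0 i (isD_id 0 ev).
have D0 := D 0; have D1 := D 1; rewrite !mxE /= in D0 D1.
have DX : is_derive 0 ev surf_x (- 6^-1 : R) by rewrite /surf_x; isde; rewrite !mxE /=; ring.
have DY : is_derive 0 ev (surf_y d) (0 : R) by rewrite /surf_y; isde; rewrite !mxE /=; ring.
have DZ : is_derive 0 ev surf_z (0 : R) by rewrite /surf_z; isde; rewrite !mxE /=; ring.
have t0 : smooth_at (surf_x (0 : plane)) (der G0) by rewrite surf_x0; have := smooth_der s0.
have t1 : smooth_at (surf_x (0 : plane)) (der G1) by rewrite surf_x0; have := smooth_der s1.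
have t2 : smooth_at (surf_x (0 : plane)) (der V0) by rewrite surf_x0; have := smooth_der s2.
have t3 : smooth_at (surf_x (0 : plane)) (der V1) by rewrite surf_x0; have := smooth_der s3.
have DA := isD_sheet (smooth_diff (smooth_surf_x 0)) t0 t1 t2 t3 DX DY DZ.
have DB := smooth_isD ev smooth_surfY; have DC := smooth_isD ev smooth_surfZ.
have c1 : is_derive 0 ev (fun p : plane => - 4^-1 * p 0 0 + d / 6 * p 0 1) (d / 6).
  by isde; rewrite !mxE /=; ring.
have c2 : is_derive 0 ev (fun p : plane => 6^-1 * p 0 1) (6^-1).
  by isde; rewrite !mxE /=; ring.
apply: is_derive_eq (isD_add (isD_add (isD_scale (isD_cstR 0 ev (- 6^-1)) DA) (isD_scale c1 DB)) (isD_scale c2 DC)) _.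
apply: surf_vv_alg.
- have [-> -> ->] := @surf_coords0 R d; rewrite surfZ0 sheet0; exact: HV.
- by rewrite !mxE !mulr0 addr0.
- by rewrite !mxE mulr0.
- by rewrite surf_h0 surfY0.
Qed.


(** Modulo F and F_v, f_u is m v h, so its v-derivative at 0 is h(0). This makes f_uv, f_v and the
    normal a frame, as the orientation condition needs. *)
Lemma sheet_map_uv : exists k l, 'D_ev ('D_eu f) 0 = k *: F 0 + l *: Fv 0 + Fh 0.
Proof.
have D i : is_derive 0 ev (fun p : plane => p 0 i) (ev 0 i) := isD_coord 0 i (isD_id 0 ev).
have D0 := D 0; have D1 := D 1; rewrite !mxE /= in D0 D1.
have c2 : is_derive 0 ev (fun p : plane => - (12 * p 0 0)) (0 : R) by isde; ring.
have DF := smooth_isD ev smooth_surf0; have Dm := smooth_isD ev smooth_scale_factor.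
have Dh := smooth_isD ev smooth_surf_h; have Dv := smooth_isD ev smooth_surf_v.
have Dmu := smooth_isD ev (smooth_derive eu smooth_scale_factor).
have E : \forall p \near (0 : plane), 'D_eu f p =
    'D_eu m p *: F p + m p *: (p 0 1 *: Fh p + (- (12 * p 0 0)) *: Fv p).
  by apply: filterS sheet_map_derive => p [_ e]; apply: etrans e _; rewrite scaleNr.
have [_ E1] := isD_add (isD_scale Dmu DF) (isD_scale Dm (isD_add (isD_scale D1 Dh) (isD_scale c2 Dv))).
have Fv0 : 'D_ev F 0 = Fv 0 by have [] := nbhs_singleton (surf_derive d s0 s1 s2 s3).
have alg (x y z dx t w : 'rV[R]_4) (b c e o o' q : R) : q = 1 -> o = 0 -> o' = 0 -> dx = y ->
    b *: x + c *: dx + (e *: (o *: z + o' *: y) + q *: (1 *: z + o *: t + (0 *: y + o' *: w))) =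
    b *: x + c *: y + z.
  by move=> -> -> -> ->; apply/rowP => i; rewrite !mxE; ring.
exists ('D_ev ('D_eu m) 0), ('D_eu m 0).
have o : (0 : plane) 0 1 = 0 by rewrite mxE.
have o' : - (12 * (0 : plane) 0 0) = 0 by rewrite mxE mulr0 oppr0.
have A := alg (F 0) (Fv 0) (Fh 0) ('D_ev F 0) ('D_ev Fh 0) ('D_ev Fv 0) ('D_ev ('D_eu m) 0) ('D_eu m 0)
  ('D_ev m 0) _ _ (m 0) m0 o o' Fv0.
exact: (etrans (near_eq_derive _ E) (etrans E1 A)).
Qed.

Lemma sheet_map_vv : exists k l n, 'D_ev ('D_ev f) 0 = k *: F 0 + l *: Fv 0 + n *: Fh 0.
Proof.
have DF := smooth_isD ev smooth_surf0; have Dm := smooth_isD ev smooth_scale_factor.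
have Dmv := smooth_isD ev (smooth_derive ev smooth_scale_factor).
have E : \forall p \near (0 : plane), 'D_ev f p = 'D_ev m p *: F p + m p *: Fv p.
  by apply: filterS sheet_map_derive => p [].
have [_ E1] := isD_add (isD_scale Dmv DF) (isD_scale Dm surf_vv).
have Fv0 : 'D_ev F 0 = Fv 0 by have [] := nbhs_singleton (surf_derive d s0 s1 s2 s3).
have alg (x y z dx : 'rV[R]_4) (b c q e : R) : dx = y ->
    b *: x + c *: dx + (c *: y + q *: (e *: z)) = b *: x + (c + c) *: y + (q * e) *: z.
  by move=> ->; apply/rowP => i; rewrite !mxE; ring.
exists ('D_ev ('D_ev m) 0), ('D_ev m 0 + 'D_ev m 0), (m 0 * (- (2 / 3 * d))).
have A := alg (F 0) (Fv 0) (Fh 0) ('D_ev F 0) ('D_ev ('D_ev m) 0) ('D_ev m 0) (m 0) (- (2 / 3 * d)) Fv0.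
exact: (etrans (near_eq_derive _ E) (etrans E1 A)).
Qed.

(** The covariant correction is a multiple of f = m F, which the determinant with row F annihilates;
    ordinary second derivatives suffice. *)
Lemma cov_normal w w' : \forall p \near (0 : plane),
  metric a (cov a f w' ('D_w f) p) (nrm p) = detg (F p) (Fv p) (Fh p) ('D_w' ('D_w f) p).
Proof.
have sfw : smooth_at 0 ('D_w f) by have := smooth_derive w smooth_sheet_map.
have nf := smooth_near smooth_sheet_map; have nfw := smooth_near sfw.
have nM := near_join M3_sheet_map.
have nt := near_join (derive_tangent smooth_sheet_map M3_sheet_map w).
have ns := sheet_normal_spec.
near=> p.
have fp : smooth_at p f by near: p; exact: nf.
have fwp : smooth_at p ('D_w f) by near: p; exact: nfw.
have Mp : \forall q \near p, M3 a (f q) by near: p; exact: nM.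
have tp : \forall q \near p, aform a (f q) ('D_w f q) = 0 by near: p; exact: nt.
have [_ _ _ _ spec] : [/\ aform a (f p) (nrm p) = 0, 0 < metric a (nrm p) (nrm p),
     metric a ('D_eu f p) (nrm p) = 0, metric a ('D_ev f p) (nrm p) = 0 &
     forall X, aform a (f p) X = 0 -> metric a X (nrm p) = detg (F p) (Fv p) (Fh p) X].
  by near: p; exact: ns.
have tc := cov_tangent w' (smooth_diff fp) (smooth_diff fwp) Mp tp.
apply: etrans (spec _ tc) _.
rewrite /cov detgD detgZ sheet_mapE detgZ.
have := detg_dependent (F p) (Fv p) (Fh p) 1 0 0.
by rewrite scale1r !scale0r !addr0 => ->; rewrite !mulr0 addr0.
Unshelve. all: by end_near. Qed.

Lemma detg_shear (p y z n : 'rV[R]_4) (k l k' : R) : detg p y z n != 0 ->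
  detg p (k *: p + l *: y + z) (k' *: p + y) n != 0.
Proof.
move=> d0; apply: free_detg => b c e g E.
have E' : (b + c * k + e * k') *: p + (c * l + e) *: y + c *: z + g *: n = 0.
  by rewrite -E; apply/rowP => i; rewrite !mxE; ring.
have [b0 e0 c0 g0] := detg_free d0 E'; rewrite c0 mul0r add0r in e0.
by move: b0; rewrite c0 e0 !mul0r !addr0 => ->.
Qed.

(** The sign that turns the nonzero frame determinant into the positive one prescribed by
    [unit_normal]. *)
Let sg : R := Num.sg (detg (f 0) (cov a f ev (du f) 0) (dv f 0) (nrm 0)).
Let kn (p : plane) : R := sg * (Num.sqrt (metric a (nrm p) (nrm p)))^-1.
Definition sheet_unit_normal (p : plane) : 'rV[R]_4 := kn p *: nrm p.

Lemma sheet_frame_detg : detg (f 0) (cov a f ev (du f) 0) (dv f 0) (nrm 0) != 0.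
Proof.
have [t0 n0 _ _ spec] := nbhs_singleton sheet_normal_spec.
have d0 : detg (F 0) (Fv 0) (Fh 0) (nrm 0) != 0 by rewrite -(spec _ t0) gt_eqF.
have [k [l E]] := sheet_map_uv.
have -> : cov a f ev (du f) 0 = k *: F 0 + l *: Fv 0 + Fh 0.
  exact: etrans (cov_eu0 a sheet_map_eu0) E.
have -> : dv f 0 = 'D_ev m 0 *: F 0 + Fv 0.
  have [Ev _] := nbhs_singleton sheet_map_derive.
  by apply: etrans Ev _; rewrite m0 scale1r.
have -> : f 0 = F 0 by rewrite sheet_map0 surf0.
exact: detg_shear.
Qed.

Lemma sheet_map_unit_normal : unit_normal a f sheet_unit_normal.
Proof.
have nz := sheet_frame_detg.
have sg0 : sg != 0 by rewrite /sg sgr_eq0.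
have [t0 n0 _ _ spec] := nbhs_singleton sheet_normal_spec.
have sN : smooth_at 0 (fun p => metric a (nrm p) (nrm p)).
  by apply: smooth_metric; exact: smooth_sheet_normal.
split.
- have sk : smooth_at 0 kn.
    have c : smooth_at (0 : plane) (fun=> sg) by exact: smooth_cst.
    exact: (smooth_mul c (smooth_invsqrt (f := fun p => metric a (nrm p) (nrm p)) n0 sN)).
  exact: (smooth_scale sk smooth_sheet_normal).
- apply: filterS sheet_normal_spec => p [tp np up vp _].
  rewrite /sheet_unit_normal; split.
  + by apply/tangentE; rewrite aformZr tp mulr0.
  + rewrite metricZl metricZr mulrA -expr2 exprMn exprVn sqr_sqrtr ?(ltW np) //.
    rewrite /sg sqr_sg nz mul1r mulVf //; exact: lt0r_neq0.
  + by rewrite metricZr [X in _ * X]up mulr0.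
  + by rewrite metricZr [X in _ * X]vp mulr0.
- rewrite /sheet_unit_normal detgZ /kn mulrAC mulr_gt0 //.
    by rewrite /sg -normrEsg normr_gt0.
  by rewrite invr_gt0 sqrtr_gt0.
Qed.

Lemma sheet_map_kappa : \forall u \near (0 : R), kappa_nu a f sheet_unit_normal u = 0.
Proof.
have nc := near_axis (cov_normal eu eu); have nu0 := near_axis (smooth_near smooth_sheet_map).
have sdu : smooth_at 0 ('D_eu f) by have := smooth_derive eu smooth_sheet_map.
have nu1 := near_axis (smooth_near sdu).
have na := near_join sheet_map_axis.
have nF : \forall u \near (0 : R), 'D_eu f (pt u 0) = der Gam u.
  near=> u.
  have su : smooth_at (pt u 0) f by near: u; exact: nu0.
  have e : \forall v \near u, f (pt v 0) = Gam v by near: u; exact: na.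
  exact: etrans (esym (der_val (isD_axis (smooth_diff su)))) (der_near e).
have nF' := near_join nF.
near=> u.
rewrite /kappa_nu; case: (u =P 0) => [u0|_].
  rewrite u0 pt00.
  have -> : metric a (cov a f ev (dv f) 0) (sheet_unit_normal 0) = 0; last by rewrite mul0r.
  rewrite /sheet_unit_normal metricZr.
  have [k [l [n E]]] := sheet_map_vv.
  have -> : metric a (cov a f ev (dv f) 0) (nrm 0) = 0; last by rewrite mulr0.
  apply: etrans (nbhs_singleton (cov_normal ev ev)) _.
  by rewrite E detg_dependent.
have C : metric a (cov a f eu ('D_eu f) (pt u 0)) (nrm (pt u 0)) =
  detg (F (pt u 0)) (Fv (pt u 0)) (Fh (pt u 0)) ('D_eu ('D_eu f) (pt u 0)) by near: u; exact: nc.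
have su : smooth_at (pt u 0) ('D_eu f) by near: u; exact: nu1.
have e : \forall v \near u, 'D_eu f (pt v 0) = der Gam v by near: u; exact: nF'.
have E := etrans (esym (der_val (isD_axis (smooth_diff su)))) (der_near e).
have Du : detg (Gam u) (Fv (pt u 0)) (Fh (pt u 0)) (der (der Gam) u) = 0 by near: u; exact: HD.
have -> : metric a (cov a f eu (du f) (pt u 0)) (sheet_unit_normal (pt u 0)) = 0; last by rewrite mul0r.
rewrite /sheet_unit_normal metricZr.
have -> : metric a (cov a f eu (du f) (pt u 0)) (nrm (pt u 0)) = 0; last by rewrite mulr0.
by apply: etrans C _; rewrite E surf_axis.
Unshelve. all: by end_near. Qed.

Lemma sheet_map_asymptotic : asymptotic_swallowtail a f.
Proof.
split; first exact: sheet_map_swallowtail.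
by exists sheet_unit_normal; [exact: sheet_map_unit_normal|exact: sheet_map_kappa].
Qed.

End AsymptoticSheet.

Local Opaque der.

(** * Choice of the coefficients for a given generic cusp *)

Section CuspToSwallowtail.
Context {R : realType}.
Variables (a : R) (c : R -> 'rV[R]_4).
Hypothesis gc : generic_space_cusp a c.
Variables (G0 G1 : R -> 'rV[R]_4).
Hypotheses (s0 : smooth_at (0 : R) G0) (s1 : smooth_at (0 : R) G1).
Let Gam (t : R) : 'rV[R]_4 := G0 (t ^+ 2) + t ^+ 3 *: G1 (t ^+ 2).
Hypothesis cE : \forall t \near (0 : R), c t = Gam t.

(** The smooth extension of gamma'(t) / t across 0, with [Z1] its derivative; gamma'' is then Z + t
    Z1. *)
Let Z (t : R) : 'rV[R]_4 := 2 *: der G0 (t ^+ 2) + (3 * t) *: G1 (t ^+ 2) + (2 * t ^+ 3) *: der G1 (t ^+ 2).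
Let Z1 (t : R) : 'rV[R]_4 := (4 * t) *: der (der G0) (t ^+ 2) + 3 *: G1 (t ^+ 2)
  + (12 * t ^+ 2) *: der G1 (t ^+ 2) + (4 * t ^+ 4) *: der (der G1) (t ^+ 2).

Lemma smooth_sq (t : R) : smooth_at t (fun t : R => t ^+ 2 : R).
Proof. exact: (smooth_exp 2 (smooth_id t)). Qed.

Lemma smooth_comp_sq (A : R -> 'rV[R]_4) : smooth_at (0 : R) A -> smooth_at (0 : R) (fun t => A (t ^+ 2)).
Proof.
move=> sA; have sA' : smooth_at ((0 : R) ^+ 2) A by rewrite expr0n.
exact: (smooth_comp_R (smooth_sq 0) sA').
Qed.

Lemma near_sq (P : R -> Prop) : (\forall t \near (0 : R), P t) -> \forall t \near (0 : R), P (t ^+ 2).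
Proof.
move=> nP; apply: (@near_smooth R _ _ (fun t : R => t ^+ 2 : R) 0 P (smooth_sq 0)).
by rewrite expr0n.
Qed.

Lemma isD_comp_sq (A : R -> 'rV[R]_4) (t : R) : smooth_at (t ^+ 2) A ->
  is_derive t 1 (fun t => A (t ^+ 2)) ((2 * t) *: der A (t ^+ 2)).
Proof.
move=> sA; have D : is_derive t 1 (fun t : R => t ^+ 2) (2 * t).
  by have := isD_idR t 1 => D; isde; rewrite /=; ring.
exact: (isD_curve (smooth_diff (smooth_sq t)) sA D).
Qed.

Let t0 := smooth_der s0.
Let t1 := smooth_der s1.
Let tt0 := smooth_der t0.
Let tt1 := smooth_der t1.

Let cst (k t : R) : smooth_at t (fun _ : R => k). Proof. exact: smooth_cst. Qed.
Let mono (k : R) n (t : R) : smooth_at t (fun t => k * t ^+ n).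
Proof. by apply: smooth_mul; [exact: cst|exact: (smooth_exp n (smooth_id t))]. Qed.
Let lin (k t : R) : smooth_at t (fun t => k * t).
Proof. by apply: smooth_mul; [exact: cst|exact: smooth_id]. Qed.

Lemma smooth_Gam : smooth_at (0 : R) Gam.
Proof.
exact: (smooth_add (smooth_comp_sq s0) (smooth_scale (smooth_exp 3 (smooth_id (0 : R))) (smooth_comp_sq s1))).
Qed.

Lemma smooth_Z : smooth_at (0 : R) Z.
Proof.
exact: (smooth_add (smooth_add (smooth_scale (cst 2 0) (smooth_comp_sq t0))
  (smooth_scale (lin 3 0) (smooth_comp_sq s1))) (smooth_scale (mono 2 3 0) (smooth_comp_sq t1))).
Qed.

Lemma smooth_Z1 : smooth_at (0 : R) Z1.
Proof.
exact: (smooth_add (smooth_add (smooth_add (smooth_scale (lin 4 0) (smooth_comp_sq tt0))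
  (smooth_scale (cst 3 0) (smooth_comp_sq s1))) (smooth_scale (mono 12 2 0) (smooth_comp_sq t1)))
  (smooth_scale (mono 4 4 0) (smooth_comp_sq tt1))).
Qed.

Lemma der_Gam : \forall t \near (0 : R), der Gam t = t *: Z t.
Proof.
have n0 := near_sq (smooth_near s0); have n1 := near_sq (smooth_near s1).
near=> t.
have x0 : smooth_at (t ^+ 2) G0 by near: t; exact: n0.
have x1 : smooth_at (t ^+ 2) G1 by near: t; exact: n1.
have D3 : is_derive t 1 (fun t : R => t ^+ 3) (3 * t ^+ 2) by have := isD_idR t 1 => D; isde; rewrite /=; ring.
apply: etrans (der_val (isD_add (isD_comp_sq x0) (isD_scale D3 (isD_comp_sq x1)))) _.
rewrite /Z; move: (der G0 (t ^+ 2)) (der G1 (t ^+ 2)) (G1 (t ^+ 2)) => x y z.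
by apply/rowP => i; rewrite !mxE; ring.
Unshelve. all: by end_near. Qed.

Lemma der_Z : \forall t \near (0 : R), der Z t = Z1 t.
Proof.
apply: filterS3 (near_sq (smooth_near t0)) (near_sq (smooth_near s1)) (near_sq (smooth_near t1)).
move=> t x0 x1 x2.
have D := isD_idR t 1.
have D1 : is_derive t 1 (fun t : R => 3 * t) (3 : R) by isde; ring.
have D3 : is_derive t 1 (fun t : R => 2 * t ^+ 3) (6 * t ^+ 2) by isde; rewrite /=; ring.
apply: etrans (der_val (isD_add (isD_add (isD_scale (isD_cstR t (1 : R) 2) (isD_comp_sq x0))
  (isD_scale D1 (isD_comp_sq x1))) (isD_scale D3 (isD_comp_sq x2)))) _.
rewrite /Z1.
move: (der (der G0) (t ^+ 2)) (der (der G1) (t ^+ 2)) (der G0 (t ^+ 2)) (der G1 (t ^+ 2)) (G1 (t ^+ 2)).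
by move=> x y z v w; apply/rowP => i; rewrite !mxE; ring.
Qed.

Let cusp_jet_sum (x y z w : 'rV[R]_4) (t : R) : x = y -> x + (1 *: z + t *: w) = y + (z + t *: w).
Proof. by move=> ->; rewrite scale1r. Qed.

Lemma der2_Gam : \forall t \near (0 : R), der (der Gam) t = Z t + t *: Z1 t.
Proof.
apply: filterS3 (near_der der_Gam) (smooth_near smooth_Z) der_Z => t e1 sZ e2.
apply: etrans e1 (etrans (der_val (isD_scale (isD_idR t 1) (isD_der sZ))) _).
by apply: (f_equal2 +%R (scale1r (Z t)) (congr1 (fun x => t *: x) e2)).
Qed.

Lemma der3_Gam : \forall t \near (0 : R), der (der (der Gam)) t = Z1 t + (Z1 t + t *: der Z1 t).
Proof.
apply: filterS2 (filterI (near_der der2_Gam) (smooth_near smooth_Z)) (filterI der_Z (smooth_near smooth_Z1)).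
move=> t [e1 sZ] [e2 sZ1].
exact: (etrans e1 (etrans (der_val (isD_add (isD_der sZ) (isD_scale (isD_idR t 1) (isD_der sZ1))))
  (cusp_jet_sum (Z1 t) (der Z1 t) t e2))).
Qed.

Let sq0 : (0 : R) ^+ 2 = 0. Proof. by rewrite expr0n. Qed.
Let at_sq0 (A : R -> 'rV[R]_4) : smooth_at (0 : R) A -> smooth_at ((0 : R) ^+ 2) A.
Proof. by rewrite sq0. Qed.

Lemma der_Z1_0 : der Z1 0 = 4 *: der (der G0) 0.
Proof.
have D := isD_idR (0 : R) 1.
have D1 : is_derive (0 : R) 1 (fun t : R => 4 * t) (4 : R) by isde; ring.
have D2 : is_derive (0 : R) 1 (fun t : R => 12 * t ^+ 2) (0 : R) by isde; rewrite /=; ring.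
have D4 : is_derive (0 : R) 1 (fun t : R => 4 * t ^+ 4) (0 : R) by isde; rewrite /= expr0n /=; ring.
have alg (A A' B B' C C' E E' : 'rV[R]_4) (o k k2 k4 : R) : o = 0 ->
    4 *: A + k *: (o *: A') + (0 *: B + 3 *: (o *: B')) + (0 *: C + k2 *: (o *: C')) + (0 *: E + k4 *: (o *: E'))
    = 4 *: A.
  by move=> ->; apply/rowP => i; rewrite !mxE; ring.
have V := der_val (isD_add (isD_add (isD_add (isD_scale D1 (isD_comp_sq (at_sq0 tt0)))
  (isD_scale (isD_cstR (0 : R) (1 : R) 3) (isD_comp_sq (at_sq0 s1))))
  (isD_scale D2 (isD_comp_sq (at_sq0 t1)))) (isD_scale D4 (isD_comp_sq (at_sq0 tt1)))).
refine (etrans V (etrans (alg _ _ _ _ _ _ _ _ _ _ _ _ (mulr0 2)) _)).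
exact: (congr1 (fun s => 4 *: der (der G0) s) sq0).
Qed.

Let mulr_0exp (k : R) n : (0 < n)%N -> k * 0 ^+ n = 0.
Proof. by move=> n0; rewrite expr0n eqn0Ngt n0 mulr0. Qed.

Lemma Gam_0 : Gam 0 = G0 0. Proof. by rewrite /Gam !expr0n /= scale0r addr0. Qed.
Lemma Z_0 : Z 0 = 2 *: der G0 0.
Proof.
have alg (x y z : 'rV[R]_4) (k q : R) : k = 0 -> q = 0 -> 2 *: x + k *: y + q *: z = 2 *: x.
  by move=> -> ->; rewrite !scale0r !addr0.
refine (etrans (alg _ _ _ _ _ (mulr0 3) (@mulr_0exp 2 3%N isT)) _).
exact: (congr1 (fun s => 2 *: der G0 s) sq0).
Qed.

Lemma Z1_0 : Z1 0 = 3 *: G1 0.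
Proof.
have alg (x y z w : 'rV[R]_4) (k q r : R) : k = 0 -> q = 0 -> r = 0 ->
    k *: x + 3 *: y + q *: z + r *: w = 3 *: y.
  by move=> -> -> ->; rewrite !scale0r !addr0 add0r.
refine (etrans (alg _ _ _ _ _ _ _ (mulr0 4) (@mulr_0exp 12 2%N isT) (@mulr_0exp 4 4%N isT)) _).
exact: (congr1 (fun s => 3 *: G1 s) sq0).
Qed.

Lemma der4_Gam0 : der (der (der (der Gam))) 0 = 12 *: der (der G0) 0.
Proof.
have D := isD_der smooth_Z1; have D' := isD_der (smooth_der smooth_Z1).
have alg (x y w : 'rV[R]_4) : x = 4 *: y -> x + (x + (1 *: x + 0 *: w)) = 12 *: y.
  by move=> ->; apply/rowP => i; rewrite !mxE; ring.
have V := der_val (isD_add D (isD_add D (isD_scale (isD_idR (0 : R) 1) D'))).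
exact: (etrans (der_near der3_Gam) (etrans V (alg _ _ _ der_Z1_0))).
Qed.

(** The second, third and fourth derivatives of gamma at 0 are 2 G0', 6 G1 and 12 G0'', so
    genericity is independence of G0, G0', G1, G0'' at 0. *)
Lemma generic_jets : detg (G0 0) (der G0 0) (G1 0) (der (der G0) 0) != 0.
Proof.
have [[sc Mc cv _] fr] := gc.
have c0 : velocity c 0 = 0 by have [_ ->] := nbhs_singleton cv.
have n2 := near_der (near_der cE); have n3 := near_der n2; have n4 := near_der n3.
have e2 : der (der Gam) 0 = 2 *: der G0 0.
  have alg (x y z : 'rV[R]_4) : x = z -> x + 0 *: y = z by move=> ->; rewrite scale0r addr0.
  exact: (etrans (nbhs_singleton der2_Gam) (alg _ _ _ Z_0)).
have e3 : der (der (der Gam)) 0 = 6 *: G1 0.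
  have alg (x y z : 'rV[R]_4) : x = 3 *: z -> x + (x + 0 *: y) = 6 *: z.
    by move=> ->; apply/rowP => i; rewrite !mxE; ring.
  exact: (etrans (nbhs_singleton der3_Gam) (alg _ _ _ Z1_0)).
have d0 := detg_neq0_eq (etrans (nbhs_singleton cE) Gam_0) (etrans (nbhs_singleton n2) e2)
  (etrans (nbhs_singleton n3) e3) (etrans (nbhs_singleton n4) der4_Gam0) (detg_of_generic_cusp sc Mc c0 fr).
apply: free_detg => k l n o E.
have [] := detg_free (a := k) (b := l / 2) (c := n / 6) (d := o / 12) d0.
  by rewrite !scalerA !divfK // pnatr_eq0.
move=> -> l0 n0 o0; split=> //; lra.
Qed.

(** The rows are gamma, F_v, h and gamma'' on the axis. Modulo p and z the last two are la z1 and t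
    z1, so - t and la are the coefficients of a linear relation; it is nontrivial also at t = 0
    because la is nonzero there. *)
Lemma detg_limit (p z z1 : 'rV[R]_4) (t la k l : R) : (t = 0 -> la != 0) ->
  detg p (- 12^-1 *: z) (la *: z1 + k *: p + l *: z) (z + t *: z1) = 0.
Proof.
move=> H; apply/eqP/negPn/negP => d0.
have [] := detg_free (a := t * k) (b := 12 * (la - t * l)) (c := - t) (d := la) d0.
  by apply/rowP => i; rewrite !mxE; field.
by move=> _ _ /eqP; rewrite oppr_eq0 => /eqP /H /negP la0 la0'; apply: la0; rewrite la0'.
Qed.

Lemma generic_cusp_swallowtail_of_normal_form : exists2 f : 'rV[R]_2 -> 'rV[R]_4,
  asymptotic_swallowtail a f & along f c.
Proof.
have gj := generic_jets.
have [al' [be' [de' [ep E1]]]] := detg_span (3 *: der G1 0) gj.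
(* With V as below, - 6 V'(0) = 3 G1' - 8 d G0'' + al G0 + 2 be G0' + 3 de G1 at 0. Expanding 3
   G1'(0) in the basis of [generic_jets] determines the four constants. *)
pose d := ep / 8; pose al := - al'; pose be := - be' / 2; pose de := - de' / 3.
(* V makes h = (-1/4 + 2 d t) G1(t^2) + 2 t V t a combination of gamma, gamma' / t and
   (gamma' / t)', and the constants are fixed by V' 0 = 0. *)
pose W (t : R) := der (der G0) (t ^+ 2) + (3 * t) *: der G1 (t ^+ 2) + (1 * t ^+ 3) *: der (der G1) (t ^+ 2).
pose U (t : R) := al *: Gam t + be *: Z t + de *: Z1 t.
pose V (t : R) : 'rV[R]_4 := (- 6^-1) *: ((1 + (- 8 * d) * t) *: W t + t *: U t).
have sW : smooth_at (0 : R) W.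
  exact: (smooth_add (smooth_add (smooth_comp_sq tt0) (smooth_scale (lin 3 0) (smooth_comp_sq t1)))
    (smooth_scale (mono 1 3 0) (smooth_comp_sq tt1))).
have sU : smooth_at (0 : R) U.
  exact: (smooth_add (smooth_add (smooth_scale (cst al 0) smooth_Gam) (smooth_scale (cst be 0) smooth_Z))
    (smooth_scale (cst de 0) smooth_Z1)).
have sk : smooth_at (0 : R) (fun t : R => 1 + (- 8 * d) * t) by exact: (smooth_add (cst 1 0) (lin (- 8 * d) 0)).
have sV : smooth_at (0 : R) V.
  exact: (smooth_scale (cst (- 6^-1) 0) (smooth_add (smooth_scale sk sW) (smooth_scale (smooth_id (0 : R)) sU))).
have W0 : W 0 = der (der G0) 0.
  have alg (x y z : 'rV[R]_4) (k q : R) : k = 0 -> q = 0 -> x + k *: y + q *: z = x.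
    by move=> -> ->; rewrite !scale0r !addr0.
  exact: (etrans (alg _ _ _ _ _ (mulr0 3) (@mulr_0exp 1 3%N isT)) (congr1 (fun s => der (der G0) s) sq0)).
have U0 : U 0 = al *: G0 0 + be *: (2 *: der G0 0) + de *: (3 *: G1 0) by rewrite /U Gam_0 Z_0 Z1_0.
have D := isD_idR (0 : R) 1.
have dW0 : der W 0 = 3 *: der G1 0.
  have D1 : is_derive (0 : R) 1 (fun t : R => 3 * t) (3 : R) by isde; ring.
  have D3 : is_derive (0 : R) 1 (fun t : R => 1 * t ^+ 3) (0 : R) by isde; rewrite /= expr0n /=; ring.
  have alg (A B B' C C' : 'rV[R]_4) (o k k3 : R) : o = 0 ->
      o *: A + (3 *: B + k *: (o *: B')) + (0 *: C + k3 *: (o *: C')) = 3 *: B.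
    by move=> ->; apply/rowP => i; rewrite !mxE; ring.
  have E := der_val (isD_add (isD_add (isD_comp_sq (at_sq0 tt0)) (isD_scale D1 (isD_comp_sq (at_sq0 t1))))
    (isD_scale D3 (isD_comp_sq (at_sq0 tt1)))).
  refine (etrans E (etrans (alg _ _ _ _ _ _ _ _ (mulr0 2)) _)).
  exact: (congr1 (fun s => 3 *: der G1 s) sq0).
have dV0 : der V 0 = 0.
  have Dk : is_derive (0 : R) 1 (fun t : R => 1 + (- 8 * d) * t) (- 8 * d) by isde; ring.
  have alg (x y z v w dw u du X g : 'rV[R]_4) (k o : R) : k = 1 -> w = v -> dw = g ->
      u = al *: x + be *: (2 *: y) + de *: (3 *: z) -> g = al' *: x + be' *: y + de' *: z + ep *: v ->
      0 *: X + (- 6^-1) *: (((- 8 * d) *: w + k *: dw) + (1 *: u + 0 *: du)) = 0.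
    by move=> -> -> -> -> ->; apply/rowP => i; rewrite !mxE /d /al /be /de; field.
  have E := der_val (isD_scale (isD_cstR (0 : R) (1 : R) (- 6^-1)) (isD_add (isD_scale Dk (isD_der sW))
    (isD_scale D (isD_der sU)))).
  have k1 : 1 + (- 8 * d) * 0 = 1 by rewrite mulr0 addr0.
  exact: (etrans E (alg _ _ _ _ _ _ _ _ _ _ _ 0 k1 W0 dW0 U0 E1)).
(* V'(0) = 0 is exactly what allows V(t) to be written as V0(x) + y V1(x) on the curve x = t^2, y =
   t^3. *)
have [V0 [V1 [sV0 sV1 VE]]] := cusp_decomposition_rV sV (etrans (derE V 0) dV0).
have V00 : V0 0 = - 6^-1 *: der (der G0) 0.
  have := nbhs_singleton VE; rewrite !expr0n /= scale0r addr0 => <-.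
  by rewrite /V W0 mulr0 addr0 scale1r scale0r addr0.
have indep : detg (G0 0) (der G0 0) (G1 0) (V0 0) != 0.
  apply: free_detg => k l n o; rewrite V00 scalerA => /(detg_free gj)[-> -> -> o0].
  by split=> //; lra.
have [[sc Mc _ _] _] := gc.
have HM : \forall t \near (0 : R), M3 a (Gam t) by apply: filterS2 cE Mc => t <-.
have HV : der (der G0) 0 + 6 *: V0 0 = 0.
  by rewrite V00; move: (der (der G0) 0) => x; apply/rowP => i; rewrite !mxE; field.
have HD : \forall t \near (0 : R), detg (Gam t) (surf_v G0 G1 V0 V1 d (pt t 0)) (surf_h G1 V0 V1 d (pt t 0))
    (der (der Gam) t) = 0.
  have n2 := der2_Gam; near=> t.
  have -> : der (der Gam) t = Z t + t *: Z1 t by near: t; exact: n2.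
  have Vt : V t = V0 (t ^+ 2) + t ^+ 3 *: V1 (t ^+ 2) by near: t; exact: VE.
  have Xt : surf_x (pt t 0) = t ^+ 2 by rewrite /surf_x pt_x pt_y mulr0 subr0.
  have Yt : surf_y d (pt t 0) = t ^+ 3 by rewrite /surf_y pt_x pt_y expr0n /= !mulr0 subr0 addr0.
  have Zt : surf_z (pt t 0) = 0 by rewrite /surf_z pt_y expr0n mulr0.
  have -> : surf_v G0 G1 V0 V1 d (pt t 0) = - 12^-1 *: Z t.
    rewrite /surf_v /surfX /surfY Xt Yt Zt pt_x pt_y /sheet !mulr0 !scale0r !addr0 /Z.
    move: (der G0 (t ^+ 2)) (der G1 (t ^+ 2)) (G1 (t ^+ 2)) => x y z.
    by apply/rowP => i; rewrite !mxE; field.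
  (* Since Z1 = 3 G1 + 4 t W, inserting V gives h = - (1 - 8 d t) Z1 / 12 - t^2 U / 3. [la] collects
     the coefficient of Z1, including the part de of U. *)
  pose la := - 12^-1 * (1 + (- 8 * d) * t) - 3^-1 * t ^+ 2 * de.
  have -> : surf_h G1 V0 V1 d (pt t 0) = la *: Z1 t + (- 3^-1 * t ^+ 2 * al) *: Gam t +
     (- 3^-1 * t ^+ 2 * be) *: Z t.
    rewrite /surf_h /surfY /surfZ Xt Yt Zt pt_x -Vt scale0r addr0 /V /W /U /la.
    move: (Gam t) (Z t) => p z; rewrite /Z1.
    move: (der (der G0) (t ^+ 2)) (der (der G1) (t ^+ 2)) (der G1 (t ^+ 2)) (G1 (t ^+ 2)) => x y w q.
    by apply/rowP => i; rewrite !mxE; field.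
  apply: detg_limit => t0'; rewrite /la t0' expr0n /= !mulr0 mul0r subr0 addr0 mulr1.
  by rewrite oppr_eq0 invr_eq0 pnatr_eq0.
exists (sheet_map a d G0 G1 V0 V1).
  exact: (sheet_map_asymptotic s0 s1 sV0 sV1 indep HM HV HD).
by apply: filterS2 (sheet_map_axis d V0 V1 HM) cE => t -> ->.
Unshelve. all: by end_near. Qed.

End CuspToSwallowtail.

Lemma generic_cusp_swallowtail (R : realType) (a : R) (c : R^o -> 'rV[R]_4) : generic_space_cusp a c ->
  exists2 f : 'rV[R]_2 -> 'rV[R]_4, asymptotic_swallowtail a f & along f c.
Proof.
move=> gc; have [[sc _ cv _] _] := gc.
have c0 : velocity c 0 = 0 by have [_ ->] := nbhs_singleton cv.
have [G0 [G1 [s0 s1 cE]]] := cusp_decomposition_rV sc c0.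
exact: (generic_cusp_swallowtail_of_normal_form gc s0 s1 cE).
Qed.

Theorem mainTheorem4 (R : realType) (a : R) :
  (forall f : 'rV[R]_2 -> 'rV[R]_4,
     nongeneric_swallowtail a f ->
     generic_space_cusp a (fun u : R^o => f (pt u 0))) /\
  (forall c : R^o -> 'rV[R]_4, nongeneric_space_cusp a c ->
     ~ exists2 f : 'rV[R]_2 -> 'rV[R]_4,
         asymptotic_swallowtail a f & along f c) /\
  (forall c : R^o -> 'rV[R]_4, generic_space_cusp a c ->
     exists2 f : 'rV[R]_2 -> 'rV[R]_4,
       asymptotic_swallowtail a f & along f c).
Proof.
split; first exact: nongeneric_swallowtail_cusp.
split; first exact: nongeneric_cusp_not_asymptotic.
exact: generic_cusp_swallowtail.
Qed.
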